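(* Let $n\ge 4$ and let $L\subset S^3$ be an oriented link with $L=\hat b$ for an $n$-braid $b\in B_n$ admitting an exchange move, i.e. $b=\alpha\beta$ with $\alpha\in\langle\sigma_1,\dots,\sigma_{n-2}\rangle$ and $\beta\in\langle\sigma_2,\dots,\sigma_{n-1}\rangle$. Assume that the braid permutation satisfies $\pi(b)(1)\ne 1$ and $\pi(b)(n)\ne n$. Then iterated exchange moves on $b$ generate infinitely many pairwise non-conjugate braid representations of $L$: among the braids $b_m=\alpha\kappa^m\beta\kappa^{-m}$, $m\in\mathbb{Z}$ (all of which have closure $L$), there are infinitely many pairwise non-conjugate elements of $B_n$.
   Context: $B_n$ is the braid group on $n$ strands with Artin generators $\sigma_1,\dots,\sigma_{n-1}$ (in $\sigma_i$ strands $i$ and $i+1$ cross); strands are numbered from left to right and oriented downward, and $\alpha\beta$ means $\alpha$ stacked on top of $\beta$. The closure of $b$ is the oriented link $\hat b\subset S^3$; $b\in B_n$ is an $n$-braid representation of $L$ if $\hat b=L$. The braid permutation $\pi(b)\in S_n$ sends $k$ to the lower end position of the strand of $b$ starting at upper position $k$; $\pi(\sigma_i)=(i,\,i+1)$. Exchange move ($n\ge 4$): $b\in B_n$ admits an exchange move if $b=\alpha\beta$ with $\alpha$ a braid on the first $n-1$ strands ($\alpha\in\langle\sigma_1,\dots,\sigma_{n-2}\rangle$) and $\beta$ a braid on the last $n-1$ strands ($\beta\in\langle\sigma_2,\dots,\sigma_{n-1}\rangle$). The exchange moves replace $b=\alpha\beta$ by $b_m=\alpha\kappa^m\beta\kappa^{-m}$,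 $m\in\mathbb{Z}$, where $\kappa=(\sigma_1\cdots\sigma_{n-2})(\sigma_{n-2}\cdots\sigma_1)$. (Up to conjugacy, and up to the sign of $m$, this is the same as inserting full twists $\Delta_{[2,n-1]}^{2m}$ and $\Delta_{[2,n-1]}^{-2m}$ on the middle $n-2$ strands between $\alpha$ and $\beta$ and between $\beta$ and $\alpha$, respectively, where $\Delta^2_{[i,j]}=(\sigma_i\cdots\sigma_{j-1})^{j-i+1}$.) *)

(* Defs.v *)
From HB Require Import structures.
From mathcomp Require Import all_boot all_order all_fingroup all_algebra.
From mathcomp Require Import all_classical all_reals all_analysis.
From mathcomp Require Import zify.

Set Implicit Arguments.
Unset Strict Implicit.
Unset Printing Implicit Defensive.

Import Order.TTheory GRing.Theory Num.Theory.
Import numFieldNormedType.Exports.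

Local Open Scope classical_set_scope.
Local Open Scope ring_scope.

(* Strand positions 1, ..., n are numbered from 0 as elements of 'I_n, and the
   Artin generators sigma_1, ..., sigma_(n-1) are numbered from 0 as elements
   of 'I_n.-1: index i crosses the positions i and i.+1.  The letter (i, true)
   stands for the generator and (i, false) for its inverse. *)
Definition braid_letter (n : nat) := ('I_n.-1 * bool)%type.
Definition braid_word (n : nat) := seq (braid_letter n).

Inductive braid_equiv (n : nat) : braid_word n -> braid_word n -> Prop :=
| BraidRefl w : braid_equiv w w
| BraidSym w w' : braid_equiv w w' -> braid_equiv w' w
| BraidTrans w w' w'' :
    braid_equiv w w' -> braid_equiv w' w'' -> braid_equiv w w''
| BraidCat u u' v v' :
    braid_equiv u u' -> braid_equiv v v' -> braid_equiv (u ++ v) (u' ++ v')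
| BraidCancel i e : braid_equiv [:: (i, e); (i, ~~ e)] [::]
| BraidFar (i j : 'I_n.-1) : (i.+1 < j)%N ->
    braid_equiv [:: (i, true); (j, true)] [:: (j, true); (i, true)]
| BraidYB (i j : 'I_n.-1) : j = i.+1 :> nat ->
    braid_equiv [:: (i, true); (j, true); (i, true)]
                [:: (j, true); (i, true); (j, true)].

Definition word_inv n (w : braid_word n) : braid_word n :=
  rev [seq (l.1, ~~ l.2) | l <- w].

Lemma word_inv_cat n (u v : braid_word n) :
  word_inv (u ++ v) = word_inv v ++ word_inv u.
Proof. by rewrite /word_inv map_cat rev_cat. Qed.

Lemma word_invK n : involutive (@word_inv n).
Proof.
move=> w; rewrite /word_inv map_rev revK -map_comp -[RHS]map_id.
by apply: eq_map => -[i e] /=; rewrite negbK.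
Qed.

Lemma word_inv_mulV n (w : braid_word n) : braid_equiv (word_inv w ++ w) [::].
Proof.
elim: w => [|[i e] w IH]; first exact: BraidRefl.
have -> : word_inv ((i, e) :: w) ++ (i, e) :: w =
          word_inv w ++ ([:: (i, ~~ e); (i, e)] ++ w).
  by rewrite /word_inv /= rev_cons -cats1 -catA.
apply: BraidTrans IH; apply: BraidCat (BraidRefl _) _.
apply: (@BraidCat _ _ [::] _ _ _ (BraidRefl _)).
by have := BraidCancel i (~~ e); rewrite negbK.
Qed.

Lemma word_mul_invV n (w : braid_word n) : braid_equiv (w ++ word_inv w) [::].
Proof. by rewrite -{1}[w]word_invK; apply: word_inv_mulV. Qed.

Lemma word_inv_equiv n (u v : braid_word n) :
  braid_equiv u v -> braid_equiv (word_inv u) (word_inv v).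
Proof.
move=> uv; apply: (@BraidTrans _ _ (word_inv u ++ (v ++ word_inv v))).
  rewrite -{1}[word_inv u]cats0; apply: BraidCat (BraidRefl _) _.
  exact: BraidSym (word_mul_invV v).
rewrite catA; apply: (@BraidCat _ _ [::] _ _ _ (BraidRefl _)).
apply: BraidTrans (word_inv_mulV u).
exact: BraidCat (BraidRefl _) (BraidSym uv).
Qed.

Definition braid_equivb n : rel (braid_word n) :=
  fun u v => `[< braid_equiv u v >].

Lemma braid_equivb_refl n : reflexive (@braid_equivb n).
Proof. by move=> w; apply/asboolP; apply: BraidRefl. Qed.

Lemma braid_equivb_sym n : symmetric (@braid_equivb n).
Proof. by move=> u v; apply/asboolP/asboolP; apply: BraidSym. Qed.

Lemma braid_equivb_trans n : transitive (@braid_equivb n).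
Proof.
move=> v u w /asboolP uv /asboolP vw.
by apply/asboolP; apply: BraidTrans vw.
Qed.

Canonical braid_equiv_rel n := EquivRel (@braid_equivb n)
  (@braid_equivb_refl n) (@braid_equivb_sym n) (@braid_equivb_trans n).

Definition braid_group (n : nat) := {eq_quot (braid_equiv_rel n)}%qT.

HB.instance Definition _ n := Choice.on (braid_group n).

Definition braid_of_word n (w : braid_word n) : braid_group n :=
  (\pi_{eq_quot (braid_equiv_rel n)} w)%qT.

Definition word_of_braid n (b : braid_group n) : braid_word n :=
  generic_quotient.repr b.

Lemma word_of_braidK n : cancel (@word_of_braid n) (@braid_of_word n).
Proof. by move=> b; apply: generic_quotient.reprK. Qed.

Lemma braid_of_wordP n (u v : braid_word n) :
  braid_of_word u = braid_of_word v <-> braid_equiv u v.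
Proof. by split=> [/eqmodP/asboolP//|uv]; apply/eqmodP/asboolP. Qed.

Lemma braid_of_wordK n (w : braid_word n) :
  braid_equiv (word_of_braid (braid_of_word w)) w.
Proof. by apply/braid_of_wordP; rewrite word_of_braidK. Qed.

Definition braid_one n : braid_group n := braid_of_word [::].
Definition braid_mul n (a b : braid_group n) : braid_group n :=
  braid_of_word (word_of_braid a ++ word_of_braid b).
Definition braid_inv n (a : braid_group n) : braid_group n :=
  braid_of_word (word_inv (word_of_braid a)).

Lemma braid_mul_word n (u v : braid_word n) :
  braid_mul (braid_of_word u) (braid_of_word v) = braid_of_word (u ++ v).
Proof. by apply/braid_of_wordP/BraidCat; apply: braid_of_wordK. Qed.

Lemma braid_inv_word n (u : braid_word n) :
  braid_inv (braid_of_word u) = braid_of_word (word_inv u).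
Proof. by apply/braid_of_wordP/word_inv_equiv/braid_of_wordK. Qed.

Lemma braid_mulA n : associative (@braid_mul n).
Proof.
move=> a b c; rewrite -(word_of_braidK a) -(word_of_braidK b).
by rewrite -(word_of_braidK c) !braid_mul_word catA.
Qed.

Lemma braid_mul1 n : left_id (@braid_one n) (@braid_mul n).
Proof. by move=> a; rewrite -(word_of_braidK a) braid_mul_word. Qed.

Lemma braid_1mul n : right_id (@braid_one n) (@braid_mul n).
Proof. by move=> a; rewrite -(word_of_braidK a) braid_mul_word cats0. Qed.

Lemma braid_mulV n : left_inverse (@braid_one n) (@braid_inv n) (@braid_mul n).
Proof.
move=> a; rewrite -(word_of_braidK a) braid_inv_word braid_mul_word.
exact/braid_of_wordP/word_inv_mulV.
Qed.

Lemma braid_Vmul n : right_inverse (@braid_one n) (@braid_inv n) (@braid_mul n).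
Proof.
move=> a; rewrite -(word_of_braidK a) braid_inv_word braid_mul_word.
exact/braid_of_wordP/word_mul_invV.
Qed.

HB.instance Definition _ n := isGroup.Build (braid_group n)
  (@braid_mulA n) (@braid_mul1 n) (@braid_1mul n)
  (@braid_mulV n) (@braid_Vmul n).

Definition artin n (i : 'I_n.-1) : braid_group n :=
  braid_of_word [:: (i, true)].

Definition conjugate_elts (G : groupType) (a b : G) : Prop :=
  exists g : G, b = (a ^ g)%g.

Definition zpow (G : groupType) (x : G) (m : int) : G :=
  match m with
  | Posz k => (x ^+ k)%g
  | Negz k => (x ^- k.+1)%g
  end.

Definition is_subgroup (G : groupType) (H : set G) : Prop :=
  H 1%g /\ forall x y, H x -> H y -> H (x * y^-1)%g.

Definition generated_subgroup (G : groupType) (S : set G) : set G :=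
  smallest (@is_subgroup G) S.

Definition pos_left n (i : 'I_n.-1) : 'I_n := widen_ord (leq_pred n) i.

Lemma pos_right_subproof n (i : 'I_n.-1) : (i.+1 < n)%N.
Proof. by case: n i => [|n] [i]. Qed.

Definition pos_right n (i : 'I_n.-1) : 'I_n := Ordinal (pos_right_subproof i).

Definition letter_perm n (l : braid_letter n) : 'S_n :=
  tperm (pos_left l.1) (pos_right l.1).

(* In 'S_n the product s * t applies s first, in agreement with the stacking
   of the first factor of a product of braids on top of the second. *)
Definition word_perm n (w : braid_word n) : 'S_n :=
  (\prod_(l <- w) letter_perm l)%g.

Lemma word_perm_equiv n (u v : braid_word n) :
  braid_equiv u v -> word_perm u = word_perm v.
Proof.
have tp (i : 'I_n.-1) e : letter_perm (i, e) = tperm (pos_left i) (pos_right i).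
  by [].
rewrite /word_perm; elim=> {u v} [//|u v _ ->//|u v w _ -> _ ->//| | | |].
- by move=> u u' v v' _ IHu _ IHv; rewrite !big_cat /= IHu IHv.
- by move=> i e; rewrite !(big_cons, big_nil) /= mulg1 !tp tperm2.
- move=> i j ij; rewrite !(big_cons, big_nil) /= !mulg1 !tp [LHS]conjgC tpermJ.
  by congr (_ * tperm _ _)%g; rewrite tpermD // -val_eqE /=; lia.
- move=> i j ji; rewrite !(big_cons, big_nil) /= !mulg1 !tp.
  have -> : pos_left j = pos_right i by apply: val_inj; rewrite /= ji.
  set x := tperm (pos_left i) _; set y := tperm (pos_right i) _.
  have -> : (x * (y * x) = y ^ x)%g by rewrite conjgE tpermV.
  have -> : (y * (x * y) = x ^ y)%g by rewrite conjgE tpermV.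
  by rewrite !tpermJ !(tpermL, tpermR) !tpermD // -val_eqE /=; lia.
Qed.

Definition braid_perm n (b : braid_group n) : 'S_n :=
  word_perm (word_of_braid b).

Lemma braid_perm_word n (w : braid_word n) :
  braid_perm (braid_of_word w) = word_perm w.
Proof. exact/word_perm_equiv/braid_of_wordK. Qed.

Lemma braid_permM n (a b : braid_group n) :
  braid_perm (a * b)%g = (braid_perm a * braid_perm b)%g.
Proof. by rewrite braid_perm_word /word_perm big_cat. Qed.

Definition first_strands_subgroup n : set (braid_group n) :=
  generated_subgroup [set artin i | i in [set i : 'I_n.-1 | (i < n.-2)%N]].

Definition last_strands_subgroup n : set (braid_group n) :=
  generated_subgroup [set artin i | i in [set i : 'I_n.-1 | (0 < i)%N]].

Definition kappa n : braid_group n :=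
  let s := [seq i : 'I_n.-1 <- enum 'I_n.-1 | (i < n.-2)%N] in
  ((\prod_(i <- s) artin i) * (\prod_(i <- rev s) artin i))%g.

Definition exchange_move n (alpha beta : braid_group n) (m : int) :
    braid_group n :=
  (alpha * zpow (kappa n) m * beta * zpow (kappa n) (- m))%g.

Definition sphere3 (R : realType) : set 'rV[R]_4 :=
  [set x | \sum_(i < 4) x ord0 i ^+ 2 = 1].

(* C^1 embedding into S^3 of a disjoint union, indexed by I, of oriented
   circles R/Z, given as 1-periodic functions on R. *)
Definition link_embedding (R : realType) (I : Type)
    (g : I -> R -> 'rV[R]_4) : Prop :=
  [/\ forall c t, @sphere3 R (g c t),
      forall c t, g c (t + 1) = g c t,
      forall c c' t t', g c t = g c' t' -> c = c' /\ exists k : int, t' = t + k%:~R,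
      forall c t, derivable (g c) t 1 /\ derive1 (g c) t != 0
    & forall c, continuous (derive1 (g c))].

Record oriented_link (R : realType) := OrientedLink {
  link_component : finType;
  link_curve :> link_component -> R -> 'rV[R]_4;
  curve_embedding : link_embedding link_curve
}.

(* Isotopy through C^1 embeddings, C^1 along the link and jointly continuous
   with its tangent vector; the components may be relabelled.  A C^1
   orientation-preserving change of parameter is a special case.  Without the
   tangent condition knots could be shrunk to a point and untied. *)
Definition isotopic (R : realType) (K L : oriented_link R) : Prop :=
  exists phi : link_component K -> link_component L, bijective phi /\
  exists F : R -> link_component K -> R -> 'rV[R]_4,
    [/\ forall c t, F 0 c t = K c t,
        forall c t, F 1 c t = L (phi c) t,
        forall s, 0 <= s <= 1 -> link_embedding (F s),
        forall c, {within [set p : R * R | 0 <= p.1 <= 1],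
          continuous (fun p : R * R => F p.1 c p.2)}
      & forall c, {within [set p : R * R | 0 <= p.1 <= 1],
          continuous (fun p : R * R => derive1 (F p.1 c) p.2)}].

Definition ease (R : realType) (t : R) : R := 3 * t ^+ 2 - 2 * t ^+ 3.

(* Geometric braid of a letter: the strand starting at position k is the motion
   t in [0, 1] |-> (x, y) in the plane, where x is the coordinate along the row
   of strands and y is the depth.  The sign chosen for y is immaterial: the
   opposite one replaces all closures by their mirror images.  The easing makes
   all velocities vanish at t = 0 and t = 1, so that concatenations and
   closures are C^1. *)
Definition letter_strand (R : realType) n (l : braid_letter n) (k : 'I_n)
    (t : R) : R * R :=
  let u := ease t in
  let y := (if l.2 then 1 else -1) * (u * (1 - u)) in
  if k == pos_left l.1 then (k%:R + u, y)
  else if k == pos_right l.1 then (k%:R - u, - y)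
  else (k%:R, 0).

Fixpoint word_strand (R : realType) n (w : braid_word n) (k : 'I_n) (t : R)
    : R * R :=
  match w with
  | [::] => (k%:R, 0)
  | l :: w' =>
      if t <= 1 / 2 then letter_strand l k (2 * t)
      else word_strand w' (letter_perm l k) (2 * t - 1)
  end.

(* Identification of S^1 x R^2 with the complement in S^3 of the braid axis
   x_0 = x_1 = 0: radial projection of (cos 2 pi t, sin 2 pi t, z). *)
Definition torus_point (R : realType) (t : R) (z : R * R) : 'rV[R]_4 :=
  (Num.sqrt (1 + z.1 ^+ 2 + z.2 ^+ 2))^-1 *:
  \row_(i < 4) [:: cos (2 * pi * t); sin (2 * pi * t); z.1; z.2]`_i.

(* K is the closure of the geometric braid of w.  The components correspond to
   the cycles of the permutation p of w; the component c, passing through the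
   starting position k c, runs at constant angular speed through the strands starting
   at k c, p (k c), p (p (k c)), etc, once around the axis for each of them. *)
Definition is_closed_word (R : realType) n (w : braid_word n)
    (K : oriented_link R) : Prop :=
  exists k : link_component K -> 'I_n,
    (forall x : 'I_n, exists! c, x \in porbit (word_perm w) (k c)) /\
    (forall c (j : nat) (t : R), 0 <= t <= 1 ->
       K c ((j%:R + t) / #|porbit (word_perm w) (k c)|%:R) =
       torus_point t (word_strand w ((word_perm w ^+ j)%g (k c)) t)).

(* The link type of L is the closure of b; b is a braid representation of L. *)
Definition is_closure (R : realType) n (b : braid_group n)
    (L : oriented_link R) : Prop :=
  exists w : braid_word n, b = braid_of_word w /\
  exists K : oriented_link R, is_closed_word w K /\ isotopic K L.

(* Main.v *)
Require Import Defs.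
From HB Require Import structures.
From mathcomp Require Import all_boot all_order all_fingroup all_algebra.
From mathcomp Require Import all_classical all_reals all_analysis.
From mathcomp Require Import zify ring lra.

Set Implicit Arguments.
Unset Strict Implicit.
Unset Printing Implicit Defensive.

Import Order.TTheory GRing.Theory Num.Theory.
Import numFieldNormedType.Exports.

Local Open Scope classical_set_scope.
Local Open Scope ring_scope.

(** Two things are to be proved: exchange moves do not change the closure, and
    they produce infinitely many conjugacy classes.

    For the closure, braids are made geometric as smooth motions of n points
    in the plane, and equivalent words have homotopic motions
    (braid_equiv_homot). The braid kappa is homotopic to a full turn of the
    first point around those in the positions 1, ..., n-2, counted from 0
    (homot_kappa). Hence the closure of an exchange braid is the closure of a
    motion in which the strand that passes the part v = beta in the first
    position makes m full turns before v and -m full turns after it. If all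
    these turns could be scaled down to zero at once, the closure of alpha beta would result;
    but to pass around all of v the circle of the first strand has to be
    enlarged, and it then sweeps across the last strand, at rest in the last
    position. However, on the half turn around the axis opposite to v the last
    strand consists of a single arc in the last position, and this arc can be
    pushed across the axis to the side of v (the function flip): its first two
    coordinates then have norm less than 1, which puts it, after rescaling, to
    the right of everything else. With the first strand moved far to the left
    during v (bulge) and the last one out of the way, the turns can be undone
    by any angle (exchange_rotation_system). Curves in the 3-sphere are
    handled as curves of rays in the 4-space (arc_system), so that isotopies
    are verified in linear coordinates, and unrolling along the permutation
    turns arcs into closed curves.

    For the conjugacy classes, the trace of the Burau matrix at t = 1 + h is
    expanded up to h^2. At h = 0 the Burau matrices of alpha and beta are the
    permutation matrices A and B, and that of kappa is 1 + h X + ... with X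
    the Laplacian of the star that joins the first position to the positions
    1, ..., n-2 (coef1_ascending_descending). The matrix of kappa^m is then
    polynomial in m, and in the trace for the m-th exchange move the
    coefficient of h is linear with slope tr(AXB) - tr(ABX), while twice the
    coefficient of h^2 is quadratic with leading coefficient tr(AX^2B) +
    tr(ABX^2) - 2 tr(AXBX) (exchange_coefs). As X differs from the identity by
    a matrix of rank at most three, supported by the first and last basis
    vectors and the vector of ones, these numbers can be computed
    (trace_slope, trace_curvature): they are y - x and (n - 2)(x + y) - 2,
    where x tells whether the braid alpha beta takes the first position to the
    last one and y whether beta alpha takes the last one to the first; all
    other entries that occur are known, as alpha fixes the last position, beta
    the first one, and their product neither of them. If x and y differ, the
    slope is 1 or -1; otherwise the leading coefficient is -2 or 2 n - 6. In
    both cases the traces of the exchange braids with large m are pairwise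
    different. *)

(** * Families of functions jointly of class C1 in the last variable *)

Section JointC1.
Context {R : realType}.
Implicit Types (F G : R -> R -> R) (g h : R -> R).

(** The derivative is exhibited rather than computed, so that the closure
    properties below and the continuity of tangent vectors come from the same
    witness. *)
Definition joint_C1 F := exists dF : R -> R -> R,
  [/\ continuous (fun p : R * R => F p.1 p.2),
      continuous (fun p : R * R => dF p.1 p.2)
    & forall s t : R, is_derive t (1 : R) (F s) (dF s t)].

Lemma joint_C1_ext F G : (forall s t, F s t = G s t) -> joint_C1 F -> joint_C1 G.
Proof. by move=> FG; suff -> : G = F by []; do 2!apply/funext=> ?. Qed.

Lemma joint_C1_param h : continuous h -> joint_C1 (fun s _ => h s).
Proof.
move=> ch; exists (fun _ _ => 0); split.
- by move=> p; apply: continuous_comp (ch _); exact: cvg_fst.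
- by move=> p; exact: cvg_cst.
- by move=> s t; exact: is_derive_cst.
Qed.

Lemma joint_C1_cst (a : R) : joint_C1 (fun _ _ => a).
Proof. by apply: joint_C1_param => s; exact: cvg_cst. Qed.

Lemma joint_C1_time : joint_C1 (fun _ t => t).
Proof.
exists (fun _ _ => 1); split.
- by move=> p; exact: cvg_snd.
- by move=> p; exact: cvg_cst.
- by move=> s t; exact: is_derive_id.
Qed.

Lemma joint_C1D F G : joint_C1 F -> joint_C1 G ->
  joint_C1 (fun s t => F s t + G s t).
Proof.
move=> [dF [cF cdF FdF]] [dG [cG cdG GdG]].
exists (fun s t => dF s t + dG s t); split.
- by move=> p; apply: cvgD; [exact: cF|exact: cG].
- by move=> p; apply: cvgD; [exact: cdF|exact: cdG].
- by move=> s t; exact: is_deriveD.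
Qed.

Lemma joint_C1N F : joint_C1 F -> joint_C1 (fun s t => - F s t).
Proof.
move=> [dF [cF cdF FdF]]; exists (fun s t => - dF s t); split.
- by move=> p; apply: cvgN; exact: cF.
- by move=> p; apply: cvgN; exact: cdF.
- by move=> s t; exact: is_deriveN.
Qed.

Lemma joint_C1B F G : joint_C1 F -> joint_C1 G ->
  joint_C1 (fun s t => F s t - G s t).
Proof. by move=> cF cG; apply: joint_C1D => //; exact: joint_C1N. Qed.

Lemma joint_C1M F G : joint_C1 F -> joint_C1 G ->
  joint_C1 (fun s t => F s t * G s t).
Proof.
move=> [dF [cF cdF FdF]] [dG [cG cdG GdG]].
exists (fun s t => F s t * dG s t + G s t * dF s t); split.
- by move=> p; apply: cvgM; [exact: cF|exact: cG].
- move=> p; apply: cvgD; apply: cvgM; [exact: cF|exact: cdG|exact: cG|].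
  exact: cdF.
- move=> s t; exact: is_deriveM.
Qed.

Lemma joint_C1_comp F G h : continuous h -> joint_C1 F -> joint_C1 G ->
  joint_C1 (fun s t => F (h s) (G s t)).
Proof.
move=> ch [dF [cF cdF FdF]] [dG [cG cdG GdG]].
have cp (H : R * R -> R) : continuous H ->
    continuous (fun p : R * R => H (h p.1, G p.1 p.2)).
  move=> cH p; apply: (@continuous_comp _ _ _ (fun p : R * R => (h p.1, G p.1 p.2)) H);
    last exact: cH.
  have c1 : (fun q : R * R => h q.1) @ p --> h p.1.
    by apply: continuous_comp (ch _); exact: cvg_fst.
  exact: (cvg_pair c1 (cG p)).
exists (fun s t => dF (h s) (G s t) * dG s t); split.
- exact: (cp _ cF).
- by move=> p; apply: cvgM; [exact: (cp _ cdF)|exact: cdG].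
- by move=> s t; apply: (@is_derive1_comp _ (F (h s)) (G s)).
Qed.

Lemma joint_C1_retime g F : joint_C1 (fun _ => g) -> joint_C1 F ->
  joint_C1 (fun s t => g (F s t)).
Proof.
move=> cg cF; apply: (@joint_C1_comp (fun _ => g) F id) => // x; exact: cvg_id.
Qed.

Lemma joint_C1_cos : joint_C1 (fun _ => @cos R).
Proof.
exists (fun _ t => - sin t); split.
- by move=> p; apply: continuous_comp; [exact: cvg_snd|exact: continuous_cos].
- by move=> p; apply: cvgN; apply: continuous_comp; [exact: cvg_snd|exact: continuous_sin].
- by move=> s t; exact: is_derive_cos.
Qed.

Lemma joint_C1_sin : joint_C1 (fun _ => @sin R).
Proof.
exists (fun _ t => cos t); split.
- by move=> p; apply: continuous_comp; [exact: cvg_snd|exact: continuous_sin].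
- by move=> p; apply: continuous_comp; [exact: cvg_snd|exact: continuous_cos].
- by move=> s t; exact: is_derive_sin.
Qed.

Lemma joint_C1_invsqrt F : (forall s t, 0 < F s t) -> joint_C1 F ->
  joint_C1 (fun s t => (Num.sqrt (F s t))^-1).
Proof.
move=> F0 [dF [cF cdF FdF]].
have s0 s t : Num.sqrt (F s t) != 0 by rewrite gt_eqF // sqrtr_gt0.
have cs : continuous (fun p : R * R => Num.sqrt (F p.1 p.2)).
  move=> p; apply: (@continuous_comp _ _ _ (fun p : R * R => F p.1 p.2) Num.sqrt).
    exact: cF.
  exact: sqrt_continuous.
exists (fun s t => - (Num.sqrt (F s t)) ^- 2 * ((2 * Num.sqrt (F s t))^-1 * dF s t)).
split.
- by move=> p; apply: cvgV; [exact: s0|exact: cs].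
- move=> p; apply: cvgM.
    apply: cvgN; apply: cvgV; first by rewrite expf_neq0.
    by apply: (@cvgM _ _ _ _ (fun p : R * R => Num.sqrt (F p.1 p.2)) (fun p : R * R => Num.sqrt (F p.1 p.2))); exact: cs.
  apply: cvgM; last exact: cdF.
  apply: cvgV; first by rewrite mulf_neq0.
  by apply: cvgM; [exact: cvg_cst|exact: cs].
- move=> s t; apply: is_deriveV => //.
  by apply: (@is_derive1_comp _ Num.sqrt (F s)); exact: is_derive1_sqrt.
Qed.

(** Continuity and derivatives only see neighbourhoods, here of the last variable
    and uniform in the parameter. *)
Lemma joint_C1_local F :
  (forall t0, exists G (e : R), [/\ joint_C1 G, 0 < e
      & forall s t, `|t - t0| < e -> F s t = G s t]) ->
  joint_C1 F.
Proof.
move=> loc; exists (fun s t => 'D_1 (F s) t).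
have key t0 : exists G dG (e : R), [/\ 0 < e,
    continuous (fun p : R * R => G p.1 p.2),
    continuous (fun p : R * R => dG p.1 p.2),
    forall s t, `|t - t0| < e -> F s t = G s t
  & forall s t, `|t - t0| < e -> is_derive t (1 : R) (F s) (dG s t)].
  have [G [e [[dG [cG cdG GdG]] e0 FG]]] := loc t0.
  exists G, dG, e; split => // s t tt0.
  apply: (near_eq_is_derive (f := G s)) => //.
  near=> u; rewrite -FG //; near: u.
  have := @near_in_itvoo _ (t0 - e) (t0 + e) t.
  rewrite in_itv /= => /(_ _)[]; first by move: tt0; rewrite ltr_norml; lra.
  move=> d /= d0 dI; exists d => // u /dI /=; rewrite in_itv /= ltr_norml; lra.
have nt (p : R * R) (e : R) : 0 < e -> \forall q \near p, `|q.2 - p.2| < e.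
  move=> e0; have /cvgrPdist_lt /(_ e e0) : (fun q : R * R => q.2) @ p --> p.2.
    exact: cvg_snd.
  by apply: filterS => q; rewrite distrC.
split.
- move=> p; have [G [dG [e [e0 cG _ FG _]]]] := key p.2.
  rewrite /continuous_at (FG _ _ _) ?subrr ?normr0 //.
  apply: cvg_trans (cG p); apply: near_eq_cvg.
  by near=> q; rewrite FG //; near: q; exact: nt.
- move=> p; have [G [dG [e [e0 _ cG FG FdG]]]] := key p.2.
  rewrite /continuous_at [X in _ --> X](_ : _ = dG p.1 p.2); last first.
    by apply: derive_val; apply: FdG; rewrite subrr normr0.
  apply: cvg_trans (cG p); apply: near_eq_cvg.
  near=> q; symmetry; apply: derive_val; apply: FdG; near: q; exact: nt.
- move=> s t; have [G [dG [e [e0 _ cG FG FdG]]]] := key t.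
  have D : is_derive t (1 : R) (F s) (dG s t) by apply: FdG; rewrite subrr normr0.
  by rewrite (derive_val (is_derive := D)).
Unshelve. all: by end_near. Qed.

End JointC1.

(** * A smooth step *)

Section SmoothStep.
Context {R : realType}.
Implicit Types t x : R.

(** The simplest function of class C1 that vanishes exactly on a half line: all
    cut-offs are made of it. *)
Definition sqpos (x : R) : R := Num.max 0 x ^+ 2.

Lemma sqpos_le0 x : x <= 0 -> sqpos x = 0.
Proof. by move=> x0; rewrite /sqpos max_l // expr0n. Qed.

Lemma sqpos_ge0E x : 0 <= x -> sqpos x = x ^+ 2.
Proof. by move=> x0; rewrite /sqpos max_r. Qed.

Lemma sqpos_ge0 x : 0 <= sqpos x.
Proof. exact: sqr_ge0. Qed.

Lemma sqpos_gt0 x : (0 < sqpos x) = (0 < x).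
Proof.
case: (ltP 0 x) => x0; first by rewrite sqpos_ge0E ?exprn_gt0 ?ltW.
by rewrite sqpos_le0 // ltxx.
Qed.

Lemma is_derive_sqpos x : is_derive x (1 : R) sqpos (2 * Num.max 0 x).
Proof.
case: (ltgtP x 0) => [x0|x0|->].
- rewrite mulr0.
  apply: (near_eq_is_derive (f := cst 0)).
  near=> y; rewrite sqpos_le0 //; near: y.
  by near=> y; apply: ltW; near: y; exact: lt_nbhsl.
- have D : is_derive x (1 : R) (fun y => y ^+ 2) (2 * x).
    have -> : (fun y : R => y ^+ 2) = (id * id)%R by apply/funext.
    by apply: is_derive_eq; rewrite /GRing.scale /= mulr1 mulr_natl mulr2n.
  apply: near_eq_is_derive D; near=> y; rewrite sqpos_ge0E //; near: y.
  by near=> y; apply: ltW; near: y; exact: lt_nbhsr.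
- rewrite mulr0; apply/is_derive1_caratheodory.
  exists (Num.max 0); split; last by rewrite max_l.
    move=> z; rewrite [sqpos 0]sqpos_le0 // !subr0 /sqpos expr2.
    by case: (ltP 0 z) => //; rewrite !mul0r.
  by apply: (@continuous_max _ _ (cst 0) id); [exact: cvg_cst|exact: cvg_id].
Unshelve. all: by end_near. Qed.

Lemma joint_C1_sqpos : joint_C1 (fun _ => sqpos).
Proof.
have cm : continuous (Num.max (0 : R)).
  by move=> z; apply: (@continuous_max _ _ (cst 0) id); [exact: cvg_cst|exact: cvg_id].
exists (fun _ t => 2 * Num.max 0 t); split.
- move=> p; apply: continuous_comp; first exact: cvg_snd.
  apply: differentiable_continuous; apply/derivable1_diffP.
  by have [] := is_derive_sqpos p.2.
- move=> p; apply: cvgM; first exact: cvg_cst.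
  by apply: continuous_comp; [exact: cvg_snd|exact: cm].
- by move=> s t; exact: is_derive_sqpos.
Qed.

(** The easing function of the letters, extended by its end values: the last two
    terms cancel the cubic beyond 1.  All motions below are built from it, and
    are constant outside of the time interval in which they take place. *)
Definition step (t : R) : R :=
  3 * sqpos t - 2 * (t * sqpos t) +
  (3 * sqpos (t - 1) + 2 * ((t - 1) * sqpos (t - 1))).

Lemma joint_C1_step : joint_C1 (fun _ => step).
Proof.
have c1 : joint_C1 (fun _ (t : R) => t - 1).
  by apply: joint_C1B; [exact: joint_C1_time|exact: joint_C1_cst].
have cq := joint_C1_sqpos; have cq1 := joint_C1_retime cq c1.
have cc (a : R) F : joint_C1 F -> joint_C1 (fun s t => a * F s t).
  by move=> cF; apply: joint_C1M => //; exact: joint_C1_cst.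
apply: joint_C1D; first apply: joint_C1B; first exact: cc.
  by apply/cc/joint_C1M => //; exact: joint_C1_time.
by apply: joint_C1D; apply: cc => //; exact: joint_C1M.
Qed.

Lemma step_le0 t : t <= 0 -> step t = 0.
Proof. by move=> t0; rewrite /step !sqpos_le0; lra. Qed.

Lemma step01 t : 0 <= t <= 1 -> step t = 3 * t ^+ 2 - 2 * t ^+ 3.
Proof.
move=> t01; rewrite /step sqpos_ge0E; last lra.
by rewrite sqpos_le0; [ring|lra].
Qed.

Lemma step_ge1 t : 1 <= t -> step t = 1.
Proof. by move=> t1; rewrite /step !sqpos_ge0E; [ring|lra|lra]. Qed.

Lemma step_ease t : 0 <= t <= 1 -> step t = ease t.
Proof. exact: step01. Qed.

Lemma step_gt0 t : 0 < t -> 0 < step t.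
Proof.
move=> t0; have [t1|t1] := leP t 1; last by rewrite step_ge1 // ltW.
rewrite step01; last lra.
have -> : 3 * t ^+ 2 - 2 * t ^+ 3 = t ^+ 2 * (3 - 2 * t) by ring.
by rewrite mulr_gt0 ?exprn_gt0 //; lra.
Qed.

Lemma step_sym t : step (1 - t) = 1 - step t.
Proof.
have [t0|t0] := leP t 0; first by rewrite step_ge1 ?step_le0; lra.
have [t1|t1] := leP t 1; last by rewrite step_le0 ?step_ge1; lra.
by rewrite !step01; [ring|lra|lra].
Qed.

Lemma step_lt1 t : t < 1 -> step t < 1.
Proof.
move=> t1; have := @step_gt0 (1 - t); rewrite step_sym; lra.
Qed.

Lemma step_ge0 t : 0 <= step t.
Proof. by have [/step_le0 ->|/step_gt0/ltW] := leP t 0. Qed.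

Lemma step_le1 t : step t <= 1.
Proof. by have [/step_ge1 ->|/step_lt1/ltW] := leP 1 t. Qed.

Lemma step_lt_half t : t < 1 / 2 -> step t < 1 / 2.
Proof.
move=> t1; have [t0|t0] := leP t 0; first by rewrite step_le0 //; lra.
rewrite step01; last lra.
have : 0 < (1 / 2 - t) * (1 + 2 * t * (1 - t)).
  have : 0 < t * (1 - t) by rewrite mulr_gt0 //; lra.
  by move=> h; rewrite mulr_gt0 //; lra.
rewrite -[_ < 1 / 2]subr_gt0.
by have -> : (1 / 2 - t) * (1 + 2 * t * (1 - t)) =
  1 / 2 - (3 * t ^+ 2 - 2 * t ^+ 3) by field.
Qed.

Lemma step_half : step (1 / 2) = 1 / 2.
Proof. by rewrite step01; [field|lra]. Qed.

End SmoothStep.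

(** * Motions of points in the plane and their homotopies *)

Section Motions.
Context {R : realType} {n : nat}.
Implicit Types (p : 'S_n) (k l : 'I_n) (b : bool) (s t : R).

(** A motion of n points in the plane; the booleans false and true select the
    coordinate along the row of strands and the depth. *)
Definition motion := 'I_n -> bool -> R -> R.
Implicit Types (z : motion) (f : R -> motion).

Definition home k b : R := if b then 0 else k%:R.

Definition smooth_family f := forall k b, joint_C1 (fun s => f s k b).

(** Geometric braids, extended to all times by their end positions. *)
Definition is_braiding p z := [/\ forall k b t, t <= 0 -> z k b t = home k b,
    forall k b t, 1 <= t -> z k b t = home (p k) b
  & forall k l t, (forall b, z k b t = z l b t) -> k = l].

Definition smooth_braiding p z :=
  smooth_family (fun _ => z) /\ is_braiding p z.

Definition homot p z z' := exists f, [/\ smooth_family f,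
  forall s, 0 <= s <= 1 -> is_braiding p (f s), f 0 = z & f 1 = z'].

Lemma home_inj k l : (forall b, home k b = home l b) -> k = l.
Proof. by move=> /(_ false) /eqP; rewrite eqr_nat => /eqP/val_inj. Qed.

Lemma homot_refl p z : smooth_braiding p z -> homot p z z.
Proof. by move=> [Cz Bz]; exists (fun _ => z). Qed.

Lemma smooth_family_at f (h : R -> R) : continuous h -> smooth_family f ->
  smooth_family (fun s => f (h s)).
Proof.
move=> ch Cf k b.
exact: (joint_C1_comp ch (Cf k b) joint_C1_time).
Qed.

Lemma homot_sym p z z' : homot p z z' -> homot p z' z.
Proof.
move=> [f [Cf Bf f0 f1]]; exists (fun s => f (1 - s)); split.
- apply: smooth_family_at => // s.
  by apply: cvgB; [exact: cvg_cst|exact: cvg_id].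
- by move=> s s01; apply: Bf; lra.
- by rewrite subr0.
- by rewrite subrr.
Qed.

Lemma homot_smoothl p z z' : homot p z z' -> smooth_braiding p z.
Proof.
move=> [f [Cf Bf <- _]]; split; last by apply: Bf; lra.
by apply: (smooth_family_at (h := cst 0)) => // s; exact: cvg_cst.
Qed.

Lemma homot_smoothr p z z' : homot p z z' -> smooth_braiding p z'.
Proof. by move/homot_sym/homot_smoothl. Qed.

(** Homotopies are controlled for parameters in [0, 1] only; composition with
    clamp makes the control global. *)
Definition clamp (s : R) : R := Num.max 0 (Num.min 1 s).

Lemma clamp_continuous : continuous clamp.
Proof.
move=> s; apply: (@continuous_max _ _ (cst 0)); first exact: cvg_cst.
by apply: (@continuous_min _ _ (cst 1) id); [exact: cvg_cst|exact: cvg_id].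
Qed.

Lemma clamp_id s : 0 <= s <= 1 -> clamp s = s.
Proof. by move=> /andP[s0 s1]; rewrite /clamp min_r // max_r. Qed.

Lemma clamp_le0 s : s <= 0 -> clamp s = 0.
Proof. by move=> s0; rewrite /clamp min_r ?max_l // (le_trans s0). Qed.

Lemma clamp_ge1 s : 1 <= s -> clamp s = 1.
Proof. by move=> s0; rewrite /clamp min_l ?max_r. Qed.

Lemma clamp01 s : 0 <= clamp s <= 1.
Proof. by rewrite /clamp le_max lexx /= ge_max ge_min lexx ler01. Qed.

Lemma clamp_affine_continuous (a c : R) : continuous (fun s => clamp (a * s + c)).
Proof.
move=> s; apply: (@continuous_comp _ _ _ (fun s => a * s + c) clamp);
  last exact: clamp_continuous.
by apply: cvgD; [apply: cvgM; [exact: cvg_cst|exact: cvg_id]|exact: cvg_cst].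
Qed.

(** The sum of the two clamped families, minus the common value in the middle,
    runs through one and then through the other: no gluing is needed. *)
Lemma homot_trans p z1 z2 z3 : homot p z1 z2 -> homot p z2 z3 -> homot p z1 z3.
Proof.
move=> H12 H23; have [Cz2 Bz2] := homot_smoothr H12.
have [f [Cf Bf f0 f1]] := H12; have [g [Cg Bg g0 g1]] := H23.
pose F s k b t := f (clamp (2 * s + 0)) k b t + g (clamp (2 * s + -1)) k b t - z2 k b t.
have Fl s : s <= 1 / 2 -> F s = f (clamp (2 * s)).
  move=> s2; do 3!apply/funext=> ?; rewrite /F (@clamp_le0 (2 * s + -1)) ?g0; last lra.
  by rewrite addr0 addrK.
have Fr s : 1 / 2 <= s -> F s = g (clamp (2 * s + -1)).
  move=> s2; do 3!apply/funext=> ?; rewrite /F (@clamp_ge1 (2 * s + 0)) ?f1; last lra.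
  by ring.
exists F; split.
- move=> k b; apply: joint_C1B; last exact: (Cz2 k b).
  apply: joint_C1D.
    exact: (smooth_family_at (@clamp_affine_continuous 2 0) Cf k b).
  exact: (smooth_family_at (@clamp_affine_continuous 2 (-1)) Cg k b).
- move=> s s01; have [s2|/ltW s2] := leP s (1 / 2).
    by rewrite Fl //; apply: Bf; exact: clamp01.
  by rewrite Fr //; apply: Bg; exact: clamp01.
- by rewrite Fl ?mulr0 ?clamp_le0 //; lra.
- by rewrite Fr ?clamp_ge1 //; lra.
Qed.

Lemma homot_ext p z z1 z' z1' : (forall k b t, z k b t = z1 k b t) ->
  (forall k b t, z' k b t = z1' k b t) -> homot p z z' -> homot p z1 z1'.
Proof.
move=> e e'; have -> : z = z1 by do 3!apply/funext=> ?.
by have -> : z' = z1' by do 3!apply/funext=> ?.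
Qed.

(** During a linear interpolation, two points meet only if their difference
    vector is antipodal to its final value. *)
Lemma homot_linear p z z' : smooth_braiding p z -> smooth_braiding p z' ->
  (forall s k l t, 0 <= s <= 1 -> k != l ->
     (forall b, (1 - s) * (z k b t - z l b t) + s * (z' k b t - z' l b t) = 0) ->
     False) ->
  homot p z z'.
Proof.
move=> [Cz [Sz Ez Dz]] [Cz' [Sz' Ez' Dz']] nd.
exists (fun s k b t => (1 - s) * z k b t + s * z' k b t); split.
- move=> k b; apply: joint_C1D; apply: joint_C1M => //; apply: joint_C1_param => s.
    by apply: cvgB; [exact: cvg_cst|exact: cvg_id].
  exact: cvg_id.
- move=> s s01; split=> [k b t t0|k b t t1|k l t e].
  + by rewrite Sz ?Sz' //; ring.
  + by rewrite Ez ?Ez' //; ring.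
  + apply/eqP/negP => /negP kl; apply: (nd s k l t s01 kl) => b.
    by have := e b; lra.
- by do 3!apply/funext=> ?; rewrite subr0 mul1r mul0r addr0.
- by do 3!apply/funext=> ?; rewrite subrr mul1r mul0r add0r.
Qed.

Lemma same_sign_convex (a c s : R) : 0 < a * c -> 0 <= s <= 1 ->
  (1 - s) * a + s * c = 0 -> False.
Proof.
move=> ac /andP[s0 s1] e.
have a0 : a != 0 by apply: contraTneq ac => ->; rewrite mul0r ltxx.
have : 0 < (1 - s) * (a * a) + s * (a * c).
  have aa : 0 < a * a by rewrite -expr2 exprn_even_gt0.
  have [->|sp] := eqVneq s 1; first by rewrite subrr mul0r add0r mul1r.
  have s1' : 0 < 1 - s by rewrite subr_gt0 lt_neqAle sp.
  by rewrite ltr_wpDr //; [exact: mulr_ge0 (ltW ac)|exact: mulr_gt0].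
suff -> : (1 - s) * (a * a) + s * (a * c) = a * ((1 - s) * a + s * c).
  by rewrite e mulr0 ltxx.
by ring.
Qed.

(** Whether a motion passes one point in front of another matters only when
    their first coordinates agree; so the depths may be replaced by any Y that
    is ordered in the same way at these moments, and the first coordinates may
    then move freely while Y keeps the points apart. *)
Lemma homot_depth p z z' (Y : 'I_n -> R -> R) :
  smooth_braiding p z -> smooth_braiding p z' ->
  (forall k, joint_C1 (fun _ => Y k)) ->
  (forall k t, t <= 0 -> Y k t = 0) -> (forall k t, 1 <= t -> Y k t = 0) ->
  (forall k l t, k != l -> z k false t = z l false t ->
     0 < (z k true t - z l true t) * (Y k t - Y l t)) ->
  (forall k l t, k != l -> z' k false t = z' l false t ->
     0 < (z' k true t - z' l true t) * (Y k t - Y l t)) ->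
  (forall k l t, k != l -> Y k t = Y l t ->
     0 < (z k false t - z l false t) * (z' k false t - z' l false t)) ->
  homot p z z'.
Proof.
move=> Bz Bz' CY Y0 Y1 zY z'Y YY.
pose W (w : motion) : motion := fun k b => if b then Y k else w k false.
have BW w : smooth_braiding p w ->
    (forall k l t, k != l -> w k false t = w l false t ->
      0 < (w k true t - w l true t) * (Y k t - Y l t)) ->
    smooth_braiding p (W w) /\ homot p w (W w).
  move=> Bw wY; have [Cw [Sw Ew Dw]] := Bw; have BW : smooth_braiding p (W w).
    split; first by move=> k [] /=; [exact: CY|exact: (Cw k false)].
    split=> [k [] t t0|k [] t t1|k l t e]; rewrite /W /=.
    - exact: Y0.
    - exact: Sw.
    - exact: Y1.
    - exact: Ew.
    - apply/eqP/negP => /negP kl; have := wY k l t kl (e false).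
      by have := e true; rewrite /W => ->; rewrite subrr mulr0 ltxx.
  split=> //; apply: homot_linear => // s k l t s01 kl e.
  have e0 := e false; have e1 := e true; rewrite /W in e0 e1.
  have ee : w k false t = w l false t by lra.
  exact: (same_sign_convex (wY k l t kl ee) s01 e1).
have [BW1 H1] := BW _ Bz zY; have [BW2 H2] := BW _ Bz' z'Y.
apply: homot_trans H1 _; apply: homot_trans (homot_sym H2).
apply: homot_linear => // s k l t s01 kl e.
have e0 := e false; have e1 := e true; rewrite /W in e0 e1.
apply: (same_sign_convex (YY k l t kl _) s01 e0); lra.
Qed.

(** ** Concatenation along a schedule of time intervals *)

(** Outside of its own interval every motion of the list is constant, so the
    sum of the displacements performs them one after the other. *)
Fixpoint seq_motion (zs : seq ('S_n * motion)) (cs : seq (R * R)) : motion :=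
  match zs, cs with
  | (p, z) :: zs', (a, c) :: cs' => fun k b t =>
      z k b ((t - a) / (c - a)) + seq_motion zs' cs' (p k) b t - home (p k) b
  | _, _ => fun k b _ => home k b
  end.

Definition seq_perm (T : Type) (zs : seq ('S_n * T)) : 'S_n :=
  foldr (fun x q => (x.1 * q)%g) 1%g zs.

Fixpoint schedule (lo : R) (cs : seq (R * R)) : Prop :=
  match cs with
  | [::] => lo <= 1
  | (a, c) :: cs' => [/\ lo <= a, a < c & schedule c cs']
  end.

Lemma schedule_le1 lo cs : schedule lo cs -> lo <= 1.
Proof.
elim: cs lo => [//|[a c] cs IH] lo /= [la ac /IH]; lra.
Qed.

Fixpoint all_braiding (zs : seq ('S_n * motion)) : Prop :=
  match zs with
  | [::] => True
  | (p, z) :: zs' => is_braiding p z /\ all_braiding zs'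
  end.

Lemma seq_motion_facts zs cs lo : all_braiding zs -> size cs = size zs ->
  schedule lo cs ->
  [/\ forall k b t, t <= lo -> seq_motion zs cs k b t = home k b,
      forall k b t, 1 <= t -> seq_motion zs cs k b t = home (seq_perm zs k) b
    & forall k l t, (forall b, seq_motion zs cs k b t = seq_motion zs cs l b t) ->
      k = l].
Proof.
elim: zs cs lo => [|[p z] zs IH] [|[a c] cs] lo //=.
  move=> _ _ l1; split=> // [k b t _|k l t]; last exact: home_inj.
  by rewrite perm1.
move=> [[Sz Ez Dz] Bzs] [sz] [la ac sch].
have [S E D] := IH cs c Bzs sz sch; have c1 := schedule_le1 sch.
have ca : 0 < c - a by rewrite subr_gt0.
have Sz' k b t : t <= a -> z k b ((t - a) / (c - a)) = home k b.
  by move=> ta; apply: Sz; rewrite pmulr_lle0 ?invr_gt0 // subr_le0.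
have Ez' k b t : c <= t -> z k b ((t - a) / (c - a)) = home (p k) b.
  by move=> tc; apply: Ez; rewrite ler_pdivlMr // mul1r lerD2r.
split=> [k b t tl|k b t t1|k l t e].
- rewrite Sz' ?S ?addrK //; first by rewrite (le_trans tl) ?(le_trans la) ?ltW.
  by rewrite (le_trans tl).
- rewrite Ez'; last exact: le_trans c1 t1.
  rewrite E //.
  by rewrite /seq_perm /= permM; ring.
- have [tc|/ltW tc] := leP t c.
    by apply: (Dz _ _ ((t - a) / (c - a))) => b; have := e b; rewrite !S ?addrK.
  apply: (@perm_inj _ p); apply: (D _ _ t) => b; have := e b.
  by rewrite !Ez' //; lra.
Qed.

End Motions.

Section Schedules.
Context {R : realType} {n : nat}.
Implicit Types (p : 'S_n) (k l : 'I_n) (b : bool) (s t : R).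
Implicit Types (z : @motion R n) (f : R -> @motion R n).

Lemma convex_le (a c a' c' s : R) : 0 <= s <= 1 -> a <= c -> a' <= c' ->
  (1 - s) * a + s * a' <= (1 - s) * c + s * c'.
Proof.
by move=> /andP[s0 s1] ac ac'; rewrite lerD // ler_wpM2l // subr_ge0.
Qed.

Lemma convex_lt (a c a' c' s : R) : 0 <= s <= 1 -> a < c -> a' < c' ->
  (1 - s) * a + s * a' < (1 - s) * c + s * c'.
Proof.
move=> /andP[s0 s1] ac ac'; have [->|sp] := eqVneq s 1.
  by rewrite subrr !mul0r !add0r !mul1r.
have s1' : 0 < 1 - s by rewrite subr_gt0 lt_neqAle sp.
by rewrite ltr_leD //; [rewrite ltr_pM2l|rewrite ler_wpM2l // ltW].
Qed.

Definition interp_schedule s (cs cs' : seq (R * R)) : seq (R * R) :=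
  [seq ((1 - s) * x.1.1 + s * x.2.1, (1 - s) * x.1.2 + s * x.2.2)
     | x <- zip cs cs'].

Lemma schedule_interp s lo lo' cs cs' : 0 <= s <= 1 -> size cs = size cs' ->
  schedule lo cs -> schedule lo' cs' ->
  schedule ((1 - s) * lo + s * lo') (interp_schedule s cs cs').
Proof.
move=> s01; elim: cs cs' lo lo' => [|[a c] cs IH] [|[a' c'] cs'] lo lo' //=.
  move=> _ l1 l1'; have := convex_le s01 l1 l1'; lra.
move=> [sz] [la ac sch] [la' ac' sch']; split; first exact: convex_le.
  exact: convex_lt.
exact: IH.
Qed.

Fixpoint all_smooth (fs : seq ('S_n * (R -> @motion R n))) : Prop :=
  match fs with
  | [::] => True
  | (_, f) :: fs' => smooth_family f /\ all_smooth fs'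
  end.

Definition seq_at s (fs : seq ('S_n * (R -> @motion R n))) :=
  [seq (x.1, x.2 s) | x <- fs].

Lemma seq_motion_smooth fs cs cs' lo lo' : all_smooth fs ->
  size cs = size cs' -> schedule lo cs -> schedule lo' cs' ->
  smooth_family
    (fun s => seq_motion (seq_at s fs) (interp_schedule (clamp s) cs cs')).
Proof.
elim: fs cs cs' lo lo' => [|[p f] fs IH] [|[a c] cs] [|[a' c'] cs'] lo lo' //=;
  try by move=> *; move=> k b; exact: joint_C1_cst.
move=> [Cf Cfs] [sz] [_ ac sch] [_ ac' sch'] k b /=.
have c1 : continuous (fun s : R => 1 - clamp s).
  by move=> s; apply: cvgB; [exact: cvg_cst|exact: clamp_continuous].
have ci (x y : R) : continuous (fun s : R => (1 - clamp s) * x + clamp s * y).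
  move=> s; apply: cvgD; apply: cvgM; first exact: c1.
  - exact: cvg_cst.
  - exact: clamp_continuous.
  - exact: cvg_cst.
apply: joint_C1B; last exact: joint_C1_cst.
apply: joint_C1D; last exact: (IH _ _ _ _ Cfs sz sch sch' (p k) b).
have cid : continuous (@id R) by move=> s; exact: cvg_id.
apply: (joint_C1_comp cid (Cf k b)); apply: joint_C1M.
  apply: joint_C1B; first exact: joint_C1_time.
  exact/joint_C1_param/ci.
apply: joint_C1_param => s; apply: cvgV.
  by rewrite subr_eq0 gt_eqF //; apply: convex_lt => //; exact: clamp01.
by apply: cvgB; exact: ci.
Qed.

Fixpoint all_homot (zs zs' : seq ('S_n * @motion R n)) : Prop :=
  match zs, zs' with
  | [::], [::] => True
  | (p, z) :: zs1, (p', z') :: zs1' =>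
      [/\ p = p', homot p z z' & all_homot zs1 zs1']
  | _, _ => False
  end.

Lemma all_homot_family zs zs' : all_homot zs zs' ->
  exists fs, [/\ all_smooth fs, seq_at 0 fs = zs, seq_at 1 fs = zs'
    & forall s, 0 <= s <= 1 -> all_braiding (seq_at s fs)].
Proof.
elim: zs zs' => [|[p z] zs IH] [|[p' z'] zs'] //=; first by exists [::].
move=> [<- [f [Cf Bf f0 f1]] /IH[fs [Cfs fs0 fs1 Bfs]]].
exists ((p, f) :: fs); split=> //=; first by rewrite f0; congr (_ :: _).
  by rewrite f1; congr (_ :: _).
by move=> s s01; split; [exact: Bf|exact: Bfs].
Qed.

(** Two schedules interpolate linearly: this moves each motion of a
    concatenation through a homotopy while changing its time interval. *)
Lemma homot_seq zs zs' cs cs' : all_homot zs zs' ->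
  size cs = size zs -> size cs' = size zs -> schedule 0 cs -> schedule 0 cs' ->
  homot (seq_perm zs) (seq_motion zs cs) (seq_motion zs' cs').
Proof.
move=> /all_homot_family[fs [Cfs <- <- Bfs]].
rewrite !size_map => sz sz' sch sch'.
have szz : size cs = size cs' by rewrite sz.
have i0 : interp_schedule 0 cs cs' = cs.
  rewrite -[RHS](@unzip1_zip _ _ cs cs') ?szz //; apply: eq_map => -[[a c] [a' c']] /=.
  by congr (_, _); ring.
have i1 : interp_schedule 1 cs cs' = cs'.
  rewrite -[RHS](@unzip2_zip _ _ cs cs') ?szz //; apply: eq_map => -[[a c] [a' c']] /=.
  by congr (_, _); ring.
exists (fun s => seq_motion (seq_at s fs) (interp_schedule (clamp s) cs cs')); split.
- exact: seq_motion_smooth sch sch'.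
- move=> s s01; rewrite clamp_id //.
  have := schedule_interp s01 szz sch sch'; rewrite !mulr0 addr0 => schs.
  have [|S E D] := seq_motion_facts (Bfs s s01) _ schs.
    by rewrite !size_map size_zip szz minnn -szz.
  have pE : seq_perm (seq_at s fs) = seq_perm (seq_at 0 fs).
    by rewrite /seq_perm /seq_at !foldr_map.
  by split=> // k b t t1; rewrite -pE E.
- by rewrite clamp_le0 // i0.
- by rewrite clamp_ge1 // i1.
Qed.

(** ** Words *)

Definition concat p z z' : @motion R n := fun k b t =>
  z k b (2 * t) + z' (p k) b (2 * t - 1) - home (p k) b.

Lemma concat_seq p z p' z' k b t :
  seq_motion [:: (p, z); (p', z')] [:: (0, 1 / 2); (1 / 2, 1)] k b t =
  concat p z z' k b t.
Proof.
rewrite /= /concat addrK.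
have -> : (t - 0) / (1 / 2 - 0) = 2 * t by field.
by have -> : (t - 1 / 2) / (1 - 1 / 2) = 2 * t - 1 by field.
Qed.

Lemma homot_concat p p' z z1 z' z1' : homot p z z1 -> homot p' z' z1' ->
  homot (p * p')%g (concat p z z') (concat p z1 z1').
Proof.
move=> H H'; apply: homot_ext (concat_seq p z p' z') (concat_seq p z1 p' z1') _.
have -> : (p * p')%g = seq_perm [:: (p, z); (p', z')] by rewrite /= mulg1.
by apply: homot_seq => //=; do 3?split; lra.
Qed.

Lemma smooth_concat p p' z z' : smooth_braiding p z -> smooth_braiding p' z' ->
  smooth_braiding (p * p')%g (concat p z z').
Proof.
by move=> /homot_refl H /homot_refl H'; exact: homot_smoothl (homot_concat H H').
Qed.

Lemma homot_concatA p p' p'' z z' z'' : smooth_braiding p z ->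
  smooth_braiding p' z' -> smooth_braiding p'' z'' ->
  homot (p * p' * p'')%g (concat p z (concat p' z' z''))
    (concat (p * p')%g (concat p z z') z'').
Proof.
move=> B B' B''; pose zs := [:: (p, z); (p', z'); (p'', z'')].
apply: (@homot_ext _ _ _ (seq_motion zs [:: (0, 1 / 2); (1 / 2, 3 / 4); (3 / 4, 1)])
   _ (seq_motion zs [:: (0, 1 / 4); (1 / 4, 1 / 2); (1 / 2, 1)])).
- move=> k b t; rewrite /= /concat.
  have -> : (t - 0) / (1 / 2 - 0) = 2 * t by field.
  have -> : (t - 1 / 2) / (3 / 4 - 1 / 2) = 2 * (2 * t - 1) by field.
  have -> : (t - 3 / 4) / (1 - 3 / 4) = 2 * (2 * t - 1) - 1 by field.
  by ring.
- move=> k b t; rewrite /= /concat permM.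
  have -> : (t - 0) / (1 / 4 - 0) = 2 * (2 * t) by field.
  have -> : (t - 1 / 4) / (1 / 2 - 1 / 4) = 2 * (2 * t) - 1 by field.
  have -> : (t - 1 / 2) / (1 - 1 / 2) = 2 * t - 1 by field.
  by ring.
have -> : (p * p' * p'')%g = seq_perm zs by rewrite /= mulg1 mulgA.
apply: homot_seq => //=; try by do 3?split; lra.
by repeat split=> //; exact: homot_refl.
Qed.

Definition still : @motion R n := fun k b _ => home k b.

Lemma smooth_still : smooth_braiding 1%g still.
Proof.
split; first by move=> k b; exact: joint_C1_cst.
split=> // [k b t _|k l t]; first by rewrite perm1.
exact: home_inj.
Qed.

Lemma homot_still_concat p z : smooth_braiding p z ->
  homot p z (concat 1%g still z).
Proof.
move=> B; pose zs := [:: (p, z)].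
apply: (@homot_ext _ _ _ (seq_motion zs [:: (0, 1)])
   _ (seq_motion zs [:: (1 / 2, 1)])).
- by move=> k b t; rewrite /= addrK subr0 subr0 divr1.
- move=> k b t; rewrite /= /concat /still perm1 addrK.
  have -> : (t - 1 / 2) / (1 - 1 / 2) = 2 * t - 1 by field.
  by ring.
have -> : p = seq_perm zs by rewrite /= mulg1.
apply: homot_seq => //=; try by do 3?split; lra.
by split=> //; exact: homot_refl.
Qed.

(** As opposed to the strands of a word, the motions are constant before time 0
    and after time 1, and they are given by one formula: that makes them smooth
    without any gluing. *)
Definition letter_motion (x : braid_letter n) : @motion R n := fun k b t =>
  let u := step t in
  let y := (if x.2 then 1 else -1) * (u * (1 - u)) in
  if k == pos_left x.1 then if b then y else k%:R + u
  else if k == pos_right x.1 then if b then - y else k%:R - u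
  else home k b.

Fixpoint word_motion (w : braid_word n) : @motion R n :=
  match w with
  | [::] => still
  | x :: w' => concat (letter_perm x) (letter_motion x) (word_motion w')
  end.

Lemma pos_neq (i : 'I_n.-1) : (pos_left i == pos_right i) = false.
Proof. by rewrite -val_eqE /=; apply/negbTE; rewrite neq_ltn ltnSn. Qed.

Lemma letter_perm_left (x : braid_letter n) :
  letter_perm x (pos_left x.1) = pos_right x.1.
Proof. exact: tpermL. Qed.

Lemma letter_perm_right (x : braid_letter n) :
  letter_perm x (pos_right x.1) = pos_left x.1.
Proof. exact: tpermR. Qed.

Lemma letter_perm_other (x : braid_letter n) k : k != pos_left x.1 ->
  k != pos_right x.1 -> letter_perm x k = k.
Proof. by move=> kl kr; rewrite /letter_perm tpermD // eq_sym. Qed.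

(** The two strands of a letter meet in the row only halfway, where the depth
    separates them. *)
Lemma letter_meet (x : braid_letter n) k l t : k != l ->
  letter_motion x k false t = letter_motion x l false t ->
  step t = 1 / 2 /\
  (k = pos_left x.1 /\ l = pos_right x.1 \/ k = pos_right x.1 /\ l = pos_left x.1).
Proof.
have rR : (pos_right x.1)%:R = (pos_left x.1)%:R + 1 :> R by rewrite /= -natr1.
rewrite /letter_motion.
move: (step_ge0 t) (step_le1 t); set u := step t => u0 u1.
set L := pos_left x.1; set P := pos_right x.1 => kl.
have nat_eq (i : 'I_n) : i != L -> i != P -> forall v : R, 0 <= v <= 1 ->
    i%:R <> L%:R + v :> R.
  move=> iL iP v /andP[v0 v1] ev.
  have : (L <= i <= P)%N by rewrite -!(ler_nat R) ev rR; lra.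
  by move: iL iP; rewrite -!val_eqE /=; lia.
have lr : L%:R + u = P%:R - u -> u = 1 / 2 by rewrite rR; lra.
have u01 : 0 <= u <= 1 by rewrite u0.
have v01 : 0 <= 1 - u <= 1 by rewrite subr_ge0 u1 gerBl.
move: kl; have [->|kL] := eqVneq k L; have [->|lL] := eqVneq l L.
- by move=> /eqP.
- have [->|lP] := eqVneq l P; first by move=> _ /lr; tauto.
  by move=> _ e1; case: (nat_eq l lL lP u u01).
- have [->|kP] := eqVneq k P; first by move=> _ /esym/lr; tauto.
  by move=> _ e1; case: (nat_eq k kL kP u u01).
- have [->|kP] := eqVneq k P; have [->|lP] := eqVneq l P; try by move=> /eqP.
  + by rewrite /home rR => _ e1; case: (nat_eq l lL lP _ v01); rewrite -e1 addrA.
  + by rewrite /home rR => _ e1; case: (nat_eq k kL kP _ v01); rewrite e1 addrA.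
  + by rewrite /home => kl /eqP; rewrite eqr_nat => /eqP/val_inj/eqP; rewrite (negbTE kl).
Qed.

Lemma smooth_letter (x : braid_letter n) :
  smooth_braiding (letter_perm x) (letter_motion x).
Proof.
have rR : (pos_right x.1)%:R = (pos_left x.1)%:R + 1 :> R by rewrite /= -natr1.
split=> [k b|].
  have cu := @joint_C1_step R.
  have cy (a : R) : joint_C1 (fun _ t => a * (step t * (1 - step t))).
    apply: joint_C1M; first exact: joint_C1_cst.
    by apply: joint_C1M => //; apply: joint_C1B => //; exact: joint_C1_cst.
  rewrite /letter_motion; case: (k == pos_left _); last case: (k == pos_right _).
  - by case: b => //; apply: joint_C1D => //; exact: joint_C1_cst.
  - by case: b; [exact: joint_C1N|apply: joint_C1B => //; exact: joint_C1_cst].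
  - exact: joint_C1_cst.
split=> [k b t t0|k b t t1|k l t e].
- rewrite /letter_motion step_le0 // !mul0r !mulr0 oppr0 !addr0 /home.
  by do 2?case: ifP.
- rewrite /letter_motion step_ge1 // subrr !mulr0 oppr0.
  have [->|kl] := eqVneq k (pos_left x.1); first by rewrite letter_perm_left -rR.
  have [->|kr] := eqVneq k (pos_right x.1).
    by rewrite letter_perm_right rR addrK.
  by rewrite letter_perm_other.
- have [//|kl] := eqVneq k l; have [u2 kl2] := letter_meet kl (e false).
  have := e true; rewrite /letter_motion u2.
  by case: kl2 => -[-> ->]; rewrite !eqxx (eq_sym (pos_right _)) pos_neq;
    case: ifP => _ h; exfalso; lra.
Qed.

Lemma word_perm_cons (x : braid_letter n) w :
  word_perm (x :: w) = (letter_perm x * word_perm w)%g.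
Proof. by rewrite /word_perm big_cons. Qed.

Lemma word_perm_nil : word_perm [::] = 1%g :> 'S_n.
Proof. by rewrite /word_perm big_nil. Qed.

Lemma word_perm_cat (u v : braid_word n) :
  word_perm (u ++ v) = (word_perm u * word_perm v)%g.
Proof. by rewrite /word_perm big_cat. Qed.

Lemma smooth_word w : smooth_braiding (word_perm w) (word_motion w).
Proof.
elim: w => [|x w IH] /=; first by rewrite word_perm_nil; exact: smooth_still.
by rewrite word_perm_cons; apply: smooth_concat => //; exact: smooth_letter.
Qed.

Lemma letter_motionE (x : braid_letter n) k t : 0 <= t <= 1 ->
  letter_strand x k t = (letter_motion x k false t, letter_motion x k true t).
Proof.
by move=> t01; rewrite /letter_strand /letter_motion step_ease //; do 2?case: ifP.
Qed.

Lemma word_motionE w k t : 0 <= t <= 1 ->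
  word_strand w k t = (word_motion w k false t, word_motion w k true t).
Proof.
elim: w k t => [|x w IH] k t t01 //=; rewrite /concat.
have [_ [S E _]] := smooth_letter x; have [_ [Sw _ _]] := smooth_word w.
case: (leP t (1 / 2)) => t2.
  by rewrite letter_motionE; [rewrite !Sw ?addrK //; lra|lra].
rewrite IH; last lra.
by rewrite !E; [congr (_, _); ring|lra|lra].
Qed.

Lemma homot_word_cat u v : homot (word_perm (u ++ v)) (word_motion (u ++ v))
  (concat (word_perm u) (word_motion u) (word_motion v)).
Proof.
elim: u => [|x u IH] /=.
  by rewrite word_perm_nil; apply: homot_still_concat; exact: smooth_word.
have Bx := smooth_letter x; have Bu := smooth_word u; have Bv := smooth_word v.
have := homot_concatA Bx Bu Bv; rewrite !word_perm_cons word_perm_cat !mulgA.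
apply: homot_trans; rewrite -mulgA -word_perm_cat.
by apply: homot_concat => //; exact: homot_refl.
Qed.

End Schedules.

(** * Equivalent words have homotopic motions *)

Section Crossings.
Context {R : realType} {n : nat}.
Implicit Types (p : 'S_n) (k l : 'I_n) (b : bool) (s t : R).
Implicit Types (z : @motion R n) (w u v : braid_word n).

Lemma concat_left p p' z z' k b t : is_braiding p' z' -> t <= 1 / 2 ->
  concat p z z' k b t = z k b (2 * t).
Proof. by move=> [S _ _] t2; rewrite /concat S ?addrK //; lra. Qed.

Lemma concat_right p z z' k b t : is_braiding p z -> 1 / 2 <= t ->
  concat p z z' k b t = z' (p k) b (2 * t - 1).
Proof. by move=> [_ E _] t2; rewrite /concat E; [ring|lra]. Qed.

Definition swaps (x : braid_letter n) k l :=
  (k == pos_left x.1) && (l == pos_right x.1).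

(** The sign of a letter decides which of its two strands has the greater
    depth. *)
Fixpoint passes_over w k l : bool :=
  match w with
  | [::] => true
  | x :: w' => [&& swaps x k l ==> x.2, swaps x l k ==> ~~ x.2
      & passes_over w' (letter_perm x k) (letter_perm x l)]
  end.

Fixpoint never_meet w k l : bool :=
  match w with
  | [::] => true
  | x :: w' => [&& ~~ swaps x k l, ~~ swaps x l k
      & never_meet w' (letter_perm x k) (letter_perm x l)]
  end.

Lemma passes_overP w k l t : passes_over w k l -> k != l ->
  word_motion w k false t = word_motion w l false t ->
  word_motion w l true t < word_motion w k true t :> R.
Proof.
elim: w k l t => [|x w IH] k l t /=.
  move=> _ kl; rewrite /still /home => /eqP.
  by rewrite eqr_nat => /eqP/val_inj/eqP; rewrite (negbTE kl).
move=> /and3P[okl olk ow] kl.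
have [_ Bx] := @smooth_letter R n x; have [_ Bw] := @smooth_word R n w.
have [t2|/ltW t2] := leP t (1 / 2); last first.
  by rewrite !(concat_right _ _ _ Bx) //; apply: IH => //; rewrite (inj_eq perm_inj).
rewrite !(concat_left _ _ _ _ Bw) // => e; have [u2 kl2] := letter_meet kl e.
rewrite /letter_motion u2; case: kl2 => -[ek el]; subst k l.
  move: okl; rewrite /swaps !eqxx /= => ->.
  by rewrite !(eq_sym (pos_right _)) pos_neq; lra.
move: olk; rewrite /swaps !eqxx /= => /negbTE ->.
by rewrite !(eq_sym (pos_right _)) pos_neq; lra.
Qed.

Lemma letter_perm_val (x : braid_letter n) k : val (letter_perm x k) =
  if k == x.1 :> nat then x.1.+1 else if k == x.1.+1 :> nat then x.1 : nat else k.
Proof.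
rewrite /letter_perm permE /= -!(inj_eq val_inj) /=.
by case: ifP => // _; case: ifP.
Qed.

Lemma letter_order (a c i : nat) (h : R) : 0 <= h <= 1 -> (a < c)%N ->
  ~~ ((a == i) && (c == i.+1)) ->
  (if a == i then a%:R + h else if a == i.+1 then a%:R - h else a%:R) <
  (if c == i then c%:R + h else if c == i.+1 then c%:R - h else c%:R).
Proof.
move=> /andP[h0 h1] ac nac.
have le1 (x y : nat) : (x + 1 <= y)%N -> x%:R + 1 <= y%:R :> R.
  by rewrite -(ler_nat R) natrD.
have le2 (x y : nat) : (x + 2 <= y)%N -> x%:R + 2 <= y%:R :> R.
  by rewrite -(ler_nat R) natrD.
have ac1 := le1 a c; have ac2 := le2 a c.
case: (eqVneq a i) nac => [ai|ai]; case: (eqVneq c i) => [ci|ci];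
  case: (eqVneq c i.+1) => [ci1|ci1] //= _; try lia;
  try (case: (eqVneq a i.+1) => [ai1|ai1]); try lia;
  by (have := ac2 ltac:(lia); lra) || (have := ac1 ltac:(lia); lra).
Qed.

Lemma never_meetP w k l t : never_meet w k l -> (k < l)%N ->
  word_motion w k false t < word_motion w l false t :> R.
Proof.
elim: w k l t => [|x w IH] k l t /=; first by rewrite /still /home ltr_nat.
move=> /and3P[okl olk ow] kl.
have [_ Bx] := @smooth_letter R n x; have [_ Bw] := @smooth_word R n w.
have [t2|/ltW t2] := leP t (1 / 2); last first.
  rewrite !(concat_right _ _ _ Bx) //; apply: IH => //.
  rewrite !letter_perm_val; move: okl olk; rewrite /swaps -!val_eqE /=.
  by do 4?case: eqP => ? //=; lia.
rewrite !(concat_left _ _ _ _ Bw) // /letter_motion /home -!(inj_eq val_inj) /=.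
apply: letter_order => //; first by rewrite step_ge0 step_le1.
Qed.

(** If every strand passes over the strands to its right (for e = true, or to its
    left), its depth can be replaced by a height that depends only on the
    strand, and this height is common to both words. *)
Lemma homot_monotone (e : bool) w w' : word_perm w = word_perm w' ->
  (forall k l, (if e then k < l else l < k)%N ->
     passes_over w k l && passes_over w' k l) ->
  @homot R n (word_perm w) (word_motion w) (word_motion w').
Proof.
move=> pE ov.
have Bw := @smooth_word R n w; have Bw' := @smooth_word R n w'; rewrite -pE in Bw'.
pose h k : R := if e then - k%:R else k%:R.
have hlt k l : (if e then k < l else l < k)%N -> h l < h k.
  by rewrite /h; case: ifP => _; rewrite ?ltrN2 ltr_nat.
have key w1 k l t : @smooth_braiding R n (word_perm w) (word_motion w1) ->
   (forall k l, (if e then k < l else l < k)%N -> passes_over w1 k l) -> k != l ->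
   word_motion w1 k false t = word_motion w1 l false t ->
   0 < (word_motion w1 k true t - word_motion w1 l true t) *
       (sqpos t * sqpos (1 - t) * h k - sqpos t * sqpos (1 - t) * h l).
  move=> [_ [S E _]] o kl ex.
  have nn (i j : 'I_n) : i != j -> i%:R = j%:R :> R -> False.
    by move=> ij /eqP; rewrite eqr_nat => /eqP/val_inj/eqP; rewrite (negbTE ij).
  have [t0|t0] := leP t 0; first by move: ex; rewrite !S // => /(nn _ _ kl).
  have [t1|t1] := leP 1 t.
    by move: ex; rewrite !E // => /nn; case; rewrite (inj_eq perm_inj).
  have q : 0 < sqpos t * sqpos (1 - t) :> R by rewrite mulr_gt0 ?sqpos_gt0 // subr_gt0.
  rewrite -mulrBr mulrCA pmulr_rgt0 //.
  have pos i j : i != j -> word_motion w1 i false t = word_motion w1 j false t ->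
      (if e then i < j else j < i)%N ->
      0 < (word_motion w1 i true t - word_motion w1 j true t) * (h i - h j).
    by move=> ij xij lij; rewrite mulr_gt0 // subr_gt0; [apply: passes_overP => //; exact: o|exact: hlt].
  have : ((if e then k < l else l < k) || (if e then l < k else k < l))%N.
    by move: kl; rewrite -val_eqE neq_ltn /=; case: (e); rewrite // orbC.
  case/orP => c; first exact: pos.
  by rewrite -mulrNN !opprB; apply: pos => //; rewrite eq_sym.
apply: (@homot_depth _ _ _ _ _ (fun k t => sqpos t * sqpos (1 - t) * h k)) => //.
- move=> k; apply: joint_C1M; last exact: joint_C1_cst.
  apply: joint_C1M; first exact: joint_C1_sqpos.
  apply: (joint_C1_retime joint_C1_sqpos); apply: joint_C1B.
    exact: joint_C1_cst.
  exact: joint_C1_time.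
- by move=> k t t0; rewrite sqpos_le0 // !mul0r.
- by move=> k t t1; rewrite (@sqpos_le0 _ (1 - t)) ?mulr0 ?mul0r // subr_le0.
- by move=> k l t kl; apply: key => // i j /ov/andP[].
- by move=> k l t kl; apply: key => // i j /ov/andP[].
- move: Bw Bw' => [_ [S E _]] [_ [S' E' _]] k l t kl; have [t0|t0] := leP t 0.
    move=> _; rewrite !S // !S' //.
    by rewrite /home -expr2 exprn_even_gt0 //= subr_eq0 eqr_nat.
  have [t1|t1] := leP 1 t.
    move=> _; rewrite !E // !E' //.
    by rewrite /home -expr2 exprn_even_gt0 //= subr_eq0 eqr_nat (inj_eq val_inj) (inj_eq perm_inj).
  have q : 0 < sqpos t * sqpos (1 - t) :> R by rewrite mulr_gt0 ?sqpos_gt0 // subr_gt0.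
  move=> /(mulfI (lt0r_neq0 q)) hh.
  have : k%:R = l%:R :> R by move: hh; rewrite /h; case: ifP => _ // /oppr_inj.
  by move=> /eqP; rewrite eqr_nat => /eqP/val_inj/eqP; rewrite (negbTE kl).
Qed.

(** On both sides of each relation every strand passes over the strands to its
    right; only for the cancellation of an inverse letter followed by the letter
    it is the strands to its left. *)
Lemma braid_equiv_homot w w' : braid_equiv w w' ->
  @homot R n (word_perm w) (word_motion w) (word_motion w').
Proof.
elim=> {w w'} [w|w w' ww' IH|w w' w'' ww' IH w'w'' IH'|u u' v v' uu' IHu vv' IHv|i e|i j ij|i j ij].
- exact/homot_refl/smooth_word.
- by rewrite -(word_perm_equiv ww'); exact: homot_sym.
- by apply: homot_trans IH _; rewrite (word_perm_equiv ww').
- apply: homot_trans (homot_word_cat _ _) _.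
  rewrite word_perm_cat; have H := homot_concat IHu IHv.
  apply: homot_trans H _; rewrite (word_perm_equiv uu') (word_perm_equiv vv').
  rewrite -word_perm_cat; exact/homot_sym/homot_word_cat.
- apply: (@homot_monotone e); first exact/word_perm_equiv/BraidCancel.
  move=> k l kl; rewrite /= andbT /swaps /= -!val_eqE /= !letter_perm_val /=.
  move: (nat_of_ord k) (nat_of_ord l) (nat_of_ord i) kl => a c m kl.
  case: (a =P m) => am; case: (a =P m.+1) => am1; case: (c =P m) => cm;
    case: (c =P m.+1) => cm1; move: kl; case: (e) => /= kl; lia.
- apply: (@homot_monotone true); first exact/word_perm_equiv/BraidFar.
  move=> k l kl; rewrite /= !andbT /swaps /= -!val_eqE /= !letter_perm_val /=.
  move: (nat_of_ord k) (nat_of_ord l) (nat_of_ord i) (nat_of_ord j) kl ij => a c m q kl ij.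
  case: (a =P m) => am; case: (a =P m.+1) => am1; case: (c =P m) => cm;
    case: (c =P m.+1) => cm1; rewrite /=; try lia;
  case: (a =P q) => aq; case: (a =P q.+1) => aq1; case: (c =P q) => cq;
    case: (c =P q.+1) => cq1; rewrite /=; lia.
- apply: (@homot_monotone true); first exact/word_perm_equiv/BraidYB.
  move=> k l kl; rewrite /= !andbT /swaps /= -!val_eqE /= !letter_perm_val /=.
  move: (nat_of_ord k) (nat_of_ord l) (nat_of_ord i) (nat_of_ord j) kl ij => a c m q kl -> {q}.
  have E : ((m == m.+1) = false) * ((m.+1 == m) = false) * ((m == m.+2) = false) *
    ((m.+2 == m) = false) * ((m.+1 == m.+2) = false) * ((m.+2 == m.+1) = false).
    by do 5?split; apply/eqP; lia.
  have split3 (x : nat) : [\/ x = m, x = m.+1, x = m.+2 |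
      ((x == m) = false) * ((x == m.+1) = false) * ((x == m.+2) = false)].
    case: (eqVneq x m) => [|/negbTE]; first by constructor 1.
    case: (eqVneq x m.+1) => [|/negbTE]; first by constructor 2.
    case: (eqVneq x m.+2) => [|/negbTE]; first by constructor 3.
    by constructor 4.
  case: (split3 a) => ea; case: (split3 c) => ec; move: kl; rewrite ?ea ?ec;
    try lia; move=> _; by do 6?[rewrite ?eqxx ?E ?ea ?ec /=].
Qed.

End Crossings.

(** * The braid kappa as a rotation of the first strand *)

Section Rotation.
Context {R : realType} {n : nat} (n_ge4 : (4 <= n)%N).
Implicit Types (p : 'S_n) (k l : 'I_n) (b : bool) (s t : R).

(** The circle with this centre that passes through the position 0 crosses the
    row of strands again between the positions n-2 and n-1. *)
Definition center : R := (2 * n%:R - 3) / 4.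

Lemma n_ge4R : 4 <= n%:R :> R.
Proof. by rewrite (ler_nat R 4 n). Qed.

Lemma center_gt0 : 0 < center.
Proof. by have := n_ge4R; rewrite /center => h; lra. Qed.

(** The circle meets the row of strands at 0 and at n - 3/2 only. *)
Lemma off_circle (j : nat) (v : R) : (0 < j)%N ->
  (center - center * cos v - j%:R) ^+ 2 + (center * sin v) ^+ 2 = 0 -> False.
Proof.
move=> j0 e.
have /eqP := e; rewrite paddr_eq0 ?sqr_ge0 // !sqrf_eq0 => /andP[/eqP e1 /eqP e2].
have e3 : j%:R * (2 * j%:R - 4 * center) = 0.
  have := cos2Dsin2 v.
  have -> : j%:R = center - center * cos v by lra.
  move=> cs; have : (center * sin v) ^+ 2 = 0 by rewrite e2 expr0n.
  have -> : (center - center * cos v) *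
    (2 * (center - center * cos v) - 4 * center) =
    2 * center ^+ 2 * (cos v ^+ 2 + sin v ^+ 2 - 1) - 2 * (center * sin v) ^+ 2 by ring.
  by rewrite cs e2 => _; ring.
have : 2 * j%:R = 4 * center.
  have j1 : j%:R != 0 :> R by rewrite pnatr_eq0 -lt0n.
  by move/eqP: e3; rewrite mulf_eq0 (negbTE j1) /= subr_eq0 => /eqP.
have -> : 4 * center = 2 * n%:R - 3 by rewrite /center; field.
move=> e4; have : ((2 * j + 3)%N%:R == (2 * n)%N%:R :> R).
  by rewrite natrD !natrM; apply/eqP; lra.
by rewrite eqr_nat => /eqP; lia.
Qed.

Definition rotation (phi : R -> R) : @motion R n := fun k b t =>
  if val k == 0%N then
    if b then center * sin (2 * pi * phi t) else center - center * cos (2 * pi * phi t)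
  else home k b.

Lemma sin_int (m : int) : sin (2 * pi * m%:~R) = 0 :> R.
Proof.
have sn (j : nat) : sin (2 * pi * j%:R) = 0 :> R.
  rewrite -[LHS](_ : sin (0 + (pi *+ 2) *+ j) = _).
    by rewrite (periodicn (@sinD2pi R)) sin0.
  by congr sin; rewrite add0r -[LHS]mulr_natr -(mulr_natl pi 2).
case: m => j; first exact: sn.
by rewrite NegzE mulrNz mulrN sinN sn oppr0.
Qed.

Lemma cos_int (m : int) : cos (2 * pi * m%:~R) = 1 :> R.
Proof.
have sn (j : nat) : cos (2 * pi * j%:R) = 1 :> R.
  rewrite -[LHS](_ : cos (0 + (pi *+ 2) *+ j) = _).
    by rewrite (periodicn (@cosD2pi R)) cos0.
  by congr cos; rewrite add0r -[LHS]mulr_natr -(mulr_natl pi 2).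
case: m => j; first exact: sn.
by rewrite NegzE mulrNz mulrN cosN sn.
Qed.

(** The angle functions are measured in turns. *)
Definition turns (m : int) (phi : R -> R) :=
  [/\ joint_C1 (fun _ => phi), forall t, t <= 0 -> phi t = 0
    & forall t, 1 <= t -> phi t = m%:~R].

Lemma rotation_braiding m phi : (forall t, t <= 0 -> phi t = 0) ->
  (forall t, 1 <= t -> phi t = m%:~R) -> is_braiding 1%g (rotation phi).
Proof.
move=> p0 p1.
have h0 k b : val k = 0%N -> home k b = 0 :> R by rewrite /home => /= ->; case: b.
split=> [k b t t0|k b t t1|k l t e].
- rewrite /rotation; case: eqP => // k0; rewrite p0 // h0 // mulr0 sin0 cos0.
  by rewrite mulr0 mulr1 subrr; case: b.
- rewrite /rotation perm1; case: eqP => // k0; rewrite p1 // h0 // sin_int cos_int.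
  by rewrite mulr0 mulr1 subrr; case: b.
have no i j : val i = 0%N -> val j <> 0%N -> (forall b, rotation phi i b t = rotation phi j b t) -> False.
  move=> i0 /eqP/negbTE j0 {}e; have := e false; have := e true.
  rewrite /rotation i0 eqxx j0 /home => e1 e2.
  apply: (@off_circle (val j) (2 * pi * phi t)); first by rewrite lt0n j0.
  by rewrite e1 e2 subrr expr0n addr0.
case: (eqVneq (val k) 0%N) => k0; case: (eqVneq (val l) 0%N) => l0.
- by apply: val_inj; rewrite k0 l0.
- by case: (no k l k0 (elimN eqP l0) e).
- by case: (no l k l0 (elimN eqP k0)) => b; rewrite e.
- by apply: (@home_inj R) => b; have := e b; rewrite /rotation (negbTE k0) (negbTE l0).
Qed.

Lemma rotation_smooth (f : R -> R -> R) : joint_C1 f ->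
  smooth_family (fun s => rotation (f s)).
Proof.
move=> Cf k b; rewrite /rotation; case: (val k == 0%N); last exact: joint_C1_cst.
have Cg : joint_C1 (fun s t => 2 * pi * f s t).
  by apply: joint_C1M => //; exact: joint_C1_cst.
case: b; first apply: joint_C1M; first exact: joint_C1_cst.
  exact: (joint_C1_retime joint_C1_sin).
apply: joint_C1B; first exact: joint_C1_cst.
apply: joint_C1M; first exact: joint_C1_cst.
exact: (joint_C1_retime joint_C1_cos).
Qed.

Lemma smooth_rotation m phi : turns m phi -> smooth_braiding 1%g (rotation phi).
Proof.
move=> [Cp p0 p1]; split; last exact: rotation_braiding p0 p1.
exact: (rotation_smooth Cp).
Qed.

(** Only the total number of turns matters: the angles can be interpolated, as
    the circle never meets the strands at rest. *)
Lemma homot_rotation m phi psi : turns m phi -> turns m psi ->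
  homot 1%g (rotation phi) (rotation psi).
Proof.
move=> [Cp p0 p1] [Cq q0 q1].
exists (fun s => rotation (fun t => (1 - s) * phi t + s * psi t)); split.
- apply: rotation_smooth; apply: joint_C1D; apply: joint_C1M => //;
    apply: joint_C1_param => s; last exact: cvg_id.
  by apply: cvgB; [exact: cvg_cst|exact: cvg_id].
- move=> s s01; apply: (@rotation_braiding m) => t tt; first by rewrite p0 ?q0 //; ring.
  by rewrite p1 ?q1 //; ring.
- by congr rotation; apply/funext => t; ring.
- by congr rotation; apply/funext => t; ring.
Qed.

Lemma turns_step (m : int) : turns m (fun t => m%:~R * step t).
Proof.
split=> [|t t0|t t1]; last by rewrite step_ge1 ?mulr1.
  by apply: joint_C1M; [exact: joint_C1_cst|exact: joint_C1_step].
by rewrite step_le0 ?mulr0.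
Qed.

Definition full_turns (m : int) := rotation (fun t => m%:~R * step t).

Lemma smooth_full_turns m : smooth_braiding 1%g (full_turns m).
Proof. exact: smooth_rotation (turns_step m). Qed.

Lemma concat_full_turns m m' :
  homot 1%g (concat 1%g (full_turns m) (full_turns m')) (full_turns (m + m')).
Proof.
pose phi (t : R) := m%:~R * step (2 * t) + m'%:~R * step (2 * t - 1).
have Ct (a c : R) : joint_C1 (fun _ t => a * t - c).
  by apply: joint_C1B; [apply: joint_C1M; [exact: joint_C1_cst|exact: joint_C1_time]|exact: joint_C1_cst].
have tphi : turns (m + m') phi.
  split=> [|t t0|t t1]; rewrite /phi.
  - apply: joint_C1D; apply: joint_C1M; try exact: joint_C1_cst.
      apply: joint_C1_ext (joint_C1_retime joint_C1_step (Ct 2 0)).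
      by move=> s t; rewrite subr0.
    exact: (joint_C1_retime joint_C1_step (Ct 2 1)).
  - by rewrite !step_le0 ?mulr0 ?addr0 //; lra.
  - by rewrite !step_ge1 ?mulr1 -?intrD //; lra.
have [_ Bm] := smooth_full_turns m; have [_ Bm'] := smooth_full_turns m'.
apply: homot_ext (homot_rotation tphi (turns_step _)) => // k b t.
have [t2|/ltW t2] := leP t (1 / 2).
  rewrite (concat_left _ _ _ _ Bm') // /full_turns /rotation /phi.
  by rewrite (@step_le0 _ (2 * t - 1)) ?mulr0 ?addr0 //; lra.
rewrite (concat_right _ _ _ Bm) // /full_turns /rotation /phi perm1.
rewrite (@step_ge1 _ (2 * t)); last lra.
by rewrite mulr1 mulrDr sinD cosD sin_int cos_int !mul0r !mul1r add0r subr0.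
Qed.

(** ** Ascending and descending words *)

Definition positive_word (s : seq 'I_n.-1) : braid_word n := [seq (i, true) | i <- s].

Lemma passes_over_cat (u v : braid_word n) k l : passes_over (u ++ v) k l =
  passes_over u k l && passes_over v (word_perm u k) (word_perm u l).
Proof.
elim: u k l => [|x u IH] k l /=; first by rewrite word_perm_nil !perm1.
by rewrite IH word_perm_cons !permM -!andbA.
Qed.

Lemma never_meet_cat (u v : braid_word n) k l : never_meet (u ++ v) k l =
  never_meet u k l && never_meet v (word_perm u k) (word_perm u l).
Proof.
elim: u k l => [|x u IH] k l /=; first by rewrite word_perm_nil !perm1.
by rewrite IH word_perm_cons !permM -!andbA.
Qed.

Lemma ascending_word (s : seq 'I_n.-1) r m k : map val s = iota r m -> k = r :> nat ->
  [/\ val (word_perm (positive_word s) k) = (r + m)%N,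
      forall l, l != k -> passes_over (positive_word s) k l,
      forall l l', l != k -> l' != k -> never_meet (positive_word s) l l'
    & forall l, (r + m < l)%N -> word_perm (positive_word s) l = l].
Proof.
elim: s r m k => [|x s IH] r [|m] k //=.
  by move=> _ kr; split=> // *; rewrite word_perm_nil perm1 ?addn0.
move=> [xr sr] kr; have kx : k = pos_left x by apply: val_inj; rewrite /= xr kr.
have [|e po nm fx] := IH _ _ (pos_right x) sr; first by rewrite /= xr.
split=> [|l lk|l l' lk lk'|l rl].
- by rewrite word_perm_cons permM kx letter_perm_left e addSnnS.
- rewrite kx letter_perm_left /swaps /= implybT pos_neq andbF /= po //.
  by rewrite -(letter_perm_left (x, true)) (inj_eq perm_inj) -kx.
- rewrite /swaps -kx (negbTE lk) (negbTE lk') /= nm //=;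
    by rewrite -(letter_perm_left (x, true)) (inj_eq perm_inj) -kx.
- rewrite word_perm_cons permM (@letter_perm_other _ (x, true)) ?fx //; first lia.
    by rewrite -val_eqE /= xr; lia.
  by rewrite -val_eqE /= xr; lia.
Qed.

Lemma positive_word_rcons (s : seq 'I_n.-1) x :
  positive_word (rcons s x) = positive_word s ++ [:: (x, true)].
Proof. by rewrite /positive_word map_rcons cats1. Qed.

Lemma descending_word (s : seq 'I_n.-1) r m k : map val s = iota r m ->
  k = (r + m)%N :> nat ->
  [/\ val (word_perm (positive_word (rev s)) k) = r,
      forall l, l != k -> passes_over (positive_word (rev s)) l k
    & forall l l', l != k -> l' != k -> never_meet (positive_word (rev s)) l l'].
Proof.
elim: s r m k => [|x s IH] r [|m] k //=.
  by move=> _; rewrite addn0 => kr; split=> // *; rewrite word_perm_nil perm1.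
move=> [xr sr] kr; rewrite rev_cons positive_word_rcons.
have [|e po nm] := IH _ _ k sr; first by rewrite kr addSnnS.
have kx : word_perm (positive_word (rev s)) k = pos_right x.
  by apply: val_inj; rewrite /= e xr.
split=> [|l lk|l l' lk lk'].
- rewrite word_perm_cat permM kx word_perm_cons word_perm_nil mulg1.
  by rewrite (letter_perm_right (x, true)) /= xr.
- rewrite passes_over_cat po //= kx /swaps /= implybT andbT /=.
  by rewrite eq_sym pos_neq.
- rewrite never_meet_cat nm //= andbT /swaps /= -kx !(inj_eq perm_inj).
  by rewrite (negbTE lk) (negbTE lk') !andbF.
Qed.

Lemma word_perm_rev (s : seq 'I_n.-1) :
  word_perm (positive_word (rev s)) = (word_perm (positive_word s))^-1%g.
Proof.
elim: s => [|x s IH]; first by rewrite word_perm_nil invg1.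
rewrite rev_cons positive_word_rcons word_perm_cat IH /= !word_perm_cons.
by rewrite word_perm_nil mulg1 invMg /letter_perm tpermV.
Qed.

Definition kappa_gens : seq 'I_n.-1 := [seq i : 'I_n.-1 <- enum 'I_n.-1 | (i < n.-2)%N].

Lemma kappa_gensE : map val kappa_gens = iota 0 n.-2.
Proof.
have -> : kappa_gens =
  seq.filter (preim (@nat_of_ord n.-1) (fun i : nat => (i < n.-2)%N)) (enum 'I_n.-1) by [].
rewrite -filter_map val_enum_ord.
have -> : iota 0 n.-1 = iota 0 n.-2 ++ [:: n.-2].
  by rewrite -[X in iota 0 X](_ : (n.-2 + 1 = n.-1)%N) ?iotaD //; lia.
rewrite filter_cat /= ltnn cats0.
by apply/all_filterP/allP => i; rewrite mem_iota add0n => /andP[].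
Qed.

Definition kappa_word := positive_word kappa_gens ++ positive_word (rev kappa_gens).

Lemma word_perm_kappa : word_perm kappa_word = 1%g.
Proof. by rewrite word_perm_cat word_perm_rev mulgV. Qed.

Lemma sin_first_half t : 0 < t < 1 / 2 -> 0 < sin (2 * pi * step t) :> R.
Proof.
move=> /andP[t0 t2]; apply: sin_gt0_pi; have pi0 := @pi_gt0 R.
have := step_gt0 t0; have := step_lt_half t2; move: (step t) => u u2 u0.
by rewrite !mulr_gt0 //= mulrC mulrA gtr_pMl //; lra.
Qed.

Lemma sin_second_half t : 1 / 2 < t < 1 -> sin (2 * pi * step t) < 0 :> R.
Proof.
move=> /andP[t2 t1].
have -> : sin (2 * pi * step t) = - sin (2 * pi * step (1 - t)) :> R.
  rewrite step_sym mulrBr mulr1 sinB.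
  have -> : 2 * pi = pi *+ 2 :> R by rewrite mulr_natl.
  by rewrite sin2pi cos2pi; ring.
by rewrite oppr_lt0; apply: sin_first_half; lra.
Qed.

End Rotation.

Section KappaRotation.
Context {R : realType} {n : nat} (n_ge4 : (4 <= n)%N).
Implicit Types (p : 'S_n) (k l : 'I_n) (b : bool) (s t : R).

Lemma turns_one : turns 1 (@step R).
Proof.
split=> [|t t0|t t1]; [exact: joint_C1_step|exact: step_le0|].
by rewrite step_ge1.
Qed.

(** In its first half kappa takes the first strand over the strands up to
    position n-2, in its second half back under them, and the other strands do
    not meet: this is what the rotation does, too. *)
Lemma homot_kappa : homot 1%g (word_motion (@kappa_word n)) (@full_turns R n 1).
Proof.
set A := positive_word (@kappa_gens n); set A' := positive_word (rev (@kappa_gens n)).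
have k0P : (0 < n)%N by lia.
pose k0 : 'I_n := Ordinal k0P.
have [eA oA nA fA] := ascending_word n_ge4 (kappa_gensE n_ge4) (erefl : k0 = 0%N :> nat).
rewrite add0n in eA fA.
set pA := word_perm A.
have [eA' oA' nA'] := descending_word (kappa_gensE n_ge4) (eA : pA k0 = (0 + n.-2)%N :> nat).
have BA := @smooth_word R n A; have BA' := @smooth_word R n A'.
set z := concat pA (word_motion A) (word_motion A') : @motion R n.
have pE : (pA * word_perm A')%g = 1%g by rewrite word_perm_rev mulgV.
have Bz : smooth_braiding 1%g z by rewrite -pE; exact: smooth_concat.
have zl k b t : t <= 1 / 2 -> z k b t = word_motion A k b (2 * t).
  exact: (concat_left pA _ _ _ BA'.2).
have zr k b t : 1 / 2 <= t -> z k b t = word_motion A' (pA k) b (2 * t - 1).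
  exact: (concat_right _ _ _ BA.2).
have zh k b : z k b (1 / 2) = home (pA k) b.
  by rewrite zl //; case: BA => _ [_ -> //]; lra.
have homeN k l : k != l -> home k false = home l false :> R -> False.
  by move=> kl /eqP; rewrite /home eqr_nat => /eqP/val_inj/eqP; rewrite (negbTE kl).
apply: homot_trans (homot_trans _ _) (homot_rotation n_ge4 turns_one (turns_step 1)).
  by have := @homot_word_cat R n A A'; rewrite word_perm_cat word_perm_rev mulgV; exact.
have [_ [Sz Ez _]] := Bz.
have Br := smooth_rotation n_ge4 turns_one; have [_ [Sr Er Dr]] := Br.
pose Y k t : R := if val k == 0%N then @center R n * sin (2 * pi * step t) else 0.
have c0 := @center_gt0 R n n_ge4.
have k0E k : (val k == 0%N) = (k == k0) by [].
have Ypos t : 0 < t < 1 / 2 -> 0 < Y k0 t.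
  by move=> tt; rewrite /Y eqxx mulr_gt0 // sin_first_half.
have Yneg t : 1 / 2 < t < 1 -> Y k0 t < 0.
  by move=> tt; rewrite /Y eqxx pmulr_rlt0 // sin_second_half.
have Y0 k t : k != k0 -> Y k t = 0 by rewrite /Y k0E => /negbTE ->.
(* the strands other than the first keep their order *)
have ord k l t : k != k0 -> l != k0 -> (k < l)%N -> z k false t < z l false t.
  move=> kn ln kl; have kl' : (pA k < pA l)%N.
    have := never_meetP (1 : R) (nA k l kn ln) kl.
    by case: BA => _ [_ E _]; rewrite !E // /home ltr_nat.
  have [t2|/ltW t2] := leP t (1 / 2); first by rewrite !zl //; exact: never_meetP (nA _ _ _ _) _.
  rewrite !zr //; apply: never_meetP => //.
  by apply: nA'; rewrite (inj_eq perm_inj).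
have zmeet l t : l != k0 -> z k0 false t = z l false t ->
    0 < (z k0 true t - z l true t) * Y k0 t.
  move=> ln e; have [t0|t0] := leP t 0.
    by case: (homeN k0 l); rewrite 1?eq_sym //; move: e; rewrite !Sz.
  have [t1|t1] := leP 1 t.
    by case: (homeN k0 l); rewrite 1?eq_sym //; move: e; rewrite !Ez ?perm1.
  have [t2|t2|t2] := ltgtP t (1 / 2).
  - rewrite mulr_gt0 ?Ypos ?t0 // subr_gt0.
    move: e; rewrite !zl ?(ltW t2) //; apply: passes_overP; first exact: oA.
    by rewrite eq_sym.
  - rewrite nmulr_rgt0 ?subr_lt0 ?Yneg ?t2 //.
    move: e; rewrite !zr ?(ltW t2) // => /esym; apply: passes_overP.
      by apply: oA'; rewrite (inj_eq perm_inj).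
    by rewrite (inj_eq perm_inj).
  - case: (homeN (pA k0) (pA l)); first by rewrite (inj_eq perm_inj) eq_sym.
    by move: e; rewrite t2 !zh.
have mulrBB (a c d e : R) : (a - c) * (d - e) = (c - a) * (e - d) by ring.
have sgn (z1 : @motion R n) k l t :
    (forall l t, l != k0 -> z1 k0 false t = z1 l false t ->
      0 < (z1 k0 true t - z1 l true t) * Y k0 t) ->
    (forall k l t, k != k0 -> l != k0 -> k != l -> z1 k false t = z1 l false t -> False) ->
    k != l -> z1 k false t = z1 l false t ->
    0 < (z1 k true t - z1 l true t) * (Y k t - Y l t).
  move=> m0 m1 kl e; have [ek|kn] := eqVneq k k0.
    by subst k; rewrite (Y0 l) ?subr0; [apply: m0; rewrite 1?eq_sym|rewrite eq_sym].
  have [el|ln] := eqVneq l k0.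
    subst l; rewrite (Y0 k) ?sub0r //.
    by rewrite -mulrNN !opprB opprK; apply: m0.
  by case: (m1 k l t).
apply: (@homot_depth _ _ _ _ _ Y) => //.
- move=> k; rewrite /Y; case: (val k == 0%N); last exact: joint_C1_cst.
  apply: joint_C1M; first exact: joint_C1_cst.
  apply: (joint_C1_retime joint_C1_sin); apply: joint_C1M; first exact: joint_C1_cst.
  exact: joint_C1_step.
- by move=> k t t0; rewrite /Y step_le0 // mulr0 sin0 mulr0 if_same.
- move=> k t t1; rewrite /Y step_ge1 // (_ : 1 = 1%:~R) // sin_int.
  by rewrite mulr0 if_same.
- move=> k l t; apply: sgn; first exact: zmeet.
  move=> {}k {}l {}t kn ln; rewrite -val_eqE neq_ltn => /orP[c|c] e.
    by have := ord k l t kn ln c; rewrite (e : z k false t = z l false t) ltxx.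
  by have := ord l k t ln kn c; rewrite (e : z k false t = z l false t) ltxx.
- move=> k l t; apply: sgn.
    move=> {}l {}t ln e; have rl : rotation step l true t = 0 :> R.
      by rewrite /rotation k0E (negbTE ln).
    rewrite (_ : Y k0 t = rotation step k0 true t) // rl subr0.
    rewrite -expr2 exprn_even_gt0 //=; apply: contra_neq ln => e2.
    by apply: (Dr _ _ t) => -[]; [rewrite rl e2|exact: esym e].
  move=> {}k {}l {}t kn ln kl; rewrite /rotation !k0E (negbTE kn) (negbTE ln).
  exact: homeN.
- move=> k l t kl YY; rewrite -/pA -/z.
  have sq (a : R) : a != 0 -> 0 < a * a by move=> a0; rewrite -expr2 exprn_even_gt0.
  have hN (i j : 'I_n) : i != j -> home i false - home j false != 0 :> R.
    by rewrite subr_eq0 => ij; apply/eqP => /(homeN _ _ ij).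
  have [t0|t0] := leP t 0; first by rewrite !Sz // !Sr // sq // hN.
  have [t1|t1] := leP 1 t; first by rewrite !Ez // !Er // !perm1 sq // hN.
  have main l' : l' != k0 -> Y k0 t = 0 ->
      0 < (z k0 false t - z l' false t) * (rotation step k0 false t - rotation step l' false t).
    move=> ln Yt; have t2 : t = 1 / 2.
      have [t2|t2|//] := ltgtP t (1 / 2).
        by have := Ypos t; rewrite Yt ltxx t0 t2 => /(_ isT).
      by have := Yneg t; rewrite Yt ltxx t1 t2 => /(_ isT).
    rewrite t2 !zh /rotation /= k0E (negbTE ln) step_half.
    have -> : 2 * pi * (1 / 2) = pi :> R by field.
    rewrite cospi /home eA /center.
    have nE : n%:R = n.-2%:R + 2 :> R.
      by rewrite -natrD; congr (_ %:R); lia.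
    rewrite nE; have [ll|ll] := ltnP l' n.-1; last first.
      rewrite fA; last lia.
      have -> : val l' = (n.-2 + 1)%N by have := ltn_ord l'; rewrite /=; lia.
      by rewrite natrD; lra.
    have pl : (pA l' < n.-2)%N.
      have pl1 : pA l' != pA k0 by rewrite (inj_eq perm_inj).
      have pl2 : val (pA l') != n.-1.
        apply: contraTneq ll => e; have nP : (n.-1 < n)%N by lia.
        have fn : pA (Ordinal nP) = Ordinal nP by apply: fA => /=; lia.
        have -> : l' = Ordinal nP by apply: (@perm_inj _ pA); rewrite fn; exact: val_inj.
        by rewrite /= ltnn.
      by have := ltn_ord (pA l'); move: pl1 pl2; rewrite -val_eqE /= eA; lia.
    have h1 : (pA l')%:R + 1 <= n.-2%:R :> R by rewrite natr1 ler_nat.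
    have h2 : l'%:R <= n.-2%:R :> R by rewrite ler_nat; lia.
    by rewrite mulr_gt0 //; lra.
  have [ek|kn] := eqVneq k k0; have [el|ln] := eqVneq l k0.
  + by move: kl; rewrite ek el eqxx.
  + by subst k; apply: main => //; rewrite YY Y0.
  + subst l; rewrite mulrBB; apply: main => //.
    by rewrite -YY Y0.
  rewrite /rotation !k0E (negbTE kn) (negbTE ln) /home.
  move: kl; rewrite -val_eqE neq_ltn => /orP[c|c].
    by rewrite mulrBB mulr_gt0 // subr_gt0 ?ltr_nat // ord.
  by rewrite mulr_gt0 // subr_gt0 ?ltr_nat // ord.
Qed.

(** ** Powers of kappa *)

Definition kappa_pow_word (m : int) : braid_word n :=
  match m with
  | Posz j => flatten (nseq j (@kappa_word n))
  | Negz j => word_inv (flatten (nseq j.+1 (@kappa_word n)))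
  end.

Lemma word_perm_flatten j : word_perm (flatten (nseq j (@kappa_word n))) = 1%g.
Proof.
elim: j => [|j IH] /=; first exact: word_perm_nil.
by rewrite word_perm_cat IH word_perm_kappa mulg1.
Qed.

Lemma homot_kappa_nat j :
  homot 1%g (word_motion (flatten (nseq j (@kappa_word n)))) (@full_turns R n j).
Proof.
elim: j => [|j IH] /=.
  have := homot_refl (@smooth_still R n); apply: homot_ext => // k b t.
  rewrite /full_turns /rotation mul0r mulr0 sin0 cos0 mulr0 mulr1 subrr.
  by rewrite /still /home; case: eqP => // ->; case: b.
have := @homot_word_cat R n (@kappa_word n) (flatten (nseq j (@kappa_word n))).
rewrite word_perm_cat word_perm_flatten word_perm_kappa // mulg1 => H.
apply: homot_trans H _.
have H := homot_concat homot_kappa IH; rewrite mulg1 in H.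
apply: homot_trans H _.
by rewrite -addn1 addnC PoszD; exact: concat_full_turns.
Qed.

Lemma word_perm_inv (w : braid_word n) : word_perm (word_inv w) = (word_perm w)^-1%g.
Proof.
apply: (mulIg (word_perm w)); rewrite mulVg -word_perm_cat.
by rewrite (word_perm_equiv (word_inv_mulV w)) word_perm_nil.
Qed.

Lemma word_perm_kappa_pow m : word_perm (kappa_pow_word m) = 1%g.
Proof.
by case: m => j; rewrite /kappa_pow_word ?word_perm_inv word_perm_flatten ?invg1.
Qed.

Lemma homot_kappa_pow m :
  homot 1%g (word_motion (kappa_pow_word m)) (@full_turns R n m).
Proof.
case: m => j; first exact: homot_kappa_nat.
set w := flatten (nseq j.+1 (@kappa_word n)).
have pw : word_perm w = 1%g := word_perm_flatten _.
have pw' : word_perm (word_inv w) = 1%g by rewrite word_perm_inv pw invg1.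
have Bw : smooth_braiding 1%g (word_motion (word_inv w) : @motion R n).
  by rewrite -pw'; exact: smooth_word.
have Hw : homot 1%g (word_motion w) (@full_turns R n (Posz j.+1)) := homot_kappa_nat _.
have BT := @smooth_full_turns R n n_ge4.
(* w^-1 is w^-1 * (w * T^-1), hence (w^-1 * w) * T^-1 *)
have H0 : homot 1%g (concat 1%g (full_turns (Posz j.+1)) (full_turns (Negz j))) (@still R n).
  have := @concat_full_turns R n n_ge4 (Posz j.+1) (Negz j); rewrite NegzE subrr => H.
  apply: homot_trans H _; have := homot_refl (@smooth_still R n); apply: homot_ext => // k b t.
  rewrite /full_turns /rotation mul0r mulr0 sin0 cos0 mulr0 mulr1 subrr.
  by rewrite /still /home; case: eqP => // ->; case: b.
have H1 : homot 1%g (concat 1%g (word_motion w) (full_turns (Negz j))) (@still R n).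
  apply: homot_trans H0; have := homot_concat Hw (homot_refl (BT (Negz j))).
  by rewrite mulg1.
have H2 : homot 1%g (concat 1%g (word_motion (word_inv w)) (@still R n))
    (word_motion (word_inv w)).
  have := @homot_word_cat R n (word_inv w) [::].
  by rewrite cats0 pw' => /homot_sym.
apply: homot_trans (homot_sym H2) _.
have H3 := homot_concat (homot_refl Bw) (homot_sym H1); rewrite mulg1 in H3.
apply: homot_trans H3 _.
have Bw1 : smooth_braiding 1%g (word_motion w : @motion R n) := homot_smoothl Hw.
have H4 := homot_concatA Bw Bw1 (BT (Negz j)); rewrite !mulg1 in H4.
apply: homot_trans H4 _.
have H5 : homot 1%g (concat 1%g (word_motion (word_inv w)) (word_motion w)) (@still R n).
  have := @homot_word_cat R n (word_inv w) w; rewrite word_perm_cat pw pw' mulg1.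
  move/homot_sym => HH; apply: homot_trans HH _.
  have := @braid_equiv_homot R n _ _ (word_inv_mulV w).
  by rewrite word_perm_cat pw pw' mulg1.
have H6 := homot_concat H5 (homot_refl (BT (Negz j))); rewrite mulg1 in H6.
apply: homot_trans H6 _.
exact/homot_sym/homot_still_concat.
Qed.

End KappaRotation.

(** * Closed curves from systems of arcs *)

Section IntegerPowers.
Context {G : groupType}.
Implicit Types (x : G) (m : int).
Local Open Scope group_scope.

Lemma zpow_succ x m : zpow x (m + 1)%R = zpow x m * x.
Proof.
case: m => [j|[|j]].
- by rewrite (_ : (Posz j + 1)%R = Posz j.+1) /= ?expgSr //; lia.
- by rewrite /= expg1 mulVg.
- rewrite (_ : (Negz j.+1 + 1)%R = Negz j); last by rewrite !NegzE; lia.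
  by rewrite /= [x ^+ j.+2]expgS invgM mulgKV.
Qed.

Lemma zpowD x m m' : zpow x (m + m')%R = zpow x m * zpow x m'.
Proof.
elim/int_rect: m' => [|j IH|j IH]; first by rewrite addr0 /= expg0 mulg1.
  by rewrite -addn1 PoszD addrA !zpow_succ IH mulgA.
apply: (mulIg x); rewrite -zpow_succ -mulgA -zpow_succ.
have -> : (m - j.+1%:Z + 1)%R = (m - j%:Z)%R by lia.
by have -> : (- j.+1%:Z + 1)%R = (- j%:Z)%R by lia.
Qed.

Lemma zpowN x m : zpow x (- m)%R = (zpow x m)^-1.
Proof.
by apply: (mulIg (zpow x m)); rewrite -zpowD addNr mulVg /= expg0.
Qed.

End IntegerPowers.

Section Curves.
Context {R : realType}.

Lemma continuous_pair (T U V : topologicalType) (f : T -> U) (g : T -> V) :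
  continuous f -> continuous g -> continuous (fun x => (f x, g x)).
Proof. by move=> cf cg x; exact: (cvg_pair (cf x) (cg x)). Qed.

Lemma continuous_compose (T U V : topologicalType) (h : T -> U) (f : U -> V) :
  continuous h -> continuous f -> continuous (fun x => f (h x)).
Proof.
by move=> ch cf x; apply: (@continuous_comp _ _ _ h f); [exact: ch|exact: cf].
Qed.

Lemma continuous_fst : continuous (fun p : R * R => p.1).
Proof. by move=> p; exact: cvg_fst. Qed.

Lemma continuous_snd : continuous (fun p : R * R => p.2).
Proof. by move=> p; exact: cvg_snd. Qed.

(** Isotopy of parametrized links with a fixed indexing of the components, and
    through families that are defined and continuous for all times. *)
Definition curve_isotopy (I : finType) (K L : I -> R -> 'rV[R]_4) :=
  exists F : R -> I -> R -> 'rV[R]_4, [/\ F 0 = K, F 1 = L,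
    forall s, 0 <= s <= 1 -> link_embedding (F s),
    forall c, continuous (fun p : R * R => F p.1 c p.2)
  & forall c, continuous (fun p : R * R => derive1 (F p.1 c) p.2)].

Lemma curve_isotopy_sym (I : finType) (K L : I -> R -> 'rV[R]_4) :
  curve_isotopy K L -> curve_isotopy L K.
Proof.
move=> [F [F0 F1 EF cF cdF]]; exists (fun s => F (1 - s)).
have cr : continuous (fun p : R * R => (1 - p.1, p.2)).
  apply: continuous_pair continuous_snd => p.
  by apply: cvgB; [exact: cvg_cst|exact: continuous_fst].
split; [by rewrite subr0|by rewrite subrr| | |].
- by move=> s s01; apply: EF; lra.
- by move=> c; exact: (continuous_compose cr (cF c)).
- by move=> c; exact: (continuous_compose cr (cdF c)).
Qed.

Lemma clamp_pair_continuous (a c : R) :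
  continuous (fun p : R * R => (clamp (a * p.1 + c), p.2)).
Proof.
apply: continuous_pair continuous_snd.
exact: (continuous_compose continuous_fst (@clamp_affine_continuous R a c)).
Qed.

(** The same device as for homotopies: the sum of both clamped families minus
    the common link in the middle. *)
Lemma curve_isotopy_trans (I : finType) (K L M : I -> R -> 'rV[R]_4) :
  curve_isotopy K L -> curve_isotopy L M -> curve_isotopy K M.
Proof.
move=> [F [F0 F1 EF cF cdF]] [G [G0 G1 EG cG cdG]].
pose f s c t := F (clamp (2 * s + 0)) c t.
pose g s c t := G (clamp (2 * s + -1)) c t.
pose H s c t := f s c t + g s c t - L c t.
have Hl s : s <= 1 / 2 -> H s = f s.
  move=> s2; do 2!apply/funext=> ?; rewrite /H /g (@clamp_le0 _ (2 * s + -1)) ?G0; last lra.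
  by rewrite addrK.
have Hr s : 1 / 2 <= s -> H s = g s.
  move=> s2; do 2!apply/funext=> ?; rewrite /H /f (@clamp_ge1 _ (2 * s + 0)) ?F1; last lra.
  by rewrite addrAC subrr add0r.
have EL : link_embedding L by rewrite -F1; apply: EF; lra.
have cf c : continuous (fun p : R * R => f p.1 c p.2).
  exact: (continuous_compose (@clamp_pair_continuous 2 0) (cF c)).
have cg c : continuous (fun p : R * R => g p.1 c p.2).
  exact: (continuous_compose (@clamp_pair_continuous 2 (-1)) (cG c)).
have cdf c : continuous (fun p : R * R => derive1 (f p.1 c) p.2).
  exact: (continuous_compose (@clamp_pair_continuous 2 0) (cdF c)).
have cdg c : continuous (fun p : R * R => derive1 (g p.1 c) p.2).
  exact: (continuous_compose (@clamp_pair_continuous 2 (-1)) (cdG c)).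
have c0 : continuous (fun q : R * R => (0 : R, q.2)).
  by apply: continuous_pair continuous_snd => p; exact: cvg_cst.
exists H; split.
- by rewrite Hl /f ?clamp_le0 ?F0 //; lra.
- by rewrite Hr /g ?clamp_ge1 ?G1 //; lra.
- move=> s s01; have [s2|/ltW s2] := leP s (1 / 2).
    by rewrite (Hl s s2); apply: EF; exact: clamp01.
  by rewrite (Hr s s2); apply: EG; exact: clamp01.
- move=> c p; apply: cvgB; first by apply: cvgD; [exact: cf|exact: cg].
  by rewrite -G0; exact: (continuous_compose c0 (cG c)).
- have dE c s t : derive1 (H s c) t = derive1 (f s c) t + derive1 (g s c) t - derive1 (L c) t.
    have [_ _ _ dL _] := EL; have [dL1 _] := dL c t.
    have [_ _ _ df _] := EF _ (clamp01 (2 * s + 0)); have [df1 _] := df c t.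
    have [_ _ _ dg _] := EG _ (clamp01 (2 * s + -1)); have [dg1 _] := dg c t.
    have e1 : is_derive t (1 : R) (f s c) ('D_1 (f s c) t) := DeriveDef df1 erefl.
    have e2 : is_derive t (1 : R) (g s c) ('D_1 (g s c) t) := DeriveDef dg1 erefl.
    have e3 : is_derive t (1 : R) (L c) ('D_1 (L c) t) := DeriveDef dL1 erefl.
    have -> : H s c = f s c + g s c - L c by apply/funext.
    have [_ e] := is_deriveB (is_deriveD e1 e2) e3.
    by rewrite !derive1E e.
  move=> c; rewrite (_ : (fun p : R * R => _) = fun p : R * R =>
    derive1 (f p.1 c) p.2 + derive1 (g p.1 c) p.2 - derive1 (L c) p.2); last first.
    by apply/funext => p; exact: dE.
  move=> p; apply: cvgB; first by apply: cvgD; [exact: cdf|exact: cdg].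
  by rewrite -G0; exact: (continuous_compose c0 (cdG c)).
Qed.

Lemma within_comp_continuous (T U V : topologicalType) (A : set U)
    (f : U -> V) (h : T -> U) : {within A, continuous f} -> continuous h ->
  (forall x, A (h x)) -> continuous (f \o h).
Proof.
move=> cf ch Ah x B nB.
have H : within A (nbhs (h x)) (f @^-1` B).
  by rewrite nbhs_subspace_in; [exact: (cf (h x) B nB)|exact: Ah].
have {}H : nbhs x [set y | A (h y) -> B (f (h y))] := ch x _ H.
by apply: (filterS _ H) => y; apply; exact: Ah.
Qed.

Lemma isotopic_extend (K' K L : oriented_link R) (f : link_component K' -> link_component K) :
  bijective f -> curve_isotopy K' (fun c => K (f c)) -> isotopic K L -> isotopic K' L.
Proof.
move=> bf KK' [phi [bphi [F [F0 F1 EF cF cdF]]]].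
have KL : curve_isotopy (fun c => K (f c)) (fun c => L (phi (f c))).
  exists (fun s c t => F (clamp (1 * s + 0)) (f c) t); split.
  - by do 2!apply/funext=> ?; rewrite clamp_le0 ?F0 //; lra.
  - by do 2!apply/funext=> ?; rewrite clamp_ge1 ?F1 //; lra.
  - move=> s s01; have [E1 E2 E3 E4 E5] := EF _ (clamp01 (1 * s + 0)); split=> //.
    move=> c c' t t' /E3[/(bij_inj bf) cc' tt']; by split.
  - move=> c; apply: (within_comp_continuous (cF (f c)) (@clamp_pair_continuous 1 0)).
    by move=> x; exact: clamp01.
  - move=> c; apply: (within_comp_continuous (cdF (f c)) (@clamp_pair_continuous 1 0)).
    by move=> x; exact: clamp01.
have [H [H0 H1 EH cH cdH]] := curve_isotopy_trans KK' KL.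
exists (phi \o f); split; first exact: bij_comp.
exists H; split=> // [c t|c t|c|c].
- by rewrite H0.
- by rewrite H1.
- by apply: continuous_subspaceT => x; exact: cH.
- by apply: continuous_subspaceT => x; exact: cdH.
Qed.

End Curves.

(** ** Unrolling a system of arcs along a permutation *)

Section ArcSystems.
Context {R : realType} {n : nat}.
Implicit Types (p : 'S_n) (k l : 'I_n) (i : 'I_4) (s t : R) (m : int).

Definition arcs := 'I_n -> 'I_4 -> R -> R.
Implicit Types g : arcs.

(** The arc of k is followed by the arc of p k. *)
Definition unroll p g : arcs := fun k i t =>
  g (zpow p (Num.floor t) k) i (t - (Num.floor t)%:~R).

(** This makes the unrolled arcs smooth at the integers, too. *)
Definition matching p g := forall k i t, `|t| < 1 / 4 -> g k i (1 + t) = g (p k) i t.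

Lemma floor_unique t m : m%:~R <= t < m%:~R + 1 -> Num.floor t = m.
Proof. by rewrite -intrD1; exact: floor_def. Qed.

Lemma floor_bounds t : (Num.floor t)%:~R <= t < (Num.floor t)%:~R + 1.
Proof. by rewrite -intrD1 floor_itv. Qed.

Lemma unroll_local p t0 : exists2 e : R, 0 < e & forall g, matching p g ->
  forall k i t, `|t - t0| < e ->
  unroll p g k i t = g (zpow p (Num.floor t0) k) i (t - (Num.floor t0)%:~R).
Proof.
set m := Num.floor t0; have /andP[m0 m1] : m%:~R <= t0 < m%:~R + 1 := floor_bounds t0.
have [t0m|t0m] := ltP m%:~R t0; last first.
  have {m0 m1 t0m} tm : t0 = m%:~R by apply/le_anti; rewrite m0 t0m.
  exists (1 / 4) => // g Mg k i t; rewrite ltr_norml tm => /andP[l1 l2]; rewrite /unroll.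
  have [tlt|tge] := ltP t m%:~R; last by rewrite (@floor_unique t m) //; lra.
  rewrite (@floor_unique t (m - 1)); last by rewrite intrB; lra.
  have -> : t - (m - 1)%:~R = 1 + (t - m%:~R) by rewrite intrB; ring.
  rewrite Mg; last by rewrite ltr_norml; lra.
  by rewrite -permM -zpow_succ subrK.
exists (Num.min (t0 - m%:~R) (m%:~R + 1 - t0)); first by rewrite lt_min !subr_gt0 t0m.
move=> g Mg k i t; rewrite lt_min !ltr_norml => /andP[/andP[? ?] /andP[? ?]].
by rewrite /unroll (@floor_unique t m) //; lra.
Qed.

Lemma unroll_succ p g k i t : unroll p g k i (t + 1) = unroll p g (p k) i t.
Proof.
rewrite /unroll (@floor_unique (t + 1) (1 + Num.floor t)); last first.
  by have := floor_bounds t; rewrite intrD; lra.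
rewrite zpowD /= expg1 permM; congr (g _ i _); rewrite intrD; ring.
Qed.

Lemma unroll_add p g k i t j : unroll p g k i (t + j%:R) = unroll p g (iter j p k) i t.
Proof.
elim: j t k => [|j IH] t k; first by rewrite addr0.
by rewrite -natr1 addrA unroll_succ IH -iterSr.
Qed.

Lemma unroll01 p g k i t : 0 <= t < 1 -> unroll p g k i t = g k i t.
Proof.
move=> t01; rewrite /unroll (@floor_unique t 0); last by rewrite add0r.
by rewrite /= expg0 perm1 subr0.
Qed.

Lemma unroll_smooth p (f : R -> arcs) : (forall k i, joint_C1 (fun s => f s k i)) ->
  (forall s, matching p (f s)) ->
  forall k i, joint_C1 (fun s => unroll p (f s) k i).
Proof.
move=> Cf Mf k i; apply: joint_C1_local => t0.
have [e e0 he] := unroll_local p t0.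
exists (fun s t => f s (zpow p (Num.floor t0) k) i (t - (Num.floor t0)%:~R)), e; split=> //.
- have cid : continuous (@id R) by move=> s; exact: cvg_id.
  apply: (joint_C1_comp cid (Cf _ i)).
  by apply: joint_C1B; [exact: joint_C1_time|exact: joint_C1_cst].
- by move=> s t tt0; apply: he.
Qed.

(** Each arc gives a curve of rays in the 4-space, which stand for points of the
    sphere: no ray is met twice, and no velocity is radial. Working with rays
    keeps the radial projection out of all geometric arguments. *)
Definition arc_system p g := [/\ matching p g,
  forall k t, 0 <= t < 1 -> 0 < \sum_i g k i t ^+ 2,
  forall k l t t' (r : R), 0 <= t < 1 -> 0 <= t' < 1 -> 0 < r ->
    (forall i, g k i t = r * g l i t') -> k = l /\ t = t'
& forall k t (mu : R), 0 <= t < 1 ->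
    (forall i, is_derive t (1 : R) (g k i) (mu * g k i t)) -> False].

Lemma zpow_orbit p m k : zpow p m k \in porbit p k.
Proof.
case: m => j /=; first exact: mem_porbit.
by rewrite -porbitV -expgVn mem_porbit.
Qed.

Lemma zpow_fix p k m : zpow p m k = k -> exists q : int, m = q * Posz #|porbit p k|.
Proof.
set N := #|porbit p k| => pm.
have N0 : (0 < N)%N by rewrite lt0n card_porbit_neq0.
have pN : zpow p (Posz N) k = k by rewrite /= permX iter_porbit.
have pNq (q : int) : zpow p (q * (Posz N)) k = k.
  elim/int_rect: q => [|j IH|j IH]; first by rewrite mul0r /= expg0 perm1.
    by rewrite -addn1 PoszD mulrDl mul1r zpowD permM IH.
  rewrite -addn1 PoszD opprD mulrDl mulN1r zpowD permM IH zpowN.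
  by rewrite -{1}pN permK.
have Nz : Posz N != 0 :> int by rewrite eqz_nat -lt0n.
have [q [r [mE r0 rN]]] : exists q r : int, [/\ m = q * Posz N + r, 0 <= r & r < Posz N].
  exists (m %/ Posz N)%Z, (m %% Posz N)%Z; split; first exact: divz_eq.
    exact: modz_ge0.
  exact: ltz_pmod.
exists q; suff -> : q * Posz N = m by [].
have pr : zpow p r k = k by rewrite -[RHS]pm mE zpowD permM pNq.
case: r mE r0 rN pr => // r mE _; rewrite ltz_nat => rN pr.
have := uniq_traject_porbit p k; rewrite -/N => /(nth_uniq k).
rewrite size_traject => /(_ r 0%N rN N0); rewrite !nth_traject //= -permX pr eqxx.
by move/esym/eqP => r0; rewrite mE r0 addr0.
Qed.

(** The speed on the cycle is constant, as closures of words require. *)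
Definition closed_curve p g k (t : R) : 'rV[R]_4 :=
  let x := #|porbit p k|%:R * t in
  \row_i ((Num.sqrt (\sum_j unroll p g k j x ^+ 2))^-1 * unroll p g k i x).

Lemma continuous_row (T : topologicalType) (f : 'I_4 -> T -> R) :
  (forall i, continuous (f i)) -> continuous (fun x => \row_i f i x : 'rV[R]_4).
Proof.
move=> cf x.
rewrite (_ : (fun x => _) = fun x => \sum_i f i x *: delta_mx 0 i); last first.
  apply/funext => y; rewrite [LHS]row_sum_delta.
  by apply: eq_bigr => i _; rewrite mxE.
rewrite (_ : (fun x => \sum_i _) = fun x => f 0 x *: delta_mx 0 0 +
  (f 1 x *: delta_mx 0 1 + (f 2 x *: delta_mx 0 2 + f 3 x *: delta_mx 0 3))); last first.
  apply/funext => y; rewrite !big_ord_recl big_ord0 addr0.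
  by do ![congr (_ + _)]; congr (f _ y *: delta_mx _ _); apply: val_inj.
have ct i : (fun x => f i x *: (delta_mx 0 i : 'rV[R]_4)) @ x --> f i x *: delta_mx 0 i.
  by apply: cvgZ; [exact: cf|exact: cvg_cst].
by apply: cvgD; [|apply: cvgD; [|apply: cvgD]]; exact: ct.
Qed.

Lemma sum4 (F : 'I_4 -> R) : \sum_i F i = F 0 + (F 1 + (F 2 + F 3)).
Proof.
rewrite !big_ord_recl big_ord0 addr0.
by do ![congr (_ + _)]; congr F; apply: val_inj.
Qed.

Lemma unroll_arc_system p g : arc_system p g ->
  [/\ forall k t, 0 < \sum_i unroll p g k i t ^+ 2,
      forall k l t t' (r : R), 0 < r ->
        (forall i, unroll p g k i t = r * unroll p g l i t') ->
        zpow p (Num.floor t) k = zpow p (Num.floor t') l /\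
        t - (Num.floor t)%:~R = t' - (Num.floor t')%:~R
    & forall k t (mu : R),
        (forall i, is_derive t (1 : R) (unroll p g k i) (mu * unroll p g k i t)) ->
        False].
Proof.
have fb t : 0 <= t - (Num.floor t)%:~R < 1 by have := floor_bounds t; lra.
move=> [Mg Ng Ig Dg]; split=> [k t|k l t t' r r0 e|k t mu e].
- exact: Ng.
- exact: (Ig _ _ _ _ r).
- have [d d0 he] := unroll_local p t; set m := (Num.floor t)%:~R : R.
  apply: (Dg (zpow p (Num.floor t) k) (t - m) mu (fb t)) => i.
  have tE : t - m + m = t by rewrite subrK.
  have D : is_derive (t - m) (1 : R) (fun u : R => u + m) 1.
    by rewrite -[X in is_derive _ _ _ X]addr0; apply: is_deriveD.
  have D' : is_derive (t - m + m) (1 : R) (unroll p g k i) (mu * unroll p g k i t).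
    by rewrite tE; exact: e.
  have := @is_derive1_comp _ (unroll p g k i) (fun u => u + m) _ _ _ D' D; rewrite mulr1.
  apply: near_eq_is_derive; near=> u; rewrite /= he //; last first.
    rewrite -[X in _ - X]tE opprD addrACA subrr addr0; near: u.
    have /cvgrPdist_lt /(_ d d0) : id @ (t - m) --> (t - m) by exact: cvg_id.
    by apply: filterS => u; rewrite distrC.
  by rewrite addrK.
Unshelve. all: by end_near. Qed.

Lemma is_derive_row (f : 'I_4 -> R -> R) (d : 'I_4 -> R) t :
  (forall i, is_derive t (1 : R) (f i) (d i)) ->
  derivable (fun x => \row_i f i x : 'rV[R]_4) t 1 /\
  derive1 (fun x => \row_i f i x : 'rV[R]_4) t = \row_i d i.
Proof.
move=> fd; have dr : derivable (fun x => \row_i f i x : 'rV[R]_4) t 1.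
  apply/derivable_mxP => i j; have [dfj _] := fd j.
  by rewrite (_ : (fun x => _) = f j) //; apply/funext => x; rewrite mxE.
split=> //; rewrite derive1E derive_mx //; apply/rowP => j; rewrite !mxE.
rewrite (_ : (fun x => _) = f j); last by apply/funext => x; rewrite mxE.
by have [_ ->] := fd j.
Qed.

Lemma closed_curve_coordinates p (f : R -> arcs) k :
  (forall k i, joint_C1 (fun s => f s k i)) -> (forall s, matching p (f s)) ->
  (forall s k t, 0 < \sum_i unroll p (f s) k i t ^+ 2) ->
  let N : R := #|porbit p k|%:R in
  (forall i, joint_C1 (fun s t => unroll p (f s) k i (N * t))) /\
  joint_C1 (fun s t => (Num.sqrt (\sum_j unroll p (f s) k j (N * t) ^+ 2))^-1).
Proof.
move=> Cf Mf Nf N.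
have CU i : joint_C1 (fun s t => unroll p (f s) k i (N * t)).
  have cid : continuous (@id R) by move=> s; exact: cvg_id.
  apply: (joint_C1_comp cid (unroll_smooth Cf Mf k i)).
  by apply: joint_C1M; [exact: joint_C1_cst|exact: joint_C1_time].
split=> //; apply: joint_C1_invsqrt => [s t|]; first exact: Nf.
apply: (@joint_C1_ext _ (fun s t =>
  unroll p (f s) k 0 (N * t) * unroll p (f s) k 0 (N * t) +
  (unroll p (f s) k 1 (N * t) * unroll p (f s) k 1 (N * t) +
  (unroll p (f s) k 2 (N * t) * unroll p (f s) k 2 (N * t) +
   unroll p (f s) k 3 (N * t) * unroll p (f s) k 3 (N * t))))).
  by move=> s t; rewrite sum4 !expr2.
by do 3?[apply: joint_C1D]; apply: joint_C1M.
Qed.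

Lemma closed_curve_smooth p (f : R -> arcs) k :
  (forall k i, joint_C1 (fun s => f s k i)) -> (forall s, matching p (f s)) ->
  (forall s k t, 0 < \sum_i unroll p (f s) k i t ^+ 2) ->
  continuous (fun q : R * R => closed_curve p (f q.1) k q.2) /\
  continuous (fun q : R * R => derive1 (closed_curve p (f q.1) k) q.2).
Proof.
move=> Cf Mf Nf; set N : R := #|porbit p k|%:R.
have [CU Cnu] := closed_curve_coordinates k Cf Mf Nf.
have CW i : joint_C1 (fun s t =>
    (Num.sqrt (\sum_j unroll p (f s) k j (N * t) ^+ 2))^-1 * unroll p (f s) k i (N * t)).
  exact: joint_C1M (CU i).
pose dW i := projT1 (cid (CW i)).
have dWP i := projT2 (cid (CW i)).
split.
  by apply: continuous_row => i; case: (dWP i).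
rewrite (_ : (fun q : R * R => _) = fun q : R * R => \row_i dW i q.1 q.2).
  by apply: continuous_row => i; case: (dWP i).
apply/funext => q; have [|_ E] := @is_derive_row
  (fun i t => (Num.sqrt (\sum_j unroll p (f q.1) k j (N * t) ^+ 2))^-1 *
     unroll p (f q.1) k i (N * t)) (fun i => dW i q.1 q.2) q.2.
  by move=> i; case: (dWP i).
exact: E.
Qed.

(** Two times with the same point of the sphere give, up to integers, the same
    time and strand; the difference of the integers fixes the strand, hence it
    is a multiple of the length of the cycle. Radial scaling does not destroy a
    velocity that is not radial. *)
Lemma closed_curve_link p g (I : finType) (kk : I -> 'I_n) :
  (forall k i, joint_C1 (fun _ => g k i)) -> arc_system p g ->
  (forall x : 'I_n, exists! c, x \in porbit p (kk c)) ->
  link_embedding (fun c => closed_curve p g (kk c)).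
Proof.
move=> Cg Sg kkP; have Mg : matching p g by case: Sg.
have [NU IU DU] := unroll_arc_system Sg.
have s0 k t : 0 < Num.sqrt (\sum_j unroll p g k j t ^+ 2) by rewrite sqrtr_gt0.
have card0 k : 0 < #|porbit p k|%:R :> R by rewrite ltr0n lt0n card_porbit_neq0.
split.
- move=> c t; rewrite /sphere3 /= /closed_curve.
  set x := _ * t; under eq_bigr do rewrite mxE exprMn.
  rewrite -mulr_sumr exprVn sqr_sqrtr; last exact: ltW.
  by rewrite mulVf // gt_eqF.
- move=> c t; rewrite /closed_curve mulrDr mulr1.
  have U i : unroll p g (kk c) i (#|porbit p (kk c)|%:R * t + #|porbit p (kk c)|%:R) =
      unroll p g (kk c) i (#|porbit p (kk c)|%:R * t).
    by rewrite unroll_add iter_porbit.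
  apply/rowP => i; rewrite !mxE U; congr ((Num.sqrt _)^-1 * _).
  by apply: eq_bigr => j _; rewrite U.
- move=> c c' t t' e.
  set x := #|porbit p (kk c)|%:R * t; set x' := #|porbit p (kk c')|%:R * t'.
  set a := Num.sqrt (\sum_j unroll p g (kk c) j x ^+ 2).
  set a' := Num.sqrt (\sum_j unroll p g (kk c') j x' ^+ 2).
  have [||kE fE] := IU (kk c) (kk c') x x' (a / a'); first exact: divr_gt0 (s0 _ _) (s0 _ _).
    move=> i; have /rowP /(_ i) := e; rewrite !mxE -/x -/x' -/a -/a' => ei.
    by rewrite -mulrA -ei mulrA mulfV ?mul1r // gt_eqF // s0.
  have [c0 [_ uc]] := kkP (zpow p (Num.floor x) (kk c)).
  have cc : c = c'.
    have e1 : c0 = c by apply: uc; exact: zpow_orbit.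
    by rewrite -e1; apply: uc; rewrite kE; exact: zpow_orbit.
  split=> //; subst c'.
  have /zpow_fix[q qE] : zpow p (Num.floor x' - Num.floor x) (kk c) = kk c.
    by rewrite addrC zpowD permM -permM -zpowD addrC zpowD permM -kE zpowN permK.
  exists q; have xx : x' = x + (Num.floor x' - Num.floor x)%:~R.
    by rewrite intrB; move: fE; lra.
  have := card0 (kk c); set N : R := _%:R => N0.
  apply: (mulfI (lt0r_neq0 N0)); rewrite -/x' xx qE intrM mulrDr mulrC.
  by rewrite [N * q%:~R]mulrC.
- move=> c t; set k := kk c; set N : R := #|porbit p k|%:R.
  have [CU [dnu [_ _ dnuP]]] :=
    closed_curve_coordinates k (f := fun _ => g) Cg (fun _ => Mg) (fun _ => NU).
  set nu := fun t : R => (Num.sqrt (\sum_j unroll p g k j (N * t) ^+ 2))^-1.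
  pose dU i := projT1 (cid (CU i)) 0.
  have dUP i t' : is_derive t' (1 : R) (fun t => unroll p g k i (N * t)) (dU i t').
    by case: (projT2 (cid (CU i))) => _ _; apply.
  have [i|der dE] := @is_derive_row (fun i t => nu t * unroll p g k i (N * t))
    (fun i => nu t * dU i t + unroll p g k i (N * t) * dnu 0 t) t.
    exact: (is_deriveM (dnuP 0 t) (dUP i t)).
  split; first exact: der.
  rewrite [X in X != _]dE; apply/eqP => /rowP z.
  have nu0 : 0 < nu t by rewrite /nu invr_gt0.
  have N0 : 0 < N := card0 k.
  apply: (DU k (N * t) (- dnu 0 t / nu t / N)) => i.
  have Nx (y : R) : N * (y / N) = y by rewrite mulrC divfK // gt_eqF.
  have D1 : is_derive (N * t) (1 : R) (fun y => y / N) N^-1.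
    have -> : (fun y => y / N) = N^-1 *: (id : R -> R).
      by apply/funext => y; rewrite mulrC.
    by rewrite -[X in is_derive _ _ _ X]mulr1; exact: is_deriveZ.
  have D2 : is_derive (N * t / N) (1 : R) (fun t => unroll p g k i (N * t)) (dU i t).
    by rewrite [N * t]mulrC mulfK ?gt_eqF //; exact: dUP.
  have := @is_derive1_comp _ (fun t => unroll p g k i (N * t)) (fun y => y / N) _ _ _ D2 D1.
  rewrite (_ : _ \o _ = unroll p g k i); last by apply/funext => y /=; rewrite Nx.
  have zi := z i; rewrite !mxE in zi.
  have -> : dU i t = - dnu 0 t / nu t * unroll p g k i (N * t).
    apply: (mulfI (lt0r_neq0 nu0)).
    have -> : nu t * (- dnu 0 t / nu t * unroll p g k i (N * t)) =
      - (unroll p g k i (N * t) * dnu 0 t) by field; exact: lt0r_neq0.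
    by move/eqP: zi; rewrite addr_eq0 => /eqP.
  by rewrite [_ / N * _]mulrAC.
- move=> c; have [_ cd] :=
    closed_curve_smooth (kk c) (f := fun _ => g) Cg (fun _ => Mg) (fun _ => NU).
  have c0 : continuous (fun t : R => (0 : R, t)).
    by apply: continuous_pair => t; [exact: cvg_cst|exact: cvg_id].
  exact: (continuous_compose c0 cd).
Qed.

(** Composition with clamp turns the smooth family into a family of arc systems
    for all parameters. *)
Lemma closed_curve_isotopy p (f : R -> arcs) (I : finType) (kk : I -> 'I_n) :
  (forall k i, joint_C1 (fun s => f s k i)) ->
  (forall s, 0 <= s <= 1 -> arc_system p (f s)) ->
  (forall x : 'I_n, exists! c, x \in porbit p (kk c)) ->
  curve_isotopy (fun c => closed_curve p (f 0) (kk c))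
                (fun c => closed_curve p (f 1) (kk c)).
Proof.
move=> Cf Sf kkP; pose h s := f (clamp s).
have Ch k i : joint_C1 (fun s => h s k i).
  exact: (joint_C1_comp (@clamp_continuous R) (Cf k i) joint_C1_time).
have Sh s : arc_system p (h s) by apply: Sf; exact: clamp01.
have Mh s : matching p (h s) by case: (Sh s).
have Nh s k t : 0 < \sum_i unroll p (h s) k i t ^+ 2.
  by case: (unroll_arc_system (Sh s)).
exists (fun s c => closed_curve p (h s) (kk c)); split.
- by rewrite /h clamp_le0.
- by rewrite /h clamp_ge1.
- move=> s _; apply: closed_curve_link kkP => // k i.
  have cs : continuous (fun _ : R => s) by move=> ?; exact: cvg_cst.
  exact: (joint_C1_comp cs (Ch k i) joint_C1_time).
- by move=> c; have [] := closed_curve_smooth (kk c) Ch Mh Nh.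
- by move=> c; have [] := closed_curve_smooth (kk c) Ch Mh Nh.
Qed.

End ArcSystems.

(** * Closed braids, and the last strand moved across the axis *)

Section BraidArcs.
Context {R : realType} {n : nat} (n_ge4 : (4 <= n)%N).
Implicit Types (p : 'S_n) (k l : 'I_n) (b : bool) (s t lam : R).
Implicit Types (z : @motion R n).

Definition is_last k := val k == n.-1.

(** The motion of k, together with what precedes and what follows it. *)
Definition extended p z : motion := fun k b t =>
  z k b t + (z (p k) b (t - 1) - home (p k) b) +
  (z ((p^-1)%g k) b (t + 1) - home k b).

(** The part of the last strand with positive first coordinate, which is a half
    turn around the axis, is pushed in the direction of negative first
    coordinates. The factor 3/2 takes the middle of the half turn from 1 to
    -1/2, beyond the axis. *)
Definition flip p k t : R :=
  3 / 2 * sqpos (cos (2 * pi * t)) *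
  ((is_last k)%:R * (1 - step (2 * t - 1 / 2)) + (is_last (p k))%:R * step (2 * t - 1 / 2)).

Definition braid_arcs p lam z : @arcs R n := fun k i t =>
  match val i with
  | 0 => cos (2 * pi * t) - lam * flip p k t
  | 1 => sin (2 * pi * t)
  | 2 => extended p z k false t
  | _ => extended p z k true t
  end.

Lemma joint_C1_turn (F : R -> R -> R) : joint_C1 F -> joint_C1 (fun s t => 2 * pi * F s t).
Proof. by move=> CF; apply: joint_C1M => //; exact: joint_C1_cst. Qed.

Lemma joint_C1_affine (a c : R) : joint_C1 (fun _ t => a * t + c).
Proof.
apply: joint_C1D; last exact: joint_C1_cst.
by apply: joint_C1M; [exact: joint_C1_cst|exact: joint_C1_time].
Qed.

Lemma flip_smooth p k : joint_C1 (fun _ => flip p k).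
Proof.
have Cs : joint_C1 (fun _ t => step (2 * t - 1 / 2) : R).
  exact: (joint_C1_retime joint_C1_step (joint_C1_affine 2 (- (1 / 2)))).
have Cc : joint_C1 (fun _ t => cos (2 * pi * t) : R).
  exact: (joint_C1_retime joint_C1_cos (joint_C1_turn joint_C1_time)).
apply: joint_C1M; first apply: joint_C1M; first exact: joint_C1_cst.
  exact: (joint_C1_retime joint_C1_sqpos Cc).
apply: joint_C1D; apply: joint_C1M => //; try exact: joint_C1_cst.
by apply: joint_C1B => //; exact: joint_C1_cst.
Qed.

Lemma braid_arcs_smooth p (lam : R -> R) (f : R -> motion) : continuous lam ->
  smooth_family f -> forall k i, joint_C1 (fun s => braid_arcs p (lam s) (f s) k i).
Proof.
move=> Cl Cf k [i i4].
have Ce b : joint_C1 (fun s => extended p (f s) k b).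
  have Ca (a : R) k' : joint_C1 (fun s t => f s k' b (t + a)).
    have cid : continuous (@id R) by move=> ?; exact: cvg_id.
    apply: (joint_C1_comp cid (Cf k' b)).
    by apply: joint_C1D; [exact: joint_C1_time|exact: joint_C1_cst].
  apply: joint_C1D; first apply: joint_C1D; first exact: (Cf k b).
    by apply: joint_C1B; [exact: (Ca (-1))|exact: joint_C1_cst].
  by apply: joint_C1B; [exact: (Ca 1)|exact: joint_C1_cst].
case: i i4 => [|[|[|i]]] i4; rewrite /braid_arcs /=.
- apply: joint_C1B; last first.
    by apply: joint_C1M; [exact: joint_C1_param|exact: flip_smooth].
  exact: (joint_C1_retime joint_C1_cos (joint_C1_turn joint_C1_time)).
- exact: (joint_C1_retime joint_C1_sin (joint_C1_turn joint_C1_time)).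
- exact: Ce.
- exact: Ce.
Qed.

Lemma flip_ge0 p k t : 0 <= flip p k t.
Proof.
rewrite /flip mulr_ge0 //; first by rewrite mulr_ge0 ?sqpos_ge0.
by rewrite addr_ge0 // mulr_ge0 ?ler0n ?subr_ge0 ?step_ge0 ?step_le1.
Qed.

Lemma twopi t : 2 * pi * (1 + t) = 2 * pi * t + pi *+ 2 :> R.
Proof. by rewrite mulrDr mulr1 addrC -[pi *+ 2]mulr_natl. Qed.

Lemma cos_middle t : 1 / 4 <= t <= 3 / 4 -> cos (2 * pi * t) <= 0.
Proof.
move=> /andP[t1 t2]; have pi0 := @pi_gt0 R.
have -> : 2 * pi * t = 2 * pi * t - pi + pi by ring.
rewrite cosDpi oppr_le0; apply: cos_ge0_pihalf.
have e : 2 * pi * t - pi = pi * (2 * t - 1) by ring.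
rewrite e; apply/andP; split; last by rewrite ler_pM2l //; lra.
by rewrite -mulrN ler_pM2l //; lra.
Qed.

Lemma flip_cases p k t : 0 <= t < 1 -> flip p k t = 0 \/
  [/\ 0 < cos (2 * pi * t), flip p k t = 3 / 2 * cos (2 * pi * t) ^+ 2
    & is_last k /\ t < 1 / 4 \/ is_last (p k) /\ 3 / 4 < t].
Proof.
move=> /andP[t0 t1]; rewrite /flip; have [c0|c0] := leP (cos (2 * pi * t)) 0.
  by left; rewrite sqpos_le0 // mulr0 mul0r.
rewrite sqpos_ge0E ?ltW //.
have [t4|t4] := ltP t (1 / 4).
  rewrite step_le0 ?subr0 ?mulr0 ?addr0 ?mulr1; last lra.
  case kl: (is_last k); first by right; split=> //; [rewrite mulr1|left].
  by left; rewrite mulr0.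
have [t3|t3] := ltP (3 / 4) t.
  rewrite step_ge1 ?subrr ?mulr0 ?add0r ?mulr1; last lra.
  case kl: (is_last (p k)); first by right; split=> //; [rewrite mulr1|right].
  by left; rewrite mulr0.
by have := @cos_middle t; rewrite t4 t3 => /(_ isT); lra.
Qed.

Definition has_ends p z := (forall k b t, t <= 0 -> z k b t = home k b) /\
  (forall k b t, 1 <= t -> z k b t = home (p k) b).

Lemma extended01 p z k b t : has_ends p z -> 0 <= t <= 1 ->
  extended p z k b t = z k b t.
Proof.
move=> [S E] t01; rewrite /extended (S (p k)); last lra.
by rewrite (E (p^-1 k)%g) ?permKV; [ring|lra].
Qed.

Lemma braid_arcs_matching p lam z : has_ends p z -> matching p (braid_arcs p lam z).
Proof.
move=> [S E] k [i i4] t; rewrite ltr_norml => /andP[t0 t1].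
have ee b : extended p z k b (1 + t) = extended p z (p k) b t.
  rewrite /extended permK (S (p (p k))); last lra.
  rewrite (E (p^-1 k)%g) ?permKV; last lra.
  have -> : 1 + t - 1 = t by ring.
  rewrite [1 + t]addrC; ring.
rewrite /braid_arcs /= !ee twopi (@cosD2pi R) (@sinD2pi R).
suff -> : flip p k (1 + t) = flip p (p k) t by [].
rewrite /flip twopi (@cosD2pi R) (@step_ge1 _ (2 * (1 + t) - 1 / 2)); last lra.
by rewrite (@step_le0 _ (2 * t - 1 / 2)); [ring|lra].
Qed.

Lemma trig_inj t t' : 0 <= t < 1 -> 0 <= t' < 1 ->
  cos (2 * pi * t) = cos (2 * pi * t') -> sin (2 * pi * t) = sin (2 * pi * t') -> t = t'.
Proof.
wlog lt_tt : t t' / t < t'.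
  move=> W t0 t1 c s; have [l|l|//] := ltgtP t t'; first exact: W.
  by symmetry; apply: W.
move=> /andP[t0 t1] /andP[t0' t1'] c s; exfalso.
have pi0 := @pi_gt0 R; set x := pi * (t' - t).
have sx : 0 < sin x.
  apply: sin_gt0_pi; rewrite /x mulr_gt0 ?subr_gt0 //= gtr_pMr //; lra.
have : cos (x *+ 2) = 1.
  have -> : x *+ 2 = 2 * pi * t' - 2 * pi * t by rewrite -mulr_natl /x; ring.
  by rewrite cosB c s -!expr2 cos2Dsin2.
rewrite cos_mulr2n cos2sin2 -mulr_natl => h.
by have := exprn_gt0 2 sx; lra.
Qed.

(** The displaced last strand meets a point r (cos, sin, x, y) of another one
    only if its displaced projection to the plane of the first two coordinates
    has norm r < 1. *)
Lemma braid_arcs_system p lam z : 0 <= lam <= 1 -> has_ends p z ->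
  (forall k b t, lam != 0 -> is_last k -> 0 <= t <= 1 / 4 -> z k b t = home k b) ->
  (forall k b t, lam != 0 -> is_last (p k) -> 3 / 4 <= t <= 1 -> z k b t = home (p k) b) ->
  (forall k l t, k != l -> 0 <= t < 1 -> lam * flip p k t = 0 ->
     lam * flip p l t = 0 -> (forall b, z k b t = z l b t) -> False) ->
  (forall l (c d r : R) t, 0 < lam -> 0 <= t < 1 -> 0 < c -> c ^+ 2 + d ^+ 2 = 1 -> 0 < r ->
     c - lam * (3 / 2 * c ^+ 2) = r * cos (2 * pi * t) -> d = r * sin (2 * pi * t) ->
     n%:R - 1 = r * z l false t -> z l true t = 0 -> False) ->
  arc_system p (braid_arcs p lam z).
Proof.
move=> /andP[lam0 lam1] ze A1 A2 B C; have [S E] := ze.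
have nR : 0 < n%:R - 1 :> R by have := @n_ge4R R n n_ge4; lra.
have homeL k b : is_last k -> home k b = (if b then 0 else n%:R - 1) :> R.
  rewrite /is_last /home => /eqP /= ->; case: b => //.
  by rewrite -[in RHS](@prednK n) -?natr1 ?addrK //; lia.
have flipped k t b : 0 <= t < 1 -> lam * flip p k t != 0 ->
    z k b t = if b then 0 else n%:R - 1.
  move=> t01 f0; have l0 : lam != 0 by apply: contraNneq f0 => ->; rewrite mul0r.
  have [f|[_ _ [[kl t4]|[kl t3]]]] := flip_cases p k t01.
  - by move: f0; rewrite f mulr0 eqxx.
  - by rewrite A1 // ?homeL //; lra.
  - by rewrite A2 // ?homeL //; lra.
have zE k t b : 0 <= t < 1 -> extended p z k b t = z k b t.
  by move=> t01; apply: extended01 => //; lra.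
have i3 : (3 < 4)%N by []; have i2 : (2 < 4)%N by [].
have ge0 k t : 0 <= t < 1 -> braid_arcs p lam z k (Ordinal i2) t = z k false t.
  by move=> t01; rewrite /braid_arcs /= zE.
have ge1 k t : 0 <= t < 1 -> braid_arcs p lam z k (Ordinal i3) t = z k true t.
  by move=> t01; rewrite /braid_arcs /= zE.
split; first exact: braid_arcs_matching.
- move=> k t t01; rewrite sum4 /braid_arcs /= !zE //.
  have [f0|f0] := eqVneq (lam * flip p k t) 0.
    by rewrite f0 subr0 addrA cos2Dsin2 ltr_pwDl // addr_ge0 ?sqr_ge0.
  rewrite !flipped // addrA ltr_wpDl ?addr_ge0 ?sqr_ge0 //.
  by rewrite ltr_pwDl ?sqr_ge0 // exprn_gt0.
(* a displaced point on the ray of one that is not displaced *)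
- have mixed k l t t' (r : R) : 0 <= t < 1 -> 0 <= t' < 1 -> 0 < r ->
      lam * flip p k t != 0 -> lam * flip p l t' = 0 ->
      (forall i, braid_arcs p lam z k i t = r * braid_arcs p lam z l i t') -> False.
    move=> t01 t01' r0 fk fl e.
    have ex := e (Ordinal i2); have ey := e (Ordinal i3); rewrite ge0 // ge0 // in ex.
    rewrite ge1 // ge1 // in ey; rewrite (flipped k t false) //= in ex; rewrite (flipped k t true) //= in ey.
    have ec := e 0; have ed := e 1; rewrite /braid_arcs /= fl subr0 in ec ed.
    have [f|[c0 fE _]] := flip_cases p k t01; first by move: fk; rewrite f mulr0 eqxx.
    rewrite fE in ec.
    have l0 : 0 < lam by rewrite lt_neqAle lam0 andbT; apply: contraNneq fk => <-; rewrite mul0r.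
    have y0 : z l true t' = 0.
      by apply: (mulfI (lt0r_neq0 r0)); rewrite mulr0 -ey.
    exact: (C l _ _ r t' l0 t01' c0 (cos2Dsin2 _) r0 ec ed ex y0).
  move=> k l t t' r t01 t01' r0 e.
  have [fk|fk] := eqVneq (lam * flip p k t) 0; have [fl|fl] := eqVneq (lam * flip p l t') 0.
  (* neither point is displaced: their angles agree *)
  + have ec := e 0; have ed := e 1; rewrite /braid_arcs /= fk fl !subr0 in ec ed.
    have r1 : r = 1.
      have := cos2Dsin2 (2 * pi * t); rewrite ec ed !exprMn -mulrDr cos2Dsin2 mulr1.
      by move/eqP; rewrite sqrf_eq1 => /orP[/eqP//|/eqP h]; move: r0; rewrite h oppr_gt0 ltr10.
    rewrite r1 !mul1r in ec ed; have tt := trig_inj t01 t01' ec ed; subst t'.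
    split=> //; apply/eqP/negP => /negP kl; apply: (B k l t kl) => // -[].
      by have := e (Ordinal i3); rewrite !ge1 // r1 mul1r.
    by have := e (Ordinal i2); rewrite !ge0 // r1 mul1r.
  + exfalso; apply: (mixed l k t' t r^-1) => // [|i]; first by rewrite invr_gt0.
    by rewrite e mulrA mulVf ?mul1r // gt_eqF.
  + by exfalso; apply: (mixed k l t t' r).
  (* both points are displaced, at the home n - 1: then r = 1 *)
  + have ex := e (Ordinal i2); rewrite !ge0 // !flipped //= in ex.
    have r1 : r = 1 by apply: (mulIf (lt0r_neq0 nR)); rewrite -ex mul1r.
    have ed := e 1; rewrite /braid_arcs /= r1 mul1r in ed.
    have [f|[c0 _ ck]] := flip_cases p k t01; first by move: fk; rewrite f mulr0 eqxx.
    have [f|[c0' _ cl]] := flip_cases p l t01'; first by move: fl; rewrite f mulr0 eqxx.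
    have ec : cos (2 * pi * t) = cos (2 * pi * t').
      apply/eqP; rewrite -(@eqrXn2 _ 2) ?ltW //.
      by rewrite !cos2sin2 ed.
    have tt := trig_inj t01 t01' ec ed; subst t'; split=> //.
    case: ck cl => [[kl t4]|[kl t4]] [[ll t4']|[ll t4']].
    - by apply: val_inj; rewrite (eqP kl) (eqP ll).
    - by exfalso; lra.
    - by exfalso; lra.
    - by apply: (@perm_inj _ p); apply: val_inj; rewrite (eqP kl) (eqP ll).
- move=> k t mu t01 d.
  have pi0 := @pi_gt0 R.
  have D : is_derive t (1 : R) (fun t : R => 2 * pi * t) (2 * pi).
    have -> : (fun t : R => 2 * pi * t) = (2 * pi) *: (id : R -> R) by [].
    by rewrite -[X in is_derive _ _ _ X]mulr1; exact: is_deriveZ.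
  have Dc : is_derive t (1 : R) (fun t : R => cos (2 * pi * t)) (- sin (2 * pi * t) * (2 * pi)).
    exact: (is_derive1_comp (is_derive_cos _) D).
  have Ds : is_derive t (1 : R) (fun t : R => sin (2 * pi * t)) (cos (2 * pi * t) * (2 * pi)).
    exact: (is_derive1_comp (is_derive_sin _) D).
  have uni (f : R -> R) (a c : R) : is_derive t (1 : R) f a -> is_derive t (1 : R) f c -> a = c.
    by move=> [_ <-] [_ <-].
  have db := uni _ _ _ (d 1) Ds; rewrite /braid_arcs /= in db.
  (* where flip vanishes it has a minimum: the velocity is that of the circle *)
  have [f0|f0] := eqVneq (lam * flip p k t) 0.
    have da := d 0; rewrite /braid_arcs /= f0 subr0 in da.
    have [dF [_ _ dFP]] := flip_smooth p k.
    have Df : is_derive t (1 : R) (fun t => lam * flip p k t) 0.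
      apply: (@derive1_at_min _ _ (t - 1) (t + 1)).
      - by lra.
      - move=> u _; have [h _] := is_deriveM (is_derive_cst lam u 1) (dFP 0 u).
        exact: h.
      - by rewrite in_itv /=; lra.
      - by move=> u _; rewrite f0 mulr_ge0 ?flip_ge0.
    have := uni _ _ _ da (is_deriveB Dc Df); rewrite subr0 => ea.
    have : 2 * pi = 0 :> R.
      have := cos2Dsin2 (2 * pi * t).
      set c := cos _ in db ea *; set e := sin _ in db ea * => ce.
      by rewrite -[LHS]mulr1 -ce; nra.
    by move/eqP; rewrite mulf_eq0 pnatr_eq0 /= gt_eqF.
  have xE := ge0 k t t01; rewrite flipped //= in xE.
  have [f|[c0 _ ck]] := flip_cases p k t01; first by move: f0; rewrite f mulr0 eqxx.
  (* the third coordinate rests at n - 1, so a radial velocity is zero *)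
  have near_const (e : R) : 0 < e -> (forall u, `|u - t| < e ->
      extended p z k false u = n%:R - 1) -> False.
    move=> e0 h.
    have D0 : is_derive t (1 : R) (braid_arcs p lam z k (Ordinal i2)) 0.
      apply: near_eq_is_derive (is_derive_cst (n%:R - 1 : R) t (1 : R)).
      have /cvgrPdist_lt /(_ e e0) : id @ t --> t by exact: cvg_id.
      apply: filterS => u; rewrite distrC => ue.
      by rewrite /braid_arcs /= h.
    have := uni _ _ _ (d (Ordinal i2)) D0; rewrite xE => /eqP.
    rewrite mulf_eq0 [_ - _ == 0]gt_eqF // orbF => /eqP mu0.
    by move: db; rewrite mu0 mul0r => /esym/eqP; rewrite mulf_eq0 !gt_eqF // mulr_gt0.
  have l0 : lam != 0 by apply: contraNneq f0 => ->; rewrite mul0r.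
  case: ck => [[kl t4]|[kl t4]].
    apply: (near_const (Num.min (1 / 4 - t) (1 / 4))); first by rewrite lt_min; lra.
    move=> u; rewrite lt_min !ltr_norml => /andP[/andP[? ?] /andP[? ?]].
    rewrite /extended (S (p k)); last lra.
    have [u0|u0] := leP 0 u.
      rewrite (A1 k) //; last lra.
      by rewrite (E (p^-1 k)%g) ?permKV; [rewrite homeL //; ring|lra].
    rewrite (S k); last exact: ltW.
    by rewrite (A2 (p^-1 k)%g) ?permKV //; [rewrite homeL //; ring|lra].
  apply: (near_const (Num.min (t - 3 / 4) (1 - t))); first by rewrite lt_min; lra.
  move=> u; rewrite lt_min !ltr_norml => /andP[/andP[? ?] /andP[? ?]].
  rewrite /extended (S (p k)); last lra.
  rewrite (A2 k) //; last lra.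
  by rewrite (E (p^-1 k)%g) ?permKV; [rewrite homeL //; ring|lra].
Qed.

End BraidArcs.

(** * The exchange move *)

Section WordBounds.
Context {R : realType} {n : nat}.
Implicit Types (k l : 'I_n) (b : bool) (s t : R) (w u v : braid_word n).

Lemma homot_curve_isotopy p (z z' : @motion R n) (I : finType) (kk : I -> 'I_n) :
  (4 <= n)%N -> (forall x : 'I_n, exists! c, x \in porbit p (kk c)) ->
  homot p z z' ->
  curve_isotopy (fun c => closed_curve p (braid_arcs p 0 z) (kk c))
                (fun c => closed_curve p (braid_arcs p 0 z') (kk c)).
Proof.
move=> n4 kkP [f [Cf Bf <- <-]].
apply: (closed_curve_isotopy (f := fun s => braid_arcs p 0 (f s))) kkP.
  by apply: braid_arcs_smooth => // s; exact: cvg_cst.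
move=> s s01; have [S E D] := Bf s s01; apply: braid_arcs_system => //.
- by rewrite lexx ler01.
- by move=> k b t; rewrite eqxx.
- by move=> k b t; rewrite eqxx.
- by move=> k l t kl _ _ _ /D/eqP; rewrite (negbTE kl).
- by move=> l c d r t; rewrite ltxx.
Qed.

Definition on_first w := all (fun x : braid_letter n => (val x.1 < n.-2)%N) w.
Definition on_last w := all (fun x : braid_letter n => (0 < val x.1)%N) w.

Lemma word_motion_step x w k b t : word_motion (x :: w) k b t =
  if t <= 1 / 2 then letter_motion x k b (2 * t)
  else word_motion w (letter_perm x k) b (2 * t - 1) :> R.
Proof.
have [_ Bx] := @smooth_letter R n x; have [_ Bw] := @smooth_word R n w.
case: leP => [t2|/ltW t2]; first exact: (concat_left _ _ _ _ Bw).
exact: (concat_right _ _ _ Bx).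
Qed.

Lemma letter_motion_other (x : braid_letter n) k b t : k != pos_left x.1 ->
  k != pos_right x.1 -> letter_motion x k b t = home k b :> R.
Proof. by rewrite /letter_motion => /negbTE -> /negbTE ->. Qed.

Lemma on_first_last w k : on_first w -> is_last k ->
  word_perm w k = k /\ forall b t, word_motion w k b t = home k b :> R.
Proof.
move=> ow /eqP kl; elim: w ow => [|x w IH] /=.
  by rewrite word_perm_nil perm1.
move=> /andP[xn /IH[pw mw]].
have kL : k != pos_left x.1 by rewrite -val_eqE /=; move: xn kl => /=; lia.
have kP : k != pos_right x.1 by rewrite -val_eqE /=; move: xn kl => /=; lia.
split=> [|b t]; first by rewrite word_perm_cons permM letter_perm_other.
rewrite -[LHS]/(word_motion (x :: w) k b t) word_motion_step.
by case: ifP => _; [exact: letter_motion_other|rewrite letter_perm_other].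
Qed.

Lemma on_last_first w k : on_last w -> val k = 0%N ->
  word_perm w k = k /\ forall b t, word_motion w k b t = home k b :> R.
Proof.
move=> ow kl; elim: w ow => [|x w IH] /=.
  by rewrite word_perm_nil perm1.
move=> /andP[xn /IH[pw mw]].
have kL : k != pos_left x.1 by rewrite -val_eqE /=; move: xn kl => /=; lia.
have kP : k != pos_right x.1 by rewrite -val_eqE /=; move: xn kl => /=; lia.
split=> [|b t]; first by rewrite word_perm_cons permM letter_perm_other.
rewrite -[LHS]/(word_motion (x :: w) k b t) word_motion_step.
by case: ifP => _; [exact: letter_motion_other|rewrite letter_perm_other].
Qed.

Lemma letter_motion_range (x : braid_letter n) k t :
  (0 : R) <= letter_motion x k false t <= n%:R - 1 /\
  (-1 : R) <= letter_motion x k true t <= 1.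
Proof.
have u0 := @step_ge0 R t; have u1 := @step_le1 R t.
have w0 : (0 : R) <= step t * (1 - step t) <= 1.
  by rewrite mulr_ge0 ?subr_ge0 //= mulr_ile1 ?subr_ge0 // gerBl.
have le (j : 'I_n) : j%:R <= n%:R - 1 :> R.
  by rewrite lerBrDr natr1 ler_nat.
have ex : (pos_right x.1)%:R = (pos_left x.1)%:R + 1 :> R by rewrite /= -natr1.
have L0 : 0 <= (pos_left x.1)%:R :> R by exact: ler0n.
have Pn := le (pos_right x.1).
rewrite /letter_motion; case: eqP => [->|_].
  by split; [lra|case: ifP => _; lra].
case: eqP => [->|_]; first by split; [lra|case: ifP => _; lra].
by rewrite /home ler0n le; split=> //; lra.
Qed.

Lemma word_motion_range w k t :
  (0 : R) <= word_motion w k false t <= n%:R - 1 /\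
  (-1 : R) <= word_motion w k true t <= 1.
Proof.
elim: w k t => [|x w IH] k t.
  rewrite /= /still /home ler0n lerBrDr natr1 ler_nat ltn_ord; split=> //; lra.
by rewrite !word_motion_step; case: ifP => _; [exact: letter_motion_range|exact: IH].
Qed.

Lemma on_last_ge1 w k t : on_last w -> val k != 0%N ->
  1 <= word_motion w k false t :> R.
Proof.
elim: w k t => [|x w IH] k t; first by rewrite /= /still /home ler1n lt0n.
rewrite word_motion_step => /= /andP[x0 ow] k0.
have xR : 1 <= (pos_left x.1)%:R :> R by rewrite ler1n.
have ex : (pos_right x.1)%:R = (pos_left x.1)%:R + 1 :> R by rewrite /= -natr1.
case: ifP => _; last first.
  by apply: IH => //; rewrite letter_perm_val; case: ifP => // _; case: ifP => // _; rewrite -lt0n.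
have u0 := @step_ge0 R (2 * t); have u1 := @step_le1 R (2 * t).
rewrite /letter_motion; case: eqP => [->|_]; first lra.
by case: eqP => [->|_]; [lra|rewrite /home ler1n lt0n].
Qed.

Lemma on_last_perm w k : on_last w -> (val (word_perm w k) == 0%N) = (val k == 0%N).
Proof.
move=> ow; apply/eqP/eqP => [e|k0]; last by have [-> _] := on_last_first ow k0.
have [fx _] := on_last_first ow e.
by rewrite -[in RHS]e -[in LHS](perm_inj fx).
Qed.

End WordBounds.

Section ExchangeMotion.
Context {R : realType} {n : nat} (n_ge4 : (4 <= n)%N).
Variables (u v : braid_word n) (m : int).
Hypotheses (u_first : on_first u) (v_last : on_last v).
Implicit Types (k l : 'I_n) (b : bool) (s t : R).

Let pu := word_perm u.
Let pv := word_perm v.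
Let p := (pu * pv)%g.

(** The proportion of the full turns made, and of the excursion to the far
    left, of the strand that passes the part v along the first position. *)
Definition turning (t : R) : R := step (16 * t - 1) - step (8 * t - 7).
Definition bulge (t : R) : R := step (16 * t - 2) - step (16 * t - 13).

(** The enlargement by 2 n at sigma = 1 makes the circle miss everything of depth
    at most 1 whose first coordinate lies between 0 and 2 (n - 1). *)
Definition radius (sigma t : R) : R := @center R n + sigma * (2 * n%:R) * bulge t.

Definition first_strand (sigma s : R) b t : R :=
  let angle := 2 * pi * (m%:~R * (s * turning t)) in
  if b then radius sigma t * sin angle
  else @center R n - radius sigma t * cos angle.

(** u takes place in [0, 1/16] and v in [1/4, 3/4]; the first strand rotates
    around the other ones in between. *)
Definition exchange_motion (sigma s : R) : @motion R n := fun k b t =>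
  word_motion u k b (16 * t) +
  (if val (pu k) == 0%N then first_strand sigma s b t
   else word_motion v (pu k) b (2 * t - 1 / 2)) - home (pu k) b.

Lemma exchange_motion_smooth (f g : R -> R) : continuous f -> continuous g ->
  smooth_family (fun s => exchange_motion (f s) (g s)).
Proof.
move=> cf cg k b.
have Cw w k' : joint_C1 (fun _ => word_motion w k' b : R -> R).
  by have [Cw _] := @smooth_word R n w; exact: (Cw k' b).
have Ca (a c : R) := @joint_C1_affine R a c.
have Cs (a c : R) : joint_C1 (fun _ t => step (a * t - c)).
  exact: (joint_C1_retime joint_C1_step (Ca a (- c))).
have Ct : joint_C1 (fun _ t => turning t) by apply: joint_C1B; exact: Cs.
have Cb : joint_C1 (fun _ t => bulge t) by apply: joint_C1B; exact: Cs.
have Cr : joint_C1 (fun s t => radius (f s) t).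
  apply: joint_C1D; first exact: joint_C1_cst.
  apply: joint_C1M => //; apply: joint_C1M; last exact: joint_C1_cst.
  exact: joint_C1_param.
have Cang : joint_C1 (fun s t => 2 * pi * (m%:~R * (g s * turning t))).
  apply: joint_C1_turn; apply: joint_C1M; first exact: joint_C1_cst.
  by apply: joint_C1M => //; exact: joint_C1_param.
apply: joint_C1B; last exact: joint_C1_cst.
apply: joint_C1D.
  apply: (joint_C1_retime (Cw u k)).
  by apply: joint_C1M; [exact: joint_C1_cst|exact: joint_C1_time].
case: (val (pu k) == 0%N); last exact: (joint_C1_retime (Cw v (pu k)) (Ca 2 (- (1 / 2)))).
rewrite /first_strand; case: b {Cw}.
  by apply: joint_C1M => //; exact: (joint_C1_retime joint_C1_sin Cang).
apply: joint_C1B; first exact: joint_C1_cst.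
by apply: joint_C1M => //; exact: (joint_C1_retime joint_C1_cos Cang).
Qed.

Lemma turning_out t : t <= 1 / 16 \/ 1 <= t -> turning t = 0.
Proof.
case=> h; rewrite /turning.
  by rewrite (@step_le0 _ (16 * t - 1)) ?(@step_le0 _ (8 * t - 7)) ?subrr //; lra.
by rewrite (@step_ge1 _ (16 * t - 1)) ?(@step_ge1 _ (8 * t - 7)) ?subrr //; lra.
Qed.

Lemma turning_in t : 1 / 8 <= t <= 7 / 8 -> turning t = 1.
Proof.
by move=> h; rewrite /turning step_ge1 ?step_le0 ?subr0 //; lra.
Qed.

Lemma bulge_out t : t <= 1 / 8 \/ 7 / 8 <= t -> bulge t = 0.
Proof.
case=> h; rewrite /bulge.
  by rewrite (@step_le0 _ (16 * t - 2)) ?(@step_le0 _ (16 * t - 13)) ?subrr //; lra.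
by rewrite (@step_ge1 _ (16 * t - 2)) ?(@step_ge1 _ (16 * t - 13)) ?subrr //; lra.
Qed.

Lemma bulge_in t : 3 / 16 <= t <= 13 / 16 -> bulge t = 1.
Proof.
by move=> h; rewrite /bulge step_ge1 ?step_le0 ?subr0 //; lra.
Qed.

Lemma bulge_ge0 t : 0 <= bulge t.
Proof.
have [h|h] := leP (16 * t - 13) 0.
  by rewrite /bulge (step_le0 h) subr0 step_ge0.
by rewrite /bulge (@step_ge1 _ (16 * t - 2)) ?subr_ge0 ?step_le1 //; lra.
Qed.

Lemma first_strand_home sigma s k b t : val k = 0%N -> turning t = 0 -> bulge t = 0 ->
  first_strand sigma s b t = home k b.
Proof.
move=> k0 e0 b0; rewrite /first_strand /radius e0 b0 !mulr0 sin0 cos0 /home.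
by move: k0 => /= ->; case: b; ring.
Qed.

Lemma exchange_early sigma s k b t : t <= 1 / 16 ->
  exchange_motion sigma s k b t = word_motion u k b (16 * t).
Proof.
move=> t1; rewrite /exchange_motion; case: eqP => k0.
  rewrite (first_strand_home sigma s (k := pu k)) ?addrK //.
    by apply: turning_out; left.
  by apply: bulge_out; left; lra.
have [_ [S _ _]] := @smooth_word R n v.
by rewrite S ?addrK //; lra.
Qed.

Lemma exchange_late sigma s k b t : 1 / 16 <= t ->
  exchange_motion sigma s k b t =
  if val (pu k) == 0%N then first_strand sigma s b t
  else word_motion v (pu k) b (2 * t - 1 / 2).
Proof.
move=> t1; have [_ [_ E _]] := @smooth_word R n u.
by rewrite /exchange_motion E; [rewrite addrAC subrr add0r|lra].
Qed.

Lemma exchange_ends sigma s : has_ends p (exchange_motion sigma s).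
Proof.
have [_ [S _ _]] := @smooth_word R n u; have [_ [_ E _]] := @smooth_word R n v.
split=> k b t h; first by rewrite exchange_early ?S //; lra.
rewrite exchange_late; last lra.
rewrite permM; case: eqP => k0; last by rewrite E //; lra.
have [-> _] := @on_last_first R n v _ v_last k0.
apply: first_strand_home => //; first by apply: turning_out; right.
by apply: bulge_out; right; lra.
Qed.

Definition whole (s : R) := s = 0 \/ s = 1.

(** Between its turns, the first strand stays on the left, once it has made an
    integral number of them. *)
Lemma first_strand_left sigma s t : whole s -> 1 / 8 <= t <= 7 / 8 ->
  first_strand sigma s false t = @center R n - radius sigma t.
Proof.
move=> s01 t1; rewrite /first_strand turning_in // mulr1.
suff -> : cos (2 * pi * (m%:~R * s)) = 1 by rewrite mulr1.
by case: s01 => ->; rewrite ?mulr0 ?mulr1 ?cos0 ?cos_int.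
Qed.

Lemma radius_ge sigma t : 0 <= sigma -> @center R n <= radius sigma t.
Proof. by move=> s0; rewrite lerDl !mulr_ge0 ?bulge_ge0. Qed.

Lemma first_strand_circle sigma s t :
  (first_strand sigma s false t - @center R n) ^+ 2 + first_strand sigma s true t ^+ 2 =
  radius sigma t ^+ 2.
Proof.
rewrite /first_strand; set a := 2 * pi * _.
have -> : radius sigma t ^+ 2 = radius sigma t ^+ 2 * (cos a ^+ 2 + sin a ^+ 2).
  by rewrite cos2Dsin2 mulr1.
by ring.
Qed.

Lemma outside_v t : t <= 1 / 4 \/ 3 / 4 <= t -> forall k, val k != 0%N ->
  exists2 l : 'I_n, val l != 0%N & forall b, word_motion v k b (2 * t - 1 / 2) = home l b :> R.
Proof.
have [_ [S E _]] := @smooth_word R n v.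
case=> h k k0; first by exists k => // b; rewrite S //; lra.
by exists (pv k) => [|b]; rewrite ?on_last_perm // E //; lra.
Qed.

Lemma exchange_braiding sigma s : 0 <= sigma -> whole s ->
  is_braiding p (exchange_motion sigma s).
Proof.
move=> sig0 s01; have [S E] := exchange_ends sigma s.
have [_ [_ _ Du]] := @smooth_word R n u; have [_ [_ _ Dv]] := @smooth_word R n v.
have c0 := @center_gt0 R n n_ge4.
split=> // k l t e.
have [t1|/ltW t1] := leP t (1 / 16).
  by apply: (Du _ _ (16 * t)) => b; have := e b; rewrite !exchange_early.
apply: (@perm_inj _ pu).
have no (i j : 'I_n) : val i = 0%N -> val j != 0%N ->
   (forall b, first_strand sigma s b t = word_motion v j b (2 * t - 1 / 2)) -> False.
  move=> i0 j0 h.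
  have [t8|t8] := boolP (1 / 8 <= t <= 7 / 8).
    have := h false; rewrite first_strand_left // => hx.
    have := @radius_ge sigma t sig0; have := @on_last_ge1 R n v j (2 * t - 1 / 2) v_last j0.
    by lra.
  have tt : t <= 1 / 8 \/ 7 / 8 <= t.
    by move: t8; rewrite negb_and -!ltNge => /orP[/ltW|/ltW]; tauto.
  have tt' : t <= 1 / 4 \/ 3 / 4 <= t by case: tt; [left|right]; lra.
  have [l' l0 hl] := outside_v tt' j0.
  have rE : radius sigma t = @center R n by rewrite /radius bulge_out // mulr0 addr0.
  have hx := h false; have hy := h true.
  rewrite hl /first_strand rE /home in hx; rewrite hl /first_strand rE /home in hy.
  by apply: (@off_circle R n n_ge4 (val l') (2 * pi * (m%:~R * (s * turning t)))); [rewrite lt0n|rewrite hx hy subrr expr0n /= addr0].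
have h b : (if val (pu k) == 0%N then first_strand sigma s b t
     else word_motion v (pu k) b (2 * t - 1 / 2)) =
    (if val (pu l) == 0%N then first_strand sigma s b t
     else word_motion v (pu l) b (2 * t - 1 / 2)).
  by rewrite -!(exchange_late sigma s _ b t1).
case: (eqVneq (val (pu k)) 0%N) (h) => k0; case: (eqVneq (val (pu l)) 0%N) => l0 {}h.
- by apply: val_inj; rewrite k0 l0.
- by case: (no _ _ k0 l0 h).
- by case: (no _ _ l0 k0) => b; rewrite -h.
- exact: (Dv _ _ _ h).
Qed.

Lemma homot_bulge s : whole s ->
  homot p (exchange_motion 0 s) (exchange_motion 1 s).
Proof.
move=> s01; exists (fun sigma => exchange_motion sigma s); split=> //.
  by apply: exchange_motion_smooth => ?; [exact: cvg_id|exact: cvg_cst].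
by move=> sigma /andP[sig0 _]; exact: exchange_braiding.
Qed.

Lemma center_lt : 2 * @center R n < n%:R - 1.
Proof. by rewrite /center; lra. Qed.

Lemma exchange_below sigma s k t : 0 <= sigma -> whole s ->
  exchange_motion sigma s k false t <= n%:R - 1.
Proof.
move=> sig0 s01; have [t1|/ltW t1] := leP t (1 / 16).
  by rewrite exchange_early //; have [/andP[]] := @word_motion_range R n u k (16 * t).
rewrite exchange_late //; case: eqP => k0; last first.
  by have [/andP[]] := @word_motion_range R n v (pu k) (2 * t - 1 / 2).
have c0 := @center_gt0 R n n_ge4; have c1 := center_lt.
have [t8|t8] := boolP (1 / 8 <= t <= 7 / 8).
  by rewrite first_strand_left //; have := radius_ge t sig0; lra.
have rE : radius sigma t = @center R n.
  rewrite /radius bulge_out ?mulr0 ?addr0 //.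
  by move: t8; rewrite negb_and -!ltNge => /orP[/ltW|/ltW]; tauto.
rewrite /first_strand rE; set a := 2 * pi * _.
have : @center R n * -1 <= @center R n * cos a by rewrite ler_pM2l // cos_geN1.
by lra.
Qed.

Lemma last_strand k : is_last k -> pu k = k /\ val k != 0%N.
Proof.
move=> kl; have [-> _] := @on_first_last R n u k u_first kl; split=> //.
by rewrite (eqP kl) -lt0n; lia.
Qed.

Lemma exchange_last_before sigma s k b t : is_last k -> 0 <= t <= 1 / 4 ->
  exchange_motion sigma s k b t = home k b.
Proof.
move=> kl t4; have [pk k0] := last_strand kl.
rewrite /exchange_motion pk (negbTE k0).
have [_ ->] := @on_first_last R n u k u_first kl.
have [_ [S _ _]] := @smooth_word R n v.
by rewrite S; [ring|lra].
Qed.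

Lemma exchange_last_after sigma s k b t : is_last (p k) -> 3 / 4 <= t <= 1 ->
  exchange_motion sigma s k b t = home (p k) b.
Proof.
rewrite permM => kl t4; rewrite exchange_late; last lra.
have k0 : val (pu k) != 0%N.
  by rewrite -(@on_last_perm R n v (pu k) v_last) (eqP kl) -lt0n; lia.
have [_ [_ E _]] := @smooth_word R n v.
by rewrite (negbTE k0) E //; lra.
Qed.

Lemma displaced_norm (c d r x lam : R) : 0 < lam <= 1 -> 0 < c -> c ^+ 2 + d ^+ 2 = 1 ->
  0 < r -> c - lam * (3 / 2 * c ^+ 2) = r * cos x -> d = r * sin x ->
  r ^+ 2 = 1 - lam * c ^+ 3 * (3 - 9 / 4 * (lam * c)) /\ r < 1 /\ c <= 1.
Proof.
move=> /andP[l0 l1] c0 cd r0 ec ed.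
have rr : r ^+ 2 = 1 - lam * c ^+ 3 * (3 - 9 / 4 * (lam * c)).
  have -> : r ^+ 2 = (r * cos x) ^+ 2 + (r * sin x) ^+ 2.
    by rewrite !exprMn -mulrDr cos2Dsin2 mulr1.
  by rewrite -ec -ed (_ : d ^+ 2 = 1 - c ^+ 2); [field|rewrite -cd; ring].
have c1 : c <= 1.
  rewrite -(@ler_pXn2r _ 2) ?nnegrE ?(ltW c0) // expr1n.
  by have := sqr_ge0 d; lra.
have lc : lam * c <= 1 by rewrite mulr_ile1 // ltW.
split=> //; split=> //; rewrite -(@ltr_pXn2r _ 2) ?nnegrE ?ltW // expr1n rr.
have : 0 < lam * c ^+ 3 * (3 - 9 / 4 * (lam * c)).
  by rewrite mulr_gt0 ?mulr_gt0 ?exprn_gt0 //; lra.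
by lra.
Qed.

(** Completely displaced, the half turn of the last strand lies over times at
    which the circle of the first strand has its full size. *)
Lemma displaced_position (c d r x : R) : 0 < c -> c ^+ 2 + d ^+ 2 = 1 ->
  0 < r -> c - 1 * (3 / 2 * c ^+ 2) = r * cos x -> d = r * sin x ->
  1 / 2 <= r /\ cos x <= 1 / 4.
Proof.
move=> c0 cd r0 ec ed.
have l1 : (0 : R) < (1 : R) <= 1.
  by rewrite ltr01 lexx.
have [rr [r1 c1]] := displaced_norm l1 c0 cd r0 ec ed.
rewrite !mul1r in rr ec; split.
  have : 0 <= (1 - c) ^+ 2 * (3 / 4 + 3 / 2 * c + 9 / 4 * c ^+ 2).
    by rewrite mulr_ge0 ?sqr_ge0 // addr_ge0 ?mulr_ge0 ?sqr_ge0 //; lra.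
  have -> : (1 - c) ^+ 2 * (3 / 4 + 3 / 2 * c + 9 / 4 * c ^+ 2) =
     1 - c ^+ 3 * (3 - 9 / 4 * c) - 1 / 4 by field.
  have -> : 1 / 4 = (1 / 2) ^+ 2 :> R by field.
  rewrite -rr subr_ge0 ler_pXn2r ?nnegrE ?(ltW r0) //; lra.
rewrite leNgt; apply/negP => cx.
set w := c - 3 / 2 * c ^+ 2 in ec.
have wr : r / 4 < w by rewrite ec ltr_pM2l //; lra.
have w6 : w <= 1 / 6.
  have -> : w = 1 / 6 - 3 / 2 * (c - 1 / 3) ^+ 2 by rewrite /w; field.
  by rewrite gerBl mulr_ge0 ?sqr_ge0.
have w0 : 0 < w by lra.
have c23 : c < 2 / 3.
  have : w = c * (1 - 3 / 2 * c) by rewrite /w; ring.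
  by move=> we; move: w0; rewrite we pmulr_rgt0 //; lra.
have ww : w ^+ 2 <= (1 / 6) ^+ 2 by rewrite ler_pXn2r ?nnegrE ?(ltW w0).
have cc : c ^+ 2 < (2 / 3) ^+ 2 by rewrite ltr_pXn2r ?nnegrE ?(ltW c0).
have rw : (r / 4) ^+ 2 < w ^+ 2 by rewrite ltr_pXn2r ?nnegrE ?(ltW w0) //; lra.
have re : r ^+ 2 = w ^+ 2 + (1 - c ^+ 2) by rewrite rr /w; field.
have r4 : (r / 4) ^+ 2 = r ^+ 2 / 16 by field.
have e6 : (1 / 6) ^+ 2 = 1 / 36 :> R by field.
have e23 : (2 / 3) ^+ 2 = 4 / 9 :> R by field.
by rewrite r4 re e6 e23 in rw ww cc; lra.
Qed.

Lemma cos_three_sixteenths : 1 / 4 < cos (2 * pi * (3 / 16)) :> R.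
Proof.
have pi0 := @pi_gt0 R; set x := 2 * pi * (3 / 16).
have x0 : 0 <= cos x.
  by apply: cos_ge0_pihalf; rewrite /x; apply/andP; split; lra.
have y0 : 0 <= cos (pi / 4) :> R by apply: cos_ge0_pihalf; apply/andP; split; lra.
have e1 : 2 * cos (pi / 4) ^+ 2 - 1 = 0 :> R.
  rewrite [2 * _]mulr_natl -cos_mulr2n -cos_pihalf; congr cos.
  by rewrite -mulr_natl; field.
have e2 : 2 * cos x ^+ 2 - 1 = - cos (pi / 4).
  rewrite [2 * _]mulr_natl -cos_mulr2n.
  have -> : x *+ 2 = pi - pi / 4 by rewrite -mulr_natl /x; field.
  by rewrite cosB cospi sinpi; ring.
have y1 : cos (pi / 4) <= 3 / 4 :> R.
  rewrite -(@ler_pXn2r _ 2) ?nnegrE //; have -> : (3 / 4) ^+ 2 = 9 / 16 :> R by field.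
  lra.
rewrite -(@ltr_pXn2r _ 2) ?nnegrE //; have -> : (1 / 4) ^+ 2 = 1 / 16 :> R by field.
lra.
Qed.

Lemma cos_outside t : 0 <= t < 3 / 16 \/ 13 / 16 < t <= 1 -> 1 / 4 < cos (2 * pi * t) :> R.
Proof.
have pi0 := @pi_gt0 R.
have H (x : R) : 0 <= x < 3 / 16 -> 1 / 4 < cos (2 * pi * x).
  move=> /andP[x0 x1]; apply: lt_trans cos_three_sixteenths _.
  have p16 : 2 * pi * x < 2 * pi * (3 / 16) by rewrite ltr_pM2l // mulr_gt0.
  have px : 0 <= 2 * pi * x by rewrite !mulr_ge0 // ltW.
  by rewrite ltr_cos // in_itv /=; apply/andP; split; lra.
case=> h; first exact: H.
have -> : cos (2 * pi * t) = cos (2 * pi * (1 - t)).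
  rewrite -cosN -(@cosD2pi R); congr cos.
  by rewrite -[pi *+ 2]mulr_natl; ring.
by apply: H; lra.
Qed.

Lemma flip_gt0 k t : 0 <= t < 1 ->
  is_last k && (t < 3 / 16) || is_last (p k) && (13 / 16 < t) -> 0 < flip p k t :> R.
Proof.
move=> /andP[t0 t1] h; have c0 : 0 < sqpos (cos (2 * pi * t)) :> R.
  rewrite sqpos_gt0; apply: lt_trans (cos_outside _) => //.
  by case/orP: h => /andP[_ h]; [left|right]; lra.
rewrite /flip; apply: mulr_gt0; first exact: mulr_gt0.
case/orP: h => /andP[kl h].
  by rewrite kl step_le0 ?mulr0 ?addr0 ?subr0 ?mulr1 //; lra.
by rewrite kl step_ge1 ?subrr ?mulr0 ?add0r ?mulr1 //; lra.
Qed.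

(** A coincidence with a displaced point needs a strand to the right of n-1, as
    the displaced point has norm less than 1 in the first two coordinates; but
    the first strand stays to the left of n-1, as it is enlarged only while its
    angle is an integral number of turns. *)
Lemma exchange_flip_system lam s : whole s -> 0 <= lam <= 1 ->
  arc_system p (braid_arcs p lam (exchange_motion 1 s)).
Proof.
move=> s01 lam01; apply: braid_arcs_system => //.
- exact: exchange_ends.
- by move=> k b t _; exact: exchange_last_before.
- by move=> k b t _; exact: exchange_last_after.
- move=> k l t kl _ _ _ e; have [_ _ D] := @exchange_braiding 1 s ler01 s01.
  by have := D _ _ _ e => /eqP; rewrite (negbTE kl).
- move=> l c d r t l0 t01 c0 cd r0 ec ed ex _.
  have lam01' : 0 < lam <= 1 by case/andP: lam01 => _ ->; rewrite l0.
  have [_ [r1 _]] := displaced_norm lam01' c0 cd r0 ec ed.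
  have x1 := @exchange_below 1 s l t ler01 s01.
  have nR := @n_ge4R R n n_ge4.
  have : r * exchange_motion 1 s l false t <= r * (n%:R - 1) by rewrite ler_pM2l.
  have : r * (n%:R - 1) < 1 * (n%:R - 1) by rewrite ltr_pM2r //; lra.
  by rewrite -ex mul1r; lra.
Qed.

Lemma sqr_le_bound (a c : R) : -c <= a <= c -> a ^+ 2 <= c ^+ 2.
Proof.
move=> /andP[h1 h2]; rewrite -subr_ge0 subr_sqr mulr_ge0 //; lra.
Qed.

(** The bound 2 (n - 1) leaves room for the factor of at most 2 between points
    of a ray through the displaced last strand. *)
Lemma far_circle (x y : R) t : 3 / 16 <= t <= 13 / 16 -> -1 <= y <= 1 ->
  0 <= x -> x <= 2 * (n%:R - 1) ->
  (x - @center R n) ^+ 2 + y ^+ 2 = radius 1 t ^+ 2 -> False.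
Proof.
move=> t1 y1 x0 x1; rewrite /radius bulge_in // mul1r mulr1.
have c0 := @center_gt0 R n n_ge4; have c1 := center_lt; have nR := @n_ge4R R n n_ge4.
have h1 : (x - @center R n) ^+ 2 <= (2 * n%:R - 2) ^+ 2.
  by apply: sqr_le_bound; apply/andP; split; lra.
have h2 : y ^+ 2 <= 1 ^+ 2 by exact: sqr_le_bound.
have h3 : (2 * n%:R) ^+ 2 <= (@center R n + 2 * n%:R) ^+ 2.
  by apply: sqr_le_bound; apply/andP; split; lra.
have e2 : (2 * n%:R - 2) ^+ 2 = (2 * n%:R) ^+ 2 - 8 * n%:R + 4 :> R by ring.
by move=> e; rewrite e2 expr1n in h1 h2; lra.
Qed.

(** The enlarged circles, too, meet the row of strands outside of the positions
    1 to n-2 only. *)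
Lemma inner_strand (j : nat) (a r : R) : (0 < j)%N -> (j < n.-1)%N ->
  @center R n <= r -> r * sin a = 0 -> @center R n - r * cos a = j%:R -> False.
Proof.
move=> j0 jn cr ey ex.
have c0 := @center_gt0 R n n_ge4.
have rr : r ^+ 2 = (j%:R - @center R n) ^+ 2.
  have -> : r ^+ 2 = (r * cos a) ^+ 2 + (r * sin a) ^+ 2.
    by rewrite !exprMn -mulrDr cos2Dsin2 mulr1.
  by rewrite ey expr0n addr0 -ex; ring.
have j1 : 1 <= j%:R :> R by rewrite ler1n.
have jn' : j%:R + 2 <= n%:R :> R by rewrite -natrD ler_nat; lia.
have : 0 < (r - (j%:R - @center R n)) * (r + (j%:R - @center R n)).
  by rewrite mulr_gt0 //; rewrite /center in c0 cr *; lra.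
by rewrite -subr_sqr rr subrr ltxx.
Qed.

(** While the last strand is displaced, the first one can rotate around
    everything else by any angle: during the part v its circle is too large to
    meet anything, and outside of this part the last strand, the only one that
    the circle does not enclose, is out of the way. *)
Lemma exchange_rotation_system s : arc_system p (braid_arcs p 1 (exchange_motion 1 s)).
Proof.
have nR := @n_ge4R R n n_ge4.
have rad1 t : @center R n <= radius 1 t by exact: radius_ge.
apply: braid_arcs_system => //.
- by rewrite ler01 lexx.
- exact: exchange_ends.
- by move=> k b t _; exact: exchange_last_before.
- by move=> k b t _; exact: exchange_last_after.
- have [_ [_ _ Du]] := @smooth_word R n u; have [_ [_ _ Dv]] := @smooth_word R n v.
  move=> k l t kl t01; rewrite !mul1r => fk fl e.
  have [t1|/ltW t1] := leP t (1 / 16).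
    have := Du k l (16 * t); move/eqP: kl => kl h; apply: kl; apply: h => b.
    by have := e b; rewrite !exchange_early.
  have no i j : val (pu i) = 0%N -> val (pu j) != 0%N -> flip p j t = 0 ->
     (forall b, first_strand 1 s b t = word_motion v (pu j) b (2 * t - 1 / 2)) -> False.
    move=> i0 j0 fj h.
    have [t3|t3] := boolP (3 / 16 <= t <= 13 / 16).
      have := first_strand_circle 1 s t; rewrite !h.
      have [/andP[x0 x1] y1] := @word_motion_range R n v (pu j) (2 * t - 1 / 2).
      by apply: far_circle => //; lra.
    have tt : t < 3 / 16 \/ 13 / 16 < t.
      by move: t3; rewrite negb_and -!ltNge => /orP[]; tauto.
    have [_ [S E _]] := @smooth_word R n v.
    have hx := h false; have hy := h true; rewrite /first_strand in hx hy.
    case: tt => tt.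
      have S' b : word_motion v (pu j) b (2 * t - 1 / 2) = home (pu j) b by apply: S; lra.
      rewrite S' in hx; rewrite S' in hy; rewrite /home in hx hy.
      apply: (inner_strand (j := val (pu j)) _ _ (rad1 t) hy hx); first by rewrite lt0n.
      have jl : ~~ is_last j.
        apply/negP => jl; have := @flip_gt0 j t t01; rewrite fj ltxx jl tt => h'.
        by have := h' isT.
      rewrite ltnNge; apply: contra jl => jn.
      have pl : is_last (pu j) by rewrite /is_last eqn_leq jn andbT /=; have := ltn_ord (pu j); lia.
      have [fx _] := @on_first_last R n u (pu j) u_first pl.
      by rewrite -(perm_inj fx).
    have E' b : word_motion v (pu j) b (2 * t - 1 / 2) = home (pv (pu j)) b by apply: E; lra.
    rewrite E' in hx; rewrite E' in hy; rewrite /home in hx hy.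
    apply: (inner_strand (j := val (pv (pu j))) _ _ (rad1 t) hy hx).
      by rewrite lt0n (@on_last_perm R n).
    have jl : ~~ is_last (p j).
      apply/negP => jl; have := @flip_gt0 j t t01; rewrite fj ltxx jl tt andbT orbT => h'.
      by have := h' isT.
    rewrite ltnNge; apply: contra jl => jn; rewrite /is_last permM eqn_leq jn andbT /=.
    by have := ltn_ord (pv (pu j)); lia.
  have h b : (if val (pu k) == 0%N then first_strand 1 s b t
     else word_motion v (pu k) b (2 * t - 1 / 2)) =
    (if val (pu l) == 0%N then first_strand 1 s b t
     else word_motion v (pu l) b (2 * t - 1 / 2)).
    by rewrite -!(exchange_late 1 s _ b t1).
  case: (eqVneq (val (pu k)) 0%N) (h) => k0; case: (eqVneq (val (pu l)) 0%N) => l0 {}h.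
  + by move/eqP: kl; apply; apply: (@perm_inj _ pu); apply: val_inj; rewrite k0 l0.
  + exact: (no k l).
  + by apply: (no l k) => // b; rewrite h.
  + by move/eqP: kl; apply; apply: (@perm_inj _ pu); exact: (Dv _ _ _ h).
- move=> l c d r t l0 t01 c0 cd r0 ec ed ex ey.
  have lam01' : (0 : R) < (1 : R) <= 1 by rewrite ltr01 lexx.
  have [_ [r1 _]] := displaced_norm lam01' c0 cd r0 ec ed.
  have [r2 cx] := displaced_position c0 cd r0 ec ed.
  have big : n%:R - 1 < exchange_motion 1 s l false t.
    rewrite ltNge; apply/negP => x1.
    have : r * exchange_motion 1 s l false t <= r * (n%:R - 1) by rewrite ler_pM2l.
    have : r * (n%:R - 1) < 1 * (n%:R - 1) by rewrite ltr_pM2r //; lra.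
    by rewrite -ex mul1r; lra.
  have small : exchange_motion 1 s l false t <= 2 * (n%:R - 1).
    rewrite -(@ler_pM2l _ r) // -ex.
    have : 1 / 2 * (2 * (n%:R - 1)) <= r * (2 * (n%:R - 1)) by rewrite ler_pM2r //; lra.
    lra.
  have [t1|/ltW t1] := leP t (1 / 16).
    have [/andP[_ x1] _] := @word_motion_range R n u l (16 * t).
    by rewrite exchange_early // in big; lra.
  rewrite !exchange_late // in big small ey; case: eqP big small ey => l0' big small ey; last first.
    by have [/andP[_ x1] _] := @word_motion_range R n v (pu l) (2 * t - 1 / 2); lra.
  have t3 : 3 / 16 <= t <= 13 / 16.
    have [//|t3] := boolP (3 / 16 <= t <= 13 / 16).
    have := @cos_outside t; move: t3; rewrite negb_and -!ltNge => /orP[t3|t3] h.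
      by have := h (or_introl _); rewrite t3 => h'; have := h' ltac:(lra); lra.
    by have := h (or_intror _) => h'; have := h' ltac:(lra); lra.
  have := first_strand_circle 1 s t; rewrite ey; apply: far_circle => //; lra.
Qed.

(** The isotopy: move the first strand far to the left, displace the last one
    across the axis, rotate, and undo the first two steps. *)
Lemma exchange_isotopy (I : finType) (kk : I -> 'I_n) :
  (forall x : 'I_n, exists! c, x \in porbit p (kk c)) ->
  curve_isotopy (fun c => closed_curve p (braid_arcs p 0 (exchange_motion 0 0)) (kk c))
                (fun c => closed_curve p (braid_arcs p 0 (exchange_motion 0 1)) (kk c)).
Proof.
move=> kkP; have w0 : whole 0 by left. have w1 : whole 1 by right.
have flipI s : whole s ->
    curve_isotopy (fun c => closed_curve p (braid_arcs p 0 (exchange_motion 1 s)) (kk c))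
      (fun c => closed_curve p (braid_arcs p 1 (exchange_motion 1 s)) (kk c)).
  move=> ws; apply: (closed_curve_isotopy
    (f := fun lam => braid_arcs p lam (exchange_motion 1 s))) kkP.
    apply: braid_arcs_smooth; first by move=> ?; exact: cvg_id.
    by apply: exchange_motion_smooth => ?; exact: cvg_cst.
  by move=> lam; exact: exchange_flip_system.
apply: curve_isotopy_trans (homot_curve_isotopy n_ge4 kkP (homot_bulge w0)) _.
apply: curve_isotopy_trans (flipI _ w0) _.
apply: curve_isotopy_trans (curve_isotopy_sym
  (homot_curve_isotopy n_ge4 kkP (homot_bulge w1))).
apply: curve_isotopy_trans (curve_isotopy_sym (flipI _ w1)).
apply: (closed_curve_isotopy
    (f := fun s => braid_arcs p 1 (exchange_motion 1 s))) kkP.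
  apply: braid_arcs_smooth; first by move=> ?; exact: cvg_cst.
  by apply: exchange_motion_smooth => ?; [exact: cvg_cst|exact: cvg_id].
by move=> s _; exact: exchange_rotation_system.
Qed.

End ExchangeMotion.

Section ExchangeEnds.
Context {R : realType} {n : nat} (n_ge4 : (4 <= n)%N).
Variables (u v : braid_word n) (m : int).
Hypotheses (u_first : on_first u) (v_last : on_last v).
Implicit Types (k l : 'I_n) (b : bool) (s t : R).

(** The two motions differ by the choice of the time intervals. *)
Lemma homot_exchange_start : @homot R n (word_perm (u ++ v))
  (word_motion (u ++ v)) (exchange_motion u v m 0 0).
Proof.
apply: homot_trans (homot_word_cat u v) _.
have Bu := @smooth_word R n u; have Bv := @smooth_word R n v.
pose zs := [:: (word_perm u, word_motion u : @motion R n); (word_perm v, word_motion v)].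
apply: (@homot_ext R n (word_perm (u ++ v)) (seq_motion zs [:: (0, 1 / 2); (1 / 2, 1)]) _
  (seq_motion zs [:: (0, 1 / 16); (1 / 4, 3 / 4)])).
- by move=> k b t; exact: concat_seq.
- move=> k b t; rewrite /= /exchange_motion.
  have -> : (t - 0) / (1 / 16 - 0) = 16 * t by field.
  have -> : (t - 1 / 4) / (3 / 4 - 1 / 4) = 2 * t - 1 / 2 by field.
  case: eqP => k0; last by ring.
  have [-> ->] := @on_last_first R n v _ v_last k0.
  have -> : @first_strand R n m 0 0 b t = home (word_perm u k) b.
    rewrite /first_strand /radius !mul0r !mulr0 sin0 cos0 /home.
    by move: k0 => /= ->; case: b; ring.
  by ring.
have -> : word_perm (u ++ v) = seq_perm zs by rewrite word_perm_cat /= mulg1.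
apply: homot_seq => //=; try by do 3?split; lra.
by repeat split=> //; exact: homot_refl.
Qed.

Definition exchange_word : braid_word n :=
  u ++ @kappa_pow_word n m ++ v ++ @kappa_pow_word n (- m).

Lemma word_perm_exchange : word_perm exchange_word = word_perm (u ++ v).
Proof. by rewrite !word_perm_cat !word_perm_kappa_pow // mul1g mulg1. Qed.

(** The m full turns before v and the -m full turns after v are exactly what
    turning does for s = 1. *)
Lemma homot_exchange_end : @homot R n (word_perm (u ++ v))
  (word_motion exchange_word) (exchange_motion u v m 0 1).
Proof.
have Bu := @smooth_word R n u; have Bv := @smooth_word R n v.
have BT := @smooth_full_turns R n n_ge4.
pose zs := [:: (word_perm u, word_motion u : @motion R n); (1%g, full_turns m);
  (word_perm v, word_motion v); (1%g, full_turns (- m))].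
have pE : word_perm (u ++ v) = seq_perm zs by rewrite word_perm_cat /= !mulg1 mul1g.
have H1 : homot (word_perm (u ++ v)) (word_motion exchange_word)
    (concat (word_perm u) (word_motion u) (concat 1%g (full_turns m)
      (concat (word_perm v) (word_motion v) (full_turns (- m))) : @motion R n)).
  have K1 := @homot_kappa_pow R n n_ge4 m; have K2 := @homot_kappa_pow R n n_ge4 (- m).
  have p1 := @word_perm_kappa_pow n m; have p2 := @word_perm_kappa_pow n (- m).
  have G3 := @homot_word_cat R n v (@kappa_pow_word n (- m)).
  have F3 := homot_concat (homot_refl Bv) K2.
  rewrite word_perm_cat p2 in G3; have {}G3 := homot_trans G3 F3; rewrite mulg1 in G3.
  have G2 := @homot_word_cat R n (@kappa_pow_word n m) (v ++ @kappa_pow_word n (- m)).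
  have F2 := homot_concat K1 G3; rewrite mul1g in F2.
  rewrite !word_perm_cat p1 p2 mul1g mulg1 in G2; have {F2}G2 := homot_trans G2 F2.
  have G1 := @homot_word_cat R n u (@kappa_pow_word n m ++ v ++ @kappa_pow_word n (- m)).
  have F1 := homot_concat (homot_refl Bu) G2.
  rewrite !word_perm_cat p1 p2 mul1g mulg1 in G1.
  by rewrite word_perm_cat; exact: homot_trans G1 F1.
apply: homot_trans H1 _.
apply: (@homot_ext _ _ _
  (seq_motion zs [:: (0, 1 / 2); (1 / 2, 3 / 4); (3 / 4, 7 / 8); (7 / 8, 1)]) _
  (seq_motion zs [:: (0, 1 / 16); (1 / 16, 1 / 8); (1 / 4, 3 / 4); (7 / 8, 1)])).
- move=> k b t; rewrite /= /concat !perm1.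
  have -> : (t - 0) / (1 / 2 - 0) = 2 * t by field.
  have -> : (t - 1 / 2) / (3 / 4 - 1 / 2) = 2 * (2 * t - 1) by field.
  have -> : (t - 3 / 4) / (7 / 8 - 3 / 4) = 2 * (2 * (2 * t - 1) - 1) by field.
  have -> : (t - 7 / 8) / (1 - 7 / 8) = 2 * (2 * (2 * t - 1) - 1) - 1 by field.
  by ring.
- move=> k b t; rewrite /= /exchange_motion !perm1.
  have -> : (t - 0) / (1 / 16 - 0) = 16 * t by field.
  have -> : (t - 1 / 16) / (1 / 8 - 1 / 16) = 16 * t - 1 by field.
  have -> : (t - 1 / 4) / (3 / 4 - 1 / 4) = 2 * t - 1 / 2 by field.
  have -> : (t - 7 / 8) / (1 - 7 / 8) = 8 * t - 7 by field.
  case: eqP => k0; last first.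
    rewrite /full_turns /rotation (@on_last_perm R n v _ v_last).
    by move/eqP/negbTE: k0 => ->; ring.
  have [-> ->] := @on_last_first R n v _ v_last k0.
  rewrite /full_turns /rotation k0 eqxx /first_strand.
  have -> : @radius R n 0 t = @center R n by rewrite /radius !mul0r addr0.
  have h0 : home (word_perm u k) b = 0 :> R.
    by move: k0; rewrite /home /= => ->; case: b.
  rewrite h0 /turning mul1r.
  have [t8|t8] := leP (8 * t - 7) 0.
    rewrite (step_le0 t8) [step _ - 0]subr0 !mulr0 sin0 cos0.
    by case: b {h0}; ring.
  rewrite (@step_ge1 _ (16 * t - 1)); last lra.
  move: (step (8 * t - 7)) => e; rewrite !mulr1 sin_int cos_int.
  have -> : 2 * pi * (m%:~R * (1 - e)) = 2 * pi * m%:~R - 2 * pi * (m%:~R * e) by ring.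
  have -> : 2 * pi * ((- m)%:~R * e) = - (2 * pi * (m%:~R * e)) by rewrite intrN; ring.
  by rewrite sinB cosB sinN cosN sin_int cos_int; case: b {h0}; ring.
rewrite pE; apply: homot_seq => //=.
- by repeat split=> //; apply: homot_refl => //; exact: BT.
- by do 5?split; lra.
- by do 5?split; lra.
Qed.

End ExchangeEnds.

Section Closures.
Context {R : realType} {n : nat} (n_ge4 : (4 <= n)%N).
Implicit Types (k l : 'I_n) (b : bool) (s t : R) (w : braid_word n).

Definition closure_curve w k : R -> 'rV[R]_4 :=
  closed_curve (word_perm w) (braid_arcs (word_perm w) 0 (word_motion w)) k.

Lemma word_arc_system w :
  arc_system (word_perm w) (braid_arcs (word_perm w) 0 (word_motion w : @motion R n)).
Proof.
have [Cw [S E D]] := @smooth_word R n w; apply: braid_arcs_system => //.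
- by rewrite lexx ler01.
- by move=> k b t; rewrite eqxx.
- by move=> k b t; rewrite eqxx.
- by move=> k l t kl _ _ _ /D/eqP; rewrite (negbTE kl).
- by move=> l c d r t; rewrite ltxx.
Qed.

Lemma closure_curve_link w (I : finType) (kk : I -> 'I_n) :
  (forall x : 'I_n, exists! c, x \in porbit (word_perm w) (kk c)) ->
  link_embedding (fun c => closure_curve w (kk c)).
Proof.
move=> kkP; apply: closed_curve_link kkP; last exact: word_arc_system.
have [Cw _] := @smooth_word R n w.
by apply: (@braid_arcs_smooth R n _ (cst 0) (fun=> word_motion w)) => // s; exact: cvg_cst.
Qed.

Lemma torus_point_row t (z : R * R) (f : 'I_4 -> R) :
  f 0 = cos (2 * pi * t) -> f 1 = sin (2 * pi * t) -> f 2 = z.1 -> f 3 = z.2 ->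
  \row_i ((Num.sqrt (\sum_j f j ^+ 2))^-1 * f i) = torus_point t z.
Proof.
move=> f0 f1 f2 f3; apply/rowP => i; rewrite !mxE sum4 f0 f1 f2 f3.
rewrite addrA cos2Dsin2 [1 + (_ + _)]addrA; congr (_ * _).
by case: i => [[|[|[|[|i]]]] i4] //=; rewrite -?f0 -?f1 -?f2 -?f3; congr f; exact: val_inj.
Qed.

Lemma closure_curveE w k j t : 0 <= t <= 1 ->
  closure_curve w k ((j%:R + t) / #|porbit (word_perm w) k|%:R) =
  torus_point t (word_strand w ((word_perm w ^+ j)%g k) t).
Proof.
move=> /andP[t0 t1]; rewrite /closure_curve /closed_curve.
have N0 : #|porbit (word_perm w) k|%:R != 0 :> R by rewrite pnatr_eq0 card_porbit_neq0.
set N : R := #|_|%:R in N0 *; have -> : N * ((j%:R + t) / N) = t + j%:R.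
  by rewrite mulrC divfK // addrC.
set g := braid_arcs _ _ _.
have U i : unroll (word_perm w) g k i (t + j%:R) =
    unroll (word_perm w) g ((word_perm w ^+ j)%g k) i t by rewrite unroll_add permX.
have -> : (\row_i ((Num.sqrt (\sum_j0 unroll (word_perm w) g k j0 (t + j%:R) ^+ 2))^-1 *
    unroll (word_perm w) g k i (t + j%:R))) =
  \row_i ((Num.sqrt (\sum_j0 unroll (word_perm w) g ((word_perm w ^+ j)%g k) j0 t ^+ 2))^-1 *
    unroll (word_perm w) g ((word_perm w ^+ j)%g k) i t).
  apply/rowP => i; rewrite !mxE U; congr ((Num.sqrt _)^-1 * _).
  by apply: eq_bigr => ? _; rewrite U.
set k' := (word_perm w ^+ j)%g k.
have [_ [S E _]] := @smooth_word R n w.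
have ze : has_ends (word_perm w) (word_motion w : @motion R n) by split.
rewrite word_motionE ?t0 //.
have [t1'|t1'] := ltP t 1.
  apply: torus_point_row; rewrite unroll01 ?t0 // /g /braid_arcs /= ?mul0r ?subr0 //.
    by rewrite extended01 // t0.
  by rewrite extended01 // t0.
have -> : t = 1 by apply/le_anti; rewrite t1.
have U1 i : unroll (word_perm w) g k' i 1 = g (word_perm w k') i 0.
  by rewrite -[1]add0r unroll_succ unroll01 // lexx ltr01.
have tp : 2 * pi * 1 = 0 + pi *+ 2 :> R by rewrite add0r mulr1 mulr_natl.
have z01 : (0 : R) <= (0 : R) <= 1 by rewrite lexx ler01.
apply: torus_point_row; rewrite U1 /g /braid_arcs /= ?mul0r ?subr0 ?tp.
- by rewrite (@cosD2pi R) mulr0.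
- by rewrite (@sinD2pi R) mulr0.
- by rewrite extended01 // S // E.
- by rewrite extended01 // S // E.
Qed.

Lemma link_periodic (I : finType) (K : I -> R -> 'rV[R]_4) c t (q : int) :
  link_embedding K -> K c (t + q%:~R) = K c t.
Proof.
move=> [_ per _ _ _]; elim/int_rect: q t => [|j IH|j IH] t; first by rewrite addr0.
  by rewrite intS intrD [1%:~R + _]addrC addrA per IH.
rewrite -[RHS]IH -[LHS]per; congr (K c _).
by rewrite intS !intrN intrD; ring.
Qed.

(** The definition prescribes the curve on the times that correspond to the
    strands; by periodicity this is everything. *)
Lemma closed_word_curve w (K : oriented_link R) (kk : link_component K -> 'I_n) :
  (forall c (j : nat) (t : R), 0 <= t <= 1 ->
     K c ((j%:R + t) / #|porbit (word_perm w) (kk c)|%:R) =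
     torus_point t (word_strand w ((word_perm w ^+ j)%g (kk c)) t)) ->
  (forall x : 'I_n, exists! c, x \in porbit (word_perm w) (kk c)) ->
  @link_curve R K = fun c => closure_curve w (kk c).
Proof.
move=> Kw kkP; apply/funext => c; apply/funext => t.
have EK := curve_embedding K; have EC := closure_curve_link kkP.
rewrite -[t](subrK (Num.floor t)%:~R) (link_periodic _ _ _ EK).
rewrite (link_periodic c (t - (Num.floor t)%:~R) (Num.floor t) EC).
have := floor_bounds t; set x := t - _ => tb; have x0 : 0 <= x by rewrite /x; lra.
set N : R := #|porbit (word_perm w) (kk c)|%:R.
have N0 : 0 < N by rewrite ltr0n lt0n card_porbit_neq0.
have Nx0 : 0 <= N * x by rewrite mulr_ge0 // ltW.
have Nb := floor_bounds (N * x).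
have f0 : 0 <= Num.floor (N * x) by rewrite floor_ge_int.
have xE : x = ((absz (Num.floor (N * x)))%:R + (N * x - (Num.floor (N * x))%:~R)) / N.
  rewrite -[X in X + _](_ : (Num.floor (N * x))%:~R = _); last first.
    by rewrite -[in LHS](gez0_abs f0).
  by rewrite addrC subrK mulrC mulKf // gt_eqF.
by rewrite xE Kw ?closure_curveE //; lra.
Qed.

(** ** Words for the braids of the exchange move *)

Lemma braid_of_wordM (x y : braid_word n) :
  (braid_of_word x * braid_of_word y)%g = braid_of_word (x ++ y).
Proof. exact: braid_mul_word. Qed.

Lemma braid_of_wordV (x : braid_word n) :
  (braid_of_word x)^-1%g = braid_of_word (word_inv x).
Proof. exact: braid_inv_word. Qed.

Lemma prod_artin (s : seq 'I_n.-1) :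
  (\prod_(i <- s) @artin n i)%g = braid_of_word (@positive_word n s).
Proof.
elim: s => [|i s IH]; first by rewrite big_nil.
by rewrite big_cons IH braid_of_wordM.
Qed.

Lemma kappaE : kappa n = @braid_of_word n (@kappa_word n).
Proof. by rewrite /kappa !prod_artin braid_of_wordM. Qed.

Lemma kappa_powE m : zpow (kappa n) m = @braid_of_word n (@kappa_pow_word n m).
Proof.
have E j : (kappa n ^+ j)%g = @braid_of_word n (flatten (nseq j (@kappa_word n))).
  elim: j => [|j IH]; first by rewrite expg0.
  by rewrite expgS IH kappaE braid_of_wordM.
by case: m => j; rewrite /= ?E // braid_of_wordV.
Qed.

Lemma exchange_moveE (u v : braid_word n) m :
  exchange_move (braid_of_word u) (braid_of_word v) m =
  braid_of_word (exchange_word u v m).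
Proof.
by rewrite /exchange_move !kappa_powE !braid_of_wordM /exchange_word !catA.
Qed.

Lemma generated_words (P : pred 'I_n.-1) (a : braid_group n) :
  @generated_subgroup (braid_group n) [set @artin n i | i in [set i | P i]] a ->
  exists2 w, all (fun x : braid_letter n => P x.1) w & a = braid_of_word w.
Proof.
pose H := [set x | exists2 w : braid_word n,
  all (fun l : braid_letter n => P l.1) w & x = braid_of_word w].
move=> /(_ H); apply; split.
  split; first by exists [::].
  move=> x y [wx Px ->] [wy Py ->]; exists (wx ++ word_inv wy).
    rewrite all_cat Px /word_inv all_rev all_map.
    by apply: sub_all Py.
  by rewrite braid_of_wordV braid_of_wordM.
by move=> _ [i Pi <-]; exists [:: (i, true)] => //=; rewrite andbT.
Qed.

(** The given closed word need not be the product of the two factors, but it is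
    equivalent to it; so it is joined to the result through two braid homotopies
    and the isotopy that undoes the turns. *)
Lemma exchange_closure (L : oriented_link R) (u v : braid_word n) m :
  on_first u -> on_last v -> is_closure (braid_of_word (u ++ v)) L ->
  is_closure (exchange_move (braid_of_word u) (braid_of_word v) m) L.
Proof.
move=> uf vl [w [wE [K [[kk [kkP Kw]] KL]]]].
have wuv : braid_equiv (u ++ v) w by apply/braid_of_wordP.
have pw := word_perm_equiv wuv.
have KE := closed_word_curve Kw kkP.
have pe := word_perm_exchange u v m.
exists (exchange_word u v m); split; first exact: exchange_moveE.
have kkP' : forall x : 'I_n, exists! c,
    x \in porbit (word_perm (exchange_word u v m)) (kk c) by rewrite pe pw.
pose K' := OrientedLink (closure_curve_link kkP').
exists K'; split.
  by exists kk; split=> //= c j t t01; exact: closure_curveE.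
apply: (@isotopic_extend R K' K L (fun c => c)) KL; first by exists id.
rewrite /= KE /closure_curve pe -pw.
have kkQ : forall x : 'I_n, exists! c, x \in porbit (word_perm (u ++ v)) (kk c).
  by rewrite pw.
have S := @homot_exchange_start R n u v m vl; have E := @homot_exchange_end R n n_ge4 u v m vl.
apply: curve_isotopy_trans (homot_curve_isotopy n_ge4 kkQ E) _.
have I0 := homot_curve_isotopy n_ge4 kkQ (homot_trans (homot_sym S) (braid_equiv_homot wuv)).
apply: curve_isotopy_trans I0.
by rewrite word_perm_cat in kkQ *; exact/curve_isotopy_sym/exchange_isotopy.
Qed.

End Closures.

(** * The Burau representation *)

Section Burau.
Context {J : comNzRingType} {n : nat} (t t' : J).
Hypothesis tt' : t * t' = 1.
Implicit Types (i j : 'I_n.-1) (w : braid_word n).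

Definition burau_col i : 'cV[J]_n :=
  t *: delta_mx (pos_left i) 0 - delta_mx (pos_right i) 0.
Definition burau_row i : 'rV[J]_n :=
  delta_mx 0 (pos_right i) - delta_mx 0 (pos_left i).
Definition burau_dyad i : 'M[J]_n := burau_col i *m burau_row i.

(** The Burau matrix of a generator differs from the identity by a matrix of rank
    one; its inverse is read off from the quadratic relation for that matrix. *)
Definition burau_letter (l : braid_letter n) : 'M[J]_n :=
  1 + (if l.2 then 1 else t') *: burau_dyad l.1.

Definition burau w : 'M[J]_n := \prod_(l <- w) burau_letter l.

Lemma burau_row_col i j : burau_row i *m burau_col j =
  ((pos_right i == pos_left j)%:R * t - (pos_right i == pos_right j)%:R
   - ((pos_left i == pos_left j)%:R * t - (pos_left i == pos_right j)%:R))%:M.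
Proof.
rewrite /burau_row /burau_col mulmxBr !mulmxBl -!scalemxAr !mul_delta_mx_cond.
apply/matrixP => a b; rewrite !ord1 !(mxE, mulmxnE) !eqxx /= mulr1n.
by do 4!case: (_ == _); rewrite /= ?mulr1n ?mulr0n; ring.
Qed.

Lemma burau_dyadM i j a : burau_row i *m burau_col j = a%:M ->
  burau_dyad i * burau_dyad j = a *: (burau_col i *m burau_row j).
Proof.
move=> e; rewrite /burau_dyad -[LHS]/(_ *m _) mulmxA -(mulmxA (burau_col i)) e.
by rewrite mul_mx_scalar -scalemxAl.
Qed.

Lemma burau_dyad_sqr i : burau_dyad i * burau_dyad i = - (1 + t) *: burau_dyad i.
Proof.
apply: burau_dyadM; rewrite burau_row_col !eqxx.
have /negbTE lr : pos_left i != pos_right i by rewrite -val_eqE /=; lia.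
by rewrite eq_sym lr /=; congr (_%:M); ring.
Qed.

Lemma burau_dyad_far i j : (i.+1 < j)%N ->
  burau_dyad i * burau_dyad j = 0 /\ burau_dyad j * burau_dyad i = 0.
Proof.
move=> ij; have E (k l : 'I_n) : val k != val l -> (k == l) = false.
  by rewrite val_eqE => /negbTE.
by split; rewrite (@burau_dyadM _ _ 0) ?scale0r // burau_row_col !E /=;
  try lia; congr (_%:M); rewrite /=; ring.
Qed.

(** Together with the quadratic relation these products reduce the braid
    relation to an expression that is symmetric in both generators. *)
Lemma burau_dyad_near i j : j = i.+1 :> nat ->
  burau_dyad i * burau_dyad j * burau_dyad i = t *: burau_dyad i /\
  burau_dyad j * burau_dyad i * burau_dyad j = t *: burau_dyad j.
Proof.
move=> ji; have E (k l : 'I_n) : val k != val l -> (k == l) = false.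
  by rewrite val_eqE => /negbTE.
have eij : pos_right i == pos_left j by rewrite -val_eqE /= ji.
have e1 : burau_row i *m burau_col j = t%:M.
  by rewrite burau_row_col eij !E /=; try lia; congr (_%:M); rewrite /=; ring.
have e2 : burau_row j *m burau_col i = 1%:M.
  by rewrite burau_row_col [pos_left j == pos_right i]eq_sym eij !E /=; try lia; congr (_%:M); rewrite /=; ring.
split.
  rewrite (burau_dyadM e1) -[LHS]/(_ *m _) /burau_dyad -scalemxAl mulmxA.
  by rewrite -(mulmxA (burau_col i)) e2 mulmx1.
rewrite (burau_dyadM e2) scale1r -[LHS]/(_ *m _) /burau_dyad mulmxA.
by rewrite -(mulmxA (burau_col j)) e1 mul_mx_scalar scalemxAl.
Qed.

Lemma burau_cat u v : burau (u ++ v) = burau u * burau v.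
Proof. exact: big_cat. Qed.

Lemma burau_nil : burau [::] = 1.
Proof. exact: big_nil. Qed.

Lemma burau_cons l w : burau (l :: w) = burau_letter l * burau w.
Proof. exact: big_cons. Qed.

Lemma burau_pow w k : burau (flatten (nseq k w)) = burau w ^+ k.
Proof.
elim: k => [|k IH]; first by rewrite burau_nil expr0.
by rewrite /= burau_cat IH exprS.
Qed.

Lemma burau_dyadE i a b : burau_dyad i a b =
  (t * (a == pos_left i)%:R - (a == pos_right i)%:R) *
  ((b == pos_right i)%:R - (b == pos_left i)%:R).
Proof. by rewrite mxE big_ord1 !mxE !eqxx !andbT. Qed.

Lemma one_dyadE (c : J) i a b : (1 + c *: burau_dyad i) a b =
  (a == b)%:R + c * ((t * (a == pos_left i)%:R - (a == pos_right i)%:R) *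
  ((b == pos_right i)%:R - (b == pos_left i)%:R)).
Proof. by rewrite mxE [X in _ + X]mxE [X in X + _]mxE burau_dyadE. Qed.

Lemma burau_letter_sqr i :
  burau [:: (i, true); (i, true)] = 1 + (1 - t) *: burau_dyad i.
Proof.
rewrite !burau_cons burau_nil mulr1 /burau_letter /= !scale1r.
rewrite !(mulrDl, mulrDr, mul1r, mulr1) burau_dyad_sqr -addrA; congr (1 + _).
rewrite scalerBl scaleNr scalerDl scale1r; congr (_ + _).
by rewrite opprD addrA subrr sub0r.
Qed.

Lemma burau_equiv u v : braid_equiv u v -> burau u = burau v.
Proof.
elim=> {u v} [//|u v _ ->//|u v w _ -> _ ->//| | | |].
- by move=> u u' v v' _ IHu _ IHv; rewrite !burau_cat IHu IHv.
- move=> i e; rewrite !burau_cons burau_nil mulr1 /burau_letter /=.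
  set X := burau_dyad i; have XX : X * X = - (1 + t) *: X by exact: burau_dyad_sqr.
  have c a b : a * b = t' -> a + b = 1 + t' -> (1 + a *: X) * (1 + b *: X) = 1.
    move=> ab apb; rewrite mulrDl mul1r mulrDr mulr1 -[_ *: X * _]/(_ *m _).
    rewrite -scalemxAl -scalemxAr -[X *m X]/(X * X) scalerA ab XX.
    rewrite scalerA -addrA -!scalerDl addrA [b + a]addrC apb.
    have -> : 1 + t' + t' * - (1 + t) = 1 - t * t' by ring.
    by rewrite tt' subrr scale0r addr0.
  by case: e; apply: c; rewrite /= ?mul1r ?mulr1 // addrC.
- move=> i j ij; have [XY YX] := burau_dyad_far ij.
  rewrite !burau_cons burau_nil mulr1 /burau_letter /= !scale1r.
  by rewrite !mulrDl !mulrDr !mul1r !mulr1 XY YX !addr0 addrAC.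
- move=> i j ji; have [XYX YXY] := burau_dyad_near ji.
  rewrite !burau_cons burau_nil !mulr1 /burau_letter /= !scale1r.
  have XX := burau_dyad_sqr i; have YY := burau_dyad_sqr j.
  move: (burau_dyad i) (burau_dyad j) XYX YXY XX YY => X Y XYX YXY XX YY.
  have E (a b : 'M[J]_n) : a * a = - (1 + t) *: a -> a * b * a = t *: a ->
      (1 + a) * ((1 + b) * (1 + a)) = 1 + (a + b) + (a * b + b * a).
    move=> aa aba; rewrite !(mulrDl, mulrDr, mul1r, mulr1) mulrA aba aa.
    rewrite scaleNr scalerDl scale1r.
    rewrite -!addrA; congr (1 + (a + (b + _))).
    by rewrite [RHS]addrC; congr (_ + _); rewrite opprD addrA [a + (_ - _)]addrA subrr sub0r addrC addrK.
  by rewrite !E // [Y + X]addrC [Y * X + _]addrC.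
Qed.

Lemma burau_trace_conjugate (b b' : braid_group n) : conjugate_elts b b' ->
  forall w w', b = braid_of_word w -> b' = braid_of_word w' ->
  \tr (burau w) = \tr (burau w').
Proof.
move=> [g bg] w w' bw bw'; rewrite -(word_of_braidK g) in bg.
move: (word_of_braid g) bg => v; rewrite bw bw' /conjg.
rewrite -[(_^-1)%g]/(braid_inv _) braid_inv_word.
rewrite -![(_ * _)%g]/(braid_mul _ _) !braid_mul_word => /braid_of_wordP/burau_equiv ->.
rewrite !burau_cat -[_ * (_ * _)]/(_ *m _) mxtrace_mulC -[_ *m _]/(_ * _) -mulrA.
by rewrite -burau_cat (burau_equiv (word_mul_invV v)) burau_nil mulr1.
Qed.

End Burau.

(** * Second-order jets *)

(** Integral power series in h modulo the third power of h, as the triple of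
    their coefficients. *)
Definition jet : Type := int * int * int.

HB.instance Definition _ := GRing.Zmodule.copy jet (int * int * int)%type.

Section Jets.
Implicit Types x y z : jet.

Definition jet_one : jet := (1, 0, 0).
Definition jet_mul x y : jet :=
  (x.1.1 * y.1.1, x.1.1 * y.1.2 + x.1.2 * y.1.1,
   x.1.1 * y.2 + x.1.2 * y.1.2 + x.2 * y.1.1).

Lemma jet_mulA : associative jet_mul.
Proof. by move=> [[? ?] ?] [[? ?] ?] [[? ?] ?]; congr (_, _, _); rewrite /=; ring. Qed.

Lemma jet_mulC : commutative jet_mul.
Proof. by move=> [[? ?] ?] [[? ?] ?]; congr (_, _, _); rewrite /=; ring. Qed.

Lemma jet_mul1 : left_id jet_one jet_mul.
Proof. by move=> [[? ?] ?]; congr (_, _, _); rewrite /=; ring. Qed.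

Lemma jet_mulDl : left_distributive jet_mul +%R.
Proof. by move=> [[? ?] ?] [[? ?] ?] [[? ?] ?]; congr (_, _, _); rewrite /=; ring. Qed.

Lemma jet_one_neq0 : jet_one != 0.
Proof. by []. Qed.

End Jets.

HB.instance Definition _ := GRing.Zmodule_isComNzRing.Build jet
  jet_mulA jet_mulC jet_mul1 jet_mulDl jet_one_neq0.

Section JetMatrices.
Context {n : nat}.
Implicit Types A B : 'M[jet]_n.

Definition coef0 A : 'M[int]_n := map_mx (fun x : jet => x.1.1) A.
Definition coef1 A : 'M[int]_n := map_mx (fun x : jet => x.1.2) A.
Definition coef2 A : 'M[int]_n := map_mx (fun x : jet => x.2) A.

Lemma coef0M A B : coef0 (A * B) = coef0 A * coef0 B.
Proof.
apply/matrixP => i j; rewrite !mxE (big_morph (fun x : jet => x.1.1) (id1 := 0) (op1 := +%R)) //.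
by apply: eq_bigr => k _; rewrite !mxE.
Qed.

Lemma coef1M A B : coef1 (A * B) = coef0 A * coef1 B + coef1 A * coef0 B.
Proof.
apply/matrixP => i j; rewrite !mxE (big_morph (fun x : jet => x.1.2) (id1 := 0) (op1 := +%R)) //.
by rewrite -big_split; apply: eq_bigr => k _; rewrite !mxE.
Qed.

Lemma coef2M A B : coef2 (A * B) =
  coef0 A * coef2 B + coef1 A * coef1 B + coef2 A * coef0 B.
Proof.
apply/matrixP => i j; rewrite !mxE (big_morph (fun x : jet => x.2) (id1 := 0) (op1 := +%R)) //.
by rewrite -!big_split; apply: eq_bigr => k _; rewrite !mxE.
Qed.

Lemma coef_one : [/\ coef0 1 = 1, coef1 1 = 0 & coef2 1 = 0].
Proof. by split; apply/matrixP => i j; rewrite !mxE; case: (_ == _). Qed.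

Lemma coef1_trace A : (\tr A).1.2 = \tr (coef1 A).
Proof.
rewrite /mxtrace (big_morph (fun x : jet => x.1.2) (id1 := 0) (op1 := +%R)) //.
by apply: eq_bigr => k _; rewrite !mxE.
Qed.

Lemma coef2_trace A : (\tr A).2 = \tr (coef2 A).
Proof.
rewrite /mxtrace (big_morph (fun x : jet => x.2) (id1 := 0) (op1 := +%R)) //.
by apply: eq_bigr => k _; rewrite !mxE.
Qed.

(** Binomial expansion, the square of the nilpotent part being seen only
    through its leading term. *)
Lemma coefs_pow A k : coef0 A = 1 ->
  [/\ coef0 (A ^+ k) = 1, coef1 (A ^+ k) = coef1 A *+ k
    & coef2 (A ^+ k) = coef2 A *+ k + (coef1 A * coef1 A) *+ 'C(k, 2)].
Proof.
move=> A0; have [c0 c1 c2] := coef_one.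
elim: k => [|k [E0 E1 E2]]; first by rewrite expr0 c0 c1 c2 !mulr0n addr0.
rewrite exprSr; split.
- by rewrite coef0M E0 A0 mulr1.
- by rewrite coef1M E0 E1 A0 mul1r mulr1 mulrSr addrC.
- rewrite coef2M E0 E1 E2 A0 mul1r mulr1 mulrnAl binS bin1 mulrSr mulrnDr.
  by rewrite [LHS]addrC addrACA.
Qed.

Lemma bin2_int k : 2 * 'C(k, 2)%:R = k%:R ^+ 2 - k%:R :> int.
Proof.
rewrite -natrM mulnC bin2 -[X in (X * 2)%N]divn2 divnK.
  by case: k => [|j]; rewrite ?mul0n //= natrM -natr1; ring.
by rewrite dvdn2 oddM; case: k => //= j; rewrite andNb.
Qed.

(** Modulo the third power of h the powers of K are polynomial in the exponent;
    in the trace, the leading coefficients of these polynomials involve nothing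
    of K beyond its first-order part. The factor 2 clears the denominator of
    the binomial coefficient. *)
Lemma jet_conjugates (U V K L : 'M[jet]_n)
    (A := coef0 U) (B := coef0 V) (X := coef1 K) : coef0 K = 1 ->
  [/\ coef0 L = 1, coef1 L = - coef1 K & coef2 L = coef1 K * coef1 K - coef2 K] ->
  exists d0 e0 e1 : int, forall k,
  (\tr (U * K ^+ k * (V * L ^+ k))).1.2 =
    d0 + (\tr (A * X * B) - \tr (A * B * X)) * k%:R /\
  2 * (\tr (U * K ^+ k * (V * L ^+ k))).2 = e0 + e1 * k%:R +
    (\tr (A * (X * X) * B) + \tr (A * B * (X * X)) - 2 * \tr (A * X * B * X)) * k%:R ^+ 2.
Proof.
move=> K0 [L0 L1 L2].
pose U1 := coef1 U; pose V1 := coef1 V; pose U2 := coef2 U; pose V2 := coef2 V.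
pose Y := coef2 K.
exists (\tr (A * V1) + \tr (U1 * B)), (2 * (\tr (A * V2) + \tr (U1 * V1) + \tr (U2 * B))).
exists (2 * (\tr (A * B * (X * X)) - \tr (A * B * Y) + \tr (A * Y * B) - \tr (A * V1 * X)
  + \tr (A * X * V1) - \tr (U1 * B * X) + \tr (U1 * X * B))
  - \tr (A * B * (X * X)) - \tr (A * (X * X) * B)).
move=> k; have [P0 P1 P2] := coefs_pow k K0; have [Q0 Q1 Q2] := coefs_pow k L0.
have C2 := bin2_int k; set C := 'C(k, 2) in P2 Q2 C2 *.
rewrite coef1_trace coef2_trace.
rewrite coef2M !coef1M !coef2M !coef0M P0 P1 P2 Q0 Q1 Q2 L1 L2.
rewrite -/A -/B -/X -/Y -/U1 -/V1 -/U2 -/V2 !mulr1 mulNrn mulrNN.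
move: A B X Y U1 V1 U2 V2 => A B X Y U1 V1 U2 V2; move: (X * X) => XX.
have trN (M : 'M[int]_n) : \tr (- M) = - \tr M by exact: raddfN.
have trMn (M : 'M[int]_n) j : \tr (M *+ j) = \tr M * j%:R.
  by rewrite raddfMn mulr_natr.
have expand := (mulrDl, mulrDr, mulrN, mulNr, mulrnAl, mulrnAr, mulrnDl).
split.
  set rhs := (X in _ = X).
  by rewrite !expand !mulrA !(mxtraceD, trN, trMn) {}/rhs; ring.
set T := \tr _; have -> : T = \tr (A * B * XX) * k%:R - \tr (A * B * Y) * k%:R +
    \tr (A * B * XX) * C%:R - \tr (A * V1 * X) * k%:R + \tr (A * V2)
    - \tr (A * X * B * X) * k%:R * k%:R + \tr (A * X * V1) * k%:R
    - \tr (U1 * B * X) * k%:R + \tr (U1 * V1) + \tr (A * Y * B) * k%:R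
    + \tr (A * XX * B) * C%:R + \tr (U1 * X * B) * k%:R + \tr (U2 * B).
  rewrite {}/T; set c := C; set rhs := (X in _ = X).
  rewrite !expand !mulrA !(mxtraceD, trN, trMn) {}/rhs; ring.
by ring: C2.
Qed.

End JetMatrices.

(** * The expansion of the Burau matrices at the trivial parameter *)

Section BurauJets.
Context {n : nat} (n_ge4 : (4 <= n)%N).
Implicit Types (i : 'I_n.-1) (k l : 'I_n) (w : braid_word n) (s : 'S_n).

(** The parameter 1 + h: at h = 0 the Burau matrices are those of the
    permutations. *)
Definition jet_t : jet := (1, 1, 0).
Definition jet_t' : jet := (1, -1, 1).

Lemma jet_tV : jet_t * jet_t' = 1.
Proof. by []. Qed.

Definition burau_jet w : 'M[jet]_n := burau jet_t jet_t' w.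

Lemma coef0_letter (x : braid_letter n) :
  coef0 (burau_letter jet_t jet_t' x) = perm_mx (letter_perm x).
Proof.
case: x => i e; apply/matrixP => a b; rewrite mxE one_dyadE !mxE /letter_perm /=.
have /negbTE lr : pos_left i != pos_right i by rewrite -val_eqE /=; lia.
have rl : (pos_right i == pos_left i) = false by rewrite eq_sym.
have [ea|al] := eqVneq a (pos_left i); [|have [ea|ar] := eqVneq a (pos_right i)].
- rewrite ea tpermL lr /= [pos_right i == b]eq_sym [pos_left i == b]eq_sym.
  by have [->|] := eqVneq b (pos_right i); rewrite ?rl; case: (b == pos_left i); case: e.
- rewrite ea tpermR /= [pos_right i == b]eq_sym [pos_left i == b]eq_sym.
  by have [->|] := eqVneq b (pos_right i); rewrite ?rl; case: (b == pos_left i); case: e.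
- rewrite tpermD 1?eq_sym // /=.
  by case: (b == a); case: (b == pos_right i); case: (b == pos_left i); case: e.
Qed.

Lemma coef0_burau w : coef0 (burau_jet w) = perm_mx (word_perm w).
Proof.
rewrite /burau_jet; elim: w => [|x w IH]; first by rewrite burau_nil word_perm_nil perm_mx1; have [] := @coef_one n.
by rewrite burau_cons coef0M IH coef0_letter word_perm_cons perm_mxM.
Qed.

(** The Laplacian of the graph with the single edge from k to l. *)
Definition edge_laplacian k l : 'M[int]_n :=
  let d : 'cV[int]_n := delta_mx k 0 - delta_mx l 0 in d *m d^T.

Lemma edge_laplacianE k l a b : edge_laplacian k l a b =
  ((a == k)%:R - (a == l)%:R) * ((b == k)%:R - (b == l)%:R).
Proof. by rewrite mxE big_ord1 !mxE !eqxx !andbT. Qed.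

Lemma coef1_letter_sqr i : coef1 (burau_jet [:: (i, true); (i, true)]) =
  edge_laplacian (pos_left i) (pos_right i).
Proof.
rewrite /burau_jet (burau_letter_sqr jet_t jet_t' i).
apply/matrixP => a b; rewrite mxE one_dyadE edge_laplacianE.
by case: (a == b); case: (a == pos_left i); case: (b == pos_left i);
  case: (a == pos_right i); case: (b == pos_right i).
Qed.

Lemma edge_laplacian_conj s k l :
  perm_mx s * edge_laplacian k l * perm_mx s^-1 =
  edge_laplacian ((s^-1)%g k) ((s^-1)%g l).
Proof.
have pd m : perm_mx s *m (delta_mx m 0 : 'cV[int]_n) = delta_mx ((s^-1)%g m) 0.
  apply/matrixP => a b; rewrite -row_permE !mxE !ord1 !eqxx !andbT.
  by rewrite -(inj_eq (@perm_inj _ s) a) permKV.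
rewrite -[_ * _]/(_ *m _) -[perm_mx s * _]/(_ *m _) -tr_perm_mx /edge_laplacian /=.
by rewrite mulmxA -mulmxA -trmx_mul mulmxBr !pd.
Qed.

(** Writing the word as nested conjugates of squares of generators shows that
    every square contributes, to first order, its edge moved by a permutation:
    the edges obtained form a star around the first position. *)
Lemma coef1_ascending_descending k0 (s : seq 'I_n.-1) m :
  k0 = 0%N :> nat -> map val s = iota 0 m ->
  coef1 (burau_jet (positive_word s ++ positive_word (rev s))) =
  \sum_(i <- s) edge_laplacian k0 (pos_right i).
Proof.
move=> k00; elim/last_ind: s m => [|s i IH] m.
  by rewrite big_nil /burau_jet burau_nil; have [] := @coef_one n.
rewrite map_rcons => sm; have ms : m = (size s).+1.
  by rewrite -(size_iota 0 m) -sm size_rcons size_map.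
move: sm; rewrite {}ms -addn1 iotaD add0n cats1 => /rcons_inj[si ri].
have [e _ _ fx] := ascending_word n_ge4 si k00; rewrite add0n in e fx.
rewrite rev_rcons big_rcons /= -(IH _ si) positive_word_rcons -catA.
have -> : [:: (i, true)] ++ positive_word (i :: rev s) =
    [:: (i, true); (i, true)] ++ positive_word (rev s) by [].
rewrite /burau_jet !burau_cat -!/(burau_jet _) coef1M coef1M coef0M coef1_letter_sqr.
have -> : coef0 (burau_jet [:: (i, true); (i, true)]) = 1.
  by rewrite coef0_burau word_perm_cons word_perm_cons word_perm_nil mulg1 tperm2 perm_mx1.
rewrite !mul1r coef1M mulrDr addrAC; congr (_ + _).
rewrite !coef0_burau word_perm_rev mulrA edge_laplacian_conj; congr edge_laplacian.
  by apply: (@perm_inj _ (word_perm (positive_word s))); rewrite permKV; apply: val_inj; rewrite /= e ri.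
by apply: (@perm_inj _ (word_perm (positive_word s))); rewrite permKV fx //= ri.
Qed.

End BurauJets.

(** * Traces of the exchange braids *)

Definition mat3 (s : seq (seq int)) : 'M[int]_3 := \matrix_(i, j) (nth [::] s i)`_j.

(** Products computed entry by entry keep the terms of the traces few enough for
    a ring normalization. *)
Lemma mat3M a b c d e f g h i a' b' c' d' e' f' g' h' i' :
  mat3 [:: [:: a; b; c]; [:: d; e; f]; [:: g; h; i]] *m
  mat3 [:: [:: a'; b'; c']; [:: d'; e'; f']; [:: g'; h'; i']] =
  mat3 [:: [:: a * a' + b * d' + c * g'; a * b' + b * e' + c * h'; a * c' + b * f' + c * i'];
           [:: d * a' + e * d' + f * g'; d * b' + e * e' + f * h'; d * c' + e * f' + f * i'];
           [:: g * a' + h * d' + i * g'; g * b' + h * e' + i * h'; g * c' + h * f' + i * i']].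
Proof.
apply/matrixP => j k; rewrite !mxE !big_ord_recl big_ord0 !mxE addr0 !addrA.
by case: j => [[|[|[|//]]] ?]; case: k => [[|[|[|//]]] ?].
Qed.

Lemma mat3_trace a b c d e f g h i :
  \tr (mat3 [:: [:: a; b; c]; [:: d; e; f]; [:: g; h; i]]) = a + e + i.
Proof. by rewrite /mxtrace !big_ord_recl big_ord0 !mxE /= addr0 addrA. Qed.

Section ExchangeTraces.
Context {n : nat} (n_ge4 : (4 <= n)%N) (k0 kl : 'I_n).
Hypotheses (k00 : k0 = 0%N :> nat) (kl1 : kl = n.-1 :> nat).
Implicit Types (s : 'S_n) (u v w : braid_word n).

Lemma first_neq_last : (k0 == kl) = false.
Proof. by apply/negbTE; rewrite -val_eqE /= k00 kl1; lia. Qed.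

(** The columns are the first and the last basis vectors e and f, and the vector
    1 of ones, which comes from the default value. *)
Definition end_vectors : 'M[int]_(n, 3) :=
  \matrix_(i, j) (nth true [:: i == k0; i == kl] j)%:R.

(** The coefficients of n ee^T - e1^T - 1e^T - (e - f)(e - f)^T. *)
Definition star_form : 'M[int]_3 :=
  mat3 [:: [:: n%:R - 1; 1; -1]; [:: 1; -1; 0]; [:: -1; 0; 0]].

Definition star_defect : 'M[int]_n := end_vectors *m star_form *m end_vectors^T.

Lemma sum_indicator (f : 'I_n -> int) k : \sum_i (i == k)%:R * f i = f k.
Proof.
rewrite (bigD1 k) //= eqxx mul1r big1 ?addr0 // => i /negbTE ->.
by rewrite mul0r.
Qed.

Lemma sum_star (F : 'I_n -> int) :
  \sum_(i <- @kappa_gens n) F (pos_right i) = \sum_j F j - F k0 - F kl.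
Proof.
rewrite /kappa_gens big_filter big_enum_cond /=.
have E : \sum_(i : 'I_n.-1) F (pos_right i) = \sum_j F j - F k0.
  case: n k0 k00 F => [[] //|p] k k0' F.
  have -> : k = ord0 by exact: val_inj.
  rewrite big_ord_recl addrC addKr; apply: eq_bigr => i _; congr F; exact: val_inj.
rewrite -E; have mP : (n.-2 < n.-1)%N by lia.
rewrite [in RHS](bigD1 (Ordinal mP)) //=.
have -> : pos_right (Ordinal mP) = kl by apply: val_inj; rewrite /= kl1; lia.
rewrite [RHS]addrC addKr; apply: eq_bigl => i; rewrite -val_eqE /=.
have := ltn_ord i; lia.
Qed.

(** Every leaf of the star contributes 1 to the diagonal; this leaves the edges
    and the corrections at the centre and at the last position, which is not in
    the star. *)
Lemma coef1_kappa : coef1 (burau_jet (@kappa_word n)) = 1 + star_defect.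
Proof.
rewrite (coef1_ascending_descending n_ge4 k00 (kappa_gensE n_ge4)).
apply/matrixP => a b; rewrite summxE.
rewrite (sum_star (fun j => edge_laplacian k0 j a b)).
under eq_bigr => j _ do rewrite edge_laplacianE mulrBl !mulrBr [a == j]eq_sym [b == j]eq_sym.
rewrite !sumrB !sum_indicator sumr_const card_ord -!mulr_sumr.
rewrite !edge_laplacianE !subrr mul0r subr0.
have -> : \sum_i (i == b)%:R = 1 :> int.
  by rewrite -[RHS](sum_indicator (fun=> 1) b); apply: eq_bigr => i _; rewrite mulr1.
rewrite -[_ *+ n]mulr_natr mxE [X in _ = X + _]mxE /star_defect mxE.
rewrite !big_ord_recl big_ord0 !mxE !big_ord_recl !big_ord0 !mxE /=.
move: (a == b) (a == k0) (a == kl) (b == k0) (b == kl) (n%:R : int) => ab a0 al b0 bl N.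
by move: (ab%:R : int) (a0%:R : int) (al%:R : int) (b0%:R : int) (bl%:R : int) => *; ring.
Qed.

Definition gram s : 'M[int]_3 :=
  mat3 [:: [:: (s k0 == k0)%:R; (s k0 == kl)%:R; 1];
           [:: (s kl == k0)%:R; (s kl == kl)%:R; 1]; [:: 1; 1; n%:R]].

Lemma gramE s : end_vectors^T *m perm_mx s *m end_vectors = gram s.
Proof.
rewrite -mulmxA -row_permE; apply/matrixP => i j; rewrite mxE.
under eq_bigr => k _ do rewrite !mxE.
have si k : \sum_i (s i == k)%:R = 1 :> int.
  rewrite (reindex_inj (@perm_inj _ (s^-1)%g)) /=.
  rewrite -[RHS](sum_indicator (fun=> 1) k); apply: eq_bigr => m _.
  by rewrite permKV mulr1.
case: i => [[|[|[|//]]] ?]; case: j => [[|[|[|//]]] ?]; rewrite mxE /= ?sum_indicator //.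
all: under eq_bigr => k _ do rewrite mul1r; by rewrite ?si // sumr_const card_ord.
Qed.

(** As the defect factors through the three vectors, the traces reduce to those
    of 3 x 3 matrices. *)
Lemma trace_defect s : \tr (perm_mx s * star_defect) = \tr (gram s *m star_form).
Proof.
by rewrite -gramE -[_ * _]/(_ *m _) /star_defect !mulmxA mxtrace_mulC !mulmxA.
Qed.

Lemma trace_defect_defect s s' :
  \tr (perm_mx s * star_defect * perm_mx s' * star_defect) =
  \tr (gram s *m star_form *m gram s' *m star_form).
Proof.
rewrite -!gramE -![_ * _]/(_ *m _) /star_defect !mulmxA mxtrace_mulC.
by rewrite !mulmxA.
Qed.

Section Coefficients.
Variables (a b : 'S_n).
Hypotheses (al : a kl = kl) (b0 : b k0 = k0) (an : a k0 != k0) (bn : b kl != kl).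

Let A : 'M[int]_n := perm_mx a.
Let B : 'M[int]_n := perm_mx b.
Let X : 'M[int]_n := 1 + star_defect.

Lemma gram_values : [/\ gram 1 = mat3 [:: [:: 1; 0; 1]; [:: 0; 1; 1]; [:: 1; 1; n%:R]],
  gram a = mat3 [:: [:: 0; 0; 1]; [:: 0; 1; 1]; [:: 1; 1; n%:R]],
  gram b = mat3 [:: [:: 1; 0; 1]; [:: 0; 0; 1]; [:: 1; 1; n%:R]],
  gram (a * b) = mat3 [:: [:: 0; (b (a k0) == kl)%:R; 1]; [:: 0; 0; 1]; [:: 1; 1; n%:R]]
  & gram (b * a) = mat3 [:: [:: 0; 0; 1]; [:: (a (b kl) == k0)%:R; 0; 1]; [:: 1; 1; n%:R]]].
Proof.
have F := first_neq_last; have F' : (kl == k0) = false by rewrite eq_sym.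
have a0l : (a k0 == kl) = false by rewrite -[X in _ == X]al (inj_eq perm_inj).
have bl0 : (b kl == k0) = false by rewrite -[X in _ == X]b0 (inj_eq perm_inj).
have ab0 : (b (a k0) == k0) = false.
  by rewrite -[X in _ == X]b0 (inj_eq perm_inj) (negbTE an).
have bal : (a (b kl) == kl) = false.
  by rewrite -[X in _ == X]al (inj_eq perm_inj) (negbTE bn).
split; rewrite /gram ?permM ?perm1 ?al ?b0 ?F ?F' ?a0l ?bl0 ?ab0 ?bal;
  by rewrite ?eqxx ?(negbTE an) ?(negbTE bn).
Qed.

(** The first-order coefficient of the trace moves by the difference of the
    two indicators on the right with every exchange move. *)
Lemma trace_slope : \tr (A * X * B) - \tr (A * B * X) =
  (a (b kl) == k0)%:R - (b (a k0) == kl)%:R.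
Proof.
rewrite /X !(mulrDl, mulrDr, mulr1) !mxtraceD.
have -> : \tr (A * star_defect * B) = \tr (perm_mx (b * a) * star_defect).
  rewrite perm_mxM -[A * star_defect * B]/(_ *m _) mxtrace_mulC.
  by rewrite -[B *m (A * _)]/(B * (A * _)) mulrA.
have -> : A * B = perm_mx (a * b) by rewrite perm_mxM.
rewrite !trace_defect; have [_ _ _ -> ->] := gram_values.
rewrite !mat3M !mat3_trace.
move: (\tr _) ((a (b kl) == k0)%:R : int) ((b (a k0) == kl)%:R : int) => p x y.
by ring.
Qed.

(** The coefficient of k^2 in twice the second-order part of the trace. When
    the two indicators agree it is -2 or 2 n - 6. *)
Lemma trace_curvature :
  \tr (A * (X * X) * B) + \tr (A * B * (X * X)) - 2 * \tr (A * X * B * X) =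
  (n%:R - 2) * ((a (b kl) == k0)%:R + (b (a k0) == kl)%:R) - 2.
Proof.
pose R := star_defect.
have -> : \tr (A * (X * X) * B) + \tr (A * B * (X * X)) - 2 * \tr (A * X * B * X) =
    \tr (A * (R * R) * B) + \tr (A * B * (R * R)) - 2 * \tr (A * R * B * R).
  rewrite /X -/R !(mulrDl, mulrDr, mulr1, mul1r) !mxtraceD !mulrA.
  by move: (\tr _) (\tr _) (\tr _) (\tr _) (\tr _) (\tr _) => *; ring.
have -> : \tr (A * (R * R) * B) = \tr (perm_mx (b * a) * R * perm_mx 1 * R).
  rewrite perm_mx1 perm_mxM mulr1 -[A * (R * R) * B]/(_ *m _) mxtrace_mulC.
  by rewrite -[B *m (A * _)]/(B * (A * _)) !mulrA.
have -> : A * B * (R * R) = perm_mx (a * b) * R * perm_mx 1 * R.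
  by rewrite perm_mx1 mulr1 perm_mxM !mulrA.
rewrite !trace_defect_defect; have [-> -> -> -> ->] := gram_values.
rewrite !mat3M !mat3_trace.
move: ((a (b kl) == k0)%:R : int) ((b (a k0) == kl)%:R : int) => x y.
by ring.
Qed.

End Coefficients.

(** The inverse of the power is written as a power of the inverse, so that both
    have jets of the same kind. *)
Definition exchange_pow_word u v k : braid_word n :=
  u ++ flatten (nseq k (@kappa_word n)) ++ v ++ flatten (nseq k (word_inv (@kappa_word n))).

Lemma coefs_kappa_inv (K := burau_jet (@kappa_word n)) (L := burau_jet (word_inv (@kappa_word n))) :
  [/\ coef0 L = 1, coef1 L = - coef1 K & coef2 L = coef1 K * coef1 K - coef2 K].
Proof.
have K0 : coef0 K = 1 by rewrite (coef0_burau n_ge4) word_perm_kappa perm_mx1.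
have KL : K * L = 1.
  rewrite /K /L /burau_jet -burau_cat (burau_equiv jet_tV (word_mul_invV _)).
  exact: burau_nil.
have [c0 c1 c2] := @coef_one n.
have L0 : coef0 L = 1 by have := congr1 coef0 KL; rewrite coef0M c0 K0 mul1r.
have L1 : coef1 L = - coef1 K.
  have := congr1 coef1 KL; rewrite coef1M c1 K0 L0 mul1r mulr1 => /eqP.
  by rewrite addr_eq0 => /eqP.
split=> //; have := congr1 coef2 KL; rewrite coef2M c2 K0 L0 L1 mul1r mulr1 mulrN.
by rewrite -addrA => /eqP; rewrite addr_eq0 opprD opprK => /eqP.
Qed.

Lemma exchange_coefs u v (A := perm_mx (word_perm u)) (B := perm_mx (word_perm v))
    (X := 1 + star_defect) : exists d0 e0 e1 : int, forall k,
  (\tr (burau_jet (exchange_pow_word u v k))).1.2 =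
    d0 + (\tr (A * X * B) - \tr (A * B * X)) * k%:R /\
  2 * (\tr (burau_jet (exchange_pow_word u v k))).2 = e0 + e1 * k%:R +
    (\tr (A * (X * X) * B) + \tr (A * B * (X * X)) - 2 * \tr (A * X * B * X)) * k%:R ^+ 2.
Proof.
rewrite /A /B /X -coef1_kappa -!(coef0_burau n_ge4) => {A B X}.
have [d0 [e0 [e1 H]]] := jet_conjugates (burau_jet u) (burau_jet v)
  (etrans (coef0_burau n_ge4 _) (etrans (congr1 perm_mx word_perm_kappa) (perm_mx1 _ _)))
  coefs_kappa_inv.
exists d0, e0, e1 => k; have {}H := H k; suff -> : burau_jet (exchange_pow_word u v k) =
  burau_jet u * burau_jet (@kappa_word n) ^+ k *
  (burau_jet v * burau_jet (word_inv (@kappa_word n)) ^+ k) by exact: H.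
rewrite /burau_jet /exchange_pow_word (burau_cat _ _ u) (burau_cat _ _ (flatten _)).
by rewrite (burau_cat _ _ v) !burau_pow mulrA.
Qed.

End ExchangeTraces.

(** * Infinitely many conjugacy classes *)

(** Distinct arguments with the same value satisfy k + k' = - c1 / c2. *)
Lemma quadratic_inj (c0 c1 c2 : int) (k k' : nat) : c2 != 0 ->
  (absz c1 < k)%N -> (absz c1 < k')%N ->
  c0 + c1 * k%:R + c2 * k%:R ^+ 2 = c0 + c1 * k'%:R + c2 * k'%:R ^+ 2 -> k = k'.
Proof.
move=> c2n kc kc' e; have {e}/eqP : (k%:R - k'%:R) * (c1 + c2 * (k + k')%:R) = 0 :> int.
  transitivity (c0 + c1 * k%:R + c2 * k%:R ^+ 2 - (c0 + c1 * k'%:R + c2 * k'%:R ^+ 2)).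
    by rewrite natrD; ring.
  by rewrite e subrr.
rewrite mulf_eq0 subr_eq0 => /orP[/eqP|]; first by rewrite !natz; lia.
rewrite addr_eq0 => /eqP e; have := congr1 absz e.
rewrite abszN abszM natz /= => e'; have := leq_pmull (k + k') (_ : 0 < absz c2)%N.
by rewrite absz_gt0 => /(_ c2n); lia.
Qed.

Lemma infinite_large (N : nat) : infinite_set [set m : int | exists2 k : nat, m = k & (N < k)%N].
Proof.
move=> finM; apply: infinite_nat.
rewrite (_ : setT = (fun k : nat => (N.+1 + k)%N%:Z) @^-1` [set m : int | exists2 k : nat, m = k & (N < k)%N]).
  by apply: finite_preimage finM => k k' _ _ [/addnI].
by apply/esym/seteqP; split=> // k _; exists (N.+1 + k)%N => //; rewrite ltnS leq_addr.
Qed.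

Section Conclusion.
Context {n : nat} (n_ge4 : (4 <= n)%N).

Lemma exchange_pow_wordE (u v : braid_word n) (k : nat) :
  exchange_move (braid_of_word u) (braid_of_word v) k =
  braid_of_word (exchange_pow_word u v k).
Proof.
have E w : braid_of_word (flatten (nseq k w)) = (@braid_of_word n w ^+ k)%g.
  elim: k => [|k IH]; first by rewrite expg0.
  by rewrite expgS -IH braid_of_wordM.
rewrite /exchange_move /exchange_pow_word -!braid_of_wordM !E -braid_of_wordV -kappaE.
by rewrite zpowN /= expVgn !mulgA.
Qed.

Lemma word_perm_fixed (w : braid_word n) k :
  all (fun x : braid_letter n => (k != pos_left x.1) && (k != pos_right x.1)) w ->
  word_perm w k = k.
Proof.
elim: w => [|x w IH] /=; first by rewrite word_perm_nil perm1.
move=> /andP[/andP[kL kR] /IH wk].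
by rewrite word_perm_cons permM /letter_perm tpermD // eq_sym.
Qed.

(** The first coefficient separates the braids unless the two indicators in its
    slope agree; if they do, the second coefficient is a quadratic polynomial,
    since -2 and 2 n - 6 do not vanish for n > 3. *)
Lemma exchange_not_conjugate (u v : braid_word n) : on_first u -> on_last v ->
  (forall k : 'I_n, k = 0%N :> nat -> word_perm (u ++ v) k <> k) ->
  (forall k : 'I_n, k = n.-1 :> nat -> word_perm (u ++ v) k <> k) ->
  exists N : nat, forall k k' : nat, (N < k)%N -> (N < k')%N ->
  conjugate_elts (exchange_move (braid_of_word u) (braid_of_word v) k)
    (exchange_move (braid_of_word u) (braid_of_word v) k') -> k = k'.
Proof.
move=> uf vl p0 pl.
have n0 : (0 < n)%N by lia.
have nl : (n.-1 < n)%N by lia.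
pose k0 := Ordinal n0; pose kl := Ordinal nl.
have k00 : k0 = 0%N :> nat by []. have kl1 : kl = n.-1 :> nat by [].
have al : word_perm u kl = kl.
  apply/word_perm_fixed; apply: sub_all uf => x /= xn.
  by rewrite -!val_eqE /=; apply/andP; split; lia.
have b0 : word_perm v k0 = k0.
  apply/word_perm_fixed; apply: sub_all vl => x /= xn.
  by rewrite -!val_eqE /=; apply/andP; split; lia.
have an : word_perm u k0 != k0.
  by apply/eqP => e; case: (p0 k0 erefl); rewrite word_perm_cat permM e b0.
have bn : word_perm v kl != kl.
  by apply/eqP => e; case: (pl kl erefl); rewrite word_perm_cat permM al e.
have [d0 [e0 [e1 T]]] := exchange_coefs n_ge4 k00 kl1 u v.
exists (absz e1) => k k' ke ke' kk'.
have := burau_trace_conjugate jet_tV kk' (exchange_pow_wordE u v k) (exchange_pow_wordE u v k').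
rewrite -!/(burau_jet _) => tr_eq.
have [T1 T2] := T k; have [T1' T2'] := T k'.
have := trace_slope n_ge4 k00 kl1 al b0 an bn.
have := trace_curvature n_ge4 k00 kl1 al b0 an bn.
move=> curv slope; rewrite tr_eq T1' slope in T1; rewrite tr_eq T2' curv in T2.
have [xy|xy] := eqVneq (word_perm u (word_perm v kl) == k0) (word_perm v (word_perm u k0) == kl).
  apply/esym; apply: quadratic_inj ke' ke T2.
  by rewrite xy; case: (_ == kl); rewrite natz; apply/eqP; lia.
by move: T1 xy; do 2!case: (_ == _) => //; rewrite !natz => /eqP; rewrite -!natz; lia.
Qed.

End Conclusion.

Theorem theorem1p1 (R : realType) (n : nat) (n_ge4 : (4 <= n)%N)
    (L : oriented_link R) (b alpha beta : braid_group n)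
    (b_closure : is_closure b L)
    (b_exchange : b = (alpha * beta)%g)
    (alpha_first : @first_strands_subgroup n alpha)
    (beta_last : @last_strands_subgroup n beta)
    (perm_first : forall k : 'I_n, k = 0%N :> nat -> braid_perm b k <> k)
    (perm_last : forall k : 'I_n, k = n.-1 :> nat -> braid_perm b k <> k) :
  (forall m : int, is_closure (exchange_move alpha beta m) L) /\
  exists M : set int, infinite_set M /\
    forall m m' : int, M m -> M m' -> m <> m' ->
      ~ conjugate_elts (exchange_move alpha beta m) (exchange_move alpha beta m').
Proof.
move: perm_first perm_last b_closure; rewrite {}b_exchange.
have [u uf ->] := generated_words alpha_first.
have [v vl ->] := generated_words beta_last.
rewrite braid_of_wordM braid_perm_word => p0 pl cl; split=> [m|].
  exact: exchange_closure.
have [N HN] := exchange_not_conjugate n_ge4 uf vl p0 pl.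
exists [set m : int | exists2 k : nat, m = k & (N < k)%N].
split; first exact: infinite_large.
by move=> _ _ [k -> Nk] [k' -> Nk'] kk' /(HN _ _ Nk Nk') e; case: kk'; rewrite e.
Qed.
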